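(* Let $$\tilde\Gamma=\Bigl\{z=x+iy\in\mathbb{C}^{n+1}\ :\ x_{n+1}=x_1x_2+x_1\sum_{j=3}^n x_j^2,\ x_1>0\Bigr\},$$ let $p_0=(1,0,\ldots,0)\in\tilde\Gamma$, and let $I_{p_0}$ be the group of all (local) biholomorphic automorphisms of $\tilde\Gamma$ defined in a neighbourhood of $p_0$ and preserving $p_0$. Then the Lie algebra $\mathfrak{is}_{p_0}$ of the group $I_{p_0}$ is generated by the following $n^2-4n+7$ holomorphic vector fields $Y_{2n+2},\ldots,Y_{n^2-2n+8}$: $$Y_{2n+2}=2z_2\frac{\partial}{\partial z_2}+2z_{n+1}\frac{\partial}{\partial z_{n+1}}+\sum_{j=3}^n z_j\frac{\partial}{\partial z_j};$$ $$R_{j,k}=z_k\frac{\partial}{\partial z_j}-z_j\frac{\partial}{\partial z_k},\quad 3\le j<k\le n,\ \text{ forming } Y_{2n+3},\ldots,Y_{\frac{n^2-n+10}{2}};$$ $$I_{j,k}=i z_k\frac{\partial}{\partial z_j}+i z_j\frac{\partial}{\partial z_k},\quad 3\le j<k\le n,\ \text{ forming } Y_{\frac{n^2-n+12}{2}},\ldots,Y_{n^2-3n+8};$$ $$Y_{n^2-3n+6+j}=-i z_j^2\frac{\partial}{\partial z_2}+i z_j\frac{\partial}{\partial z_j},\quad j=3,\ldots,n,\ \text{ forming } Y_{n^2-3n+9},\ldots,Y_{n^2-2n+6};$$ $$Y_{n^2-2n+7}=2i(z_1-1)\frac{\partial}{\partial z_2}+i(z_1^2-1)\frac{\partial}{\partial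 z_{n+1}};$$ $$Y_{n^2-2n+8}=\frac{i}{2}(z_1^2-1)\frac{\partial}{\partial z_1}+i z_{n+1}\frac{\partial}{\partial z_2}+i z_1z_{n+1}\frac{\partial}{\partial z_{n+1}}.$$
   Context: Here $n\ge 3$ and coordinates on $\mathbb{C}^{n+1}$ are $z_j=x_j+iy_j$, $j=1,\ldots,n+1$. A local biholomorphic automorphism of $\tilde\Gamma$ at $p_0$ is a (germ of a) biholomorphic map between neighbourhoods of $p_0$ mapping $\tilde\Gamma$ into itself. The group $I_{p_0}$, with the topology of uniform convergence on compact subsets of the derivatives of all orders of the component functions, has the structure of a real algebraic group. Elements of its Lie algebra are represented by germs at $p_0$ of holomorphic vector fields. The indices $Y_1,\ldots,Y_{2n+1}$ are reserved for vector fields acting transitively on $\tilde\Gamma$ and are not part of the list.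
   Formalization: The printed I_{j,k} = i z_k ∂/∂z_j + i z_j ∂/∂z_k is not tangent to Γ̃, so the claim fails for n ≥ 4; the formal statement uses I_{j,k} = −2i z_j z_k ∂/∂z_2 + i z_k ∂/∂z_j + i z_j ∂/∂z_k instead. *)

(* Defs.v *)
From HB Require Import structures.
From mathcomp Require Import all_boot all_order all_algebra.
From mathcomp Require Import complex.
From mathcomp Require Import all_classical all_reals all_analysis.
Set Implicit Arguments.
Unset Strict Implicit.
Unset Printing Implicit Defensive.
Import Order.TTheory GRing.Theory Num.Theory.
Import numFieldNormedType.Exports.
Local Open Scope classical_set_scope.
Local Open Scope ring_scope.

(* The norm topology and normed-module structure of R[i] as a numFieldType,
   which the library attaches to R[i]^o only. *)
HB.instance Definition _ (R : realType) := NormedModule.copy R[i] (R[i]^o).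
HB.instance Definition _ (R : realType) := GRing.ComAlgebra.copy R[i] (R[i]^o).
HB.instance Definition _ (R : realType) := Vector.copy R[i] (R[i]^o).

(* C^(n+1) is the type of rows of length n.+1.  Coordinates are numbered from
   1 to n+1, so that the j-th coordinate sits at the ordinal j.-1; [crd z j]
   and [dd R n j] are meaningful for 1 <= j <= n.+1 only. *)
Definition crd (R : realType) (n : nat) (z : 'rV[R[i]]_n.+1) (j : nat) : R[i] :=
  z ord0 (inord j.-1).

(* The j-th standard basis vector, i.e. the constant vector field d/dz_j. *)
Definition dd (R : realType) (n : nat) (j : nat) : 'rV[R[i]]_n.+1 :=
  delta_mx ord0 (inord j.-1).

Definition Gammat (R : realType) (n : nat) : set 'rV[R[i]]_n.+1 :=
  [set z | let x j := complex.Re (crd z j) in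
     x n.+1 = x 1%N * x 2%N + x 1%N * \sum_(3 <= j < n.+1) x j ^+ 2 /\ 0 < x 1%N].

Definition p0 (R : realType) (n : nat) : 'rV[R[i]]_n.+1 := dd R n 1.

(* Fréchet differentiability over the field R[i]. *)
Definition holomorphic_on (R : realType) (n : nat)
    (U : set 'rV[R[i]]_n.+1) (f : 'rV[R[i]]_n.+1 -> 'rV[R[i]]_n.+1) : Prop :=
  forall z, U z -> differentiable f z.

Definition biholomorphic (R : realType) (n : nat)
    (U W : set 'rV[R[i]]_n.+1) (f : 'rV[R[i]]_n.+1 -> 'rV[R[i]]_n.+1) : Prop :=
  [/\ open U, open W, f @` U = W, holomorphic_on U f &
      exists2 g : 'rV[R[i]]_n.+1 -> 'rV[R[i]]_n.+1,
        holomorphic_on W g & forall z, U z -> g (f z) = z].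

(* An element of the isotropy group at p0 is the germ at p0 of a map f
   satisfying [isotropy_on U f] for some neighbourhood U of p0. *)
Definition isotropy_on (R : realType) (n : nat)
    (U : set 'rV[R[i]]_n.+1) (f : 'rV[R[i]]_n.+1 -> 'rV[R[i]]_n.+1) : Prop :=
  [/\ U (p0 R n), f (p0 R n) = p0 R n,
      exists W, biholomorphic U W f &
      f @` (U `&` @Gammat R n) `<=` @Gammat R n].

(* The iterated complex partial derivative along the coordinates listed in s. *)
Definition pderiv (R : realType) (n : nat) (s : seq 'I_n.+1)
    (f : 'rV[R[i]]_n.+1 -> 'rV[R[i]]_n.+1) : 'rV[R[i]]_n.+1 -> 'rV[R[i]]_n.+1 :=
  foldr (fun j g z => 'D_(delta_mx ord0 j) g z) f s.

(* The Lie algebra of the isotropy group, as its tangent space at the identity: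
   X is the velocity at t = 0 of a curve t |-> phi t of group elements with
   phi 0 = id, the difference quotients converging in the topology of the
   group, i.e. with all their derivatives, uniformly on compact sets.  The
   values of X away from p0 are irrelevant. *)
Definition isotropy_algebra (R : realType) (n : nat)
    (X : 'rV[R[i]]_n.+1 -> 'rV[R[i]]_n.+1) : Prop :=
  exists (U : set 'rV[R[i]]_n.+1) (e : R)
         (phi : R -> 'rV[R[i]]_n.+1 -> 'rV[R[i]]_n.+1),
  [/\ 0 < e,
      forall t, `|t| < e -> isotropy_on U (phi t),
      forall z, U z -> phi 0 z = z,
      holomorphic_on U X &
      forall s : seq 'I_n.+1,
        {family compactly_in U,
           (fun t : R =>
              pderiv s (fun z => ((t^-1)%:C)%C *: (phi t z - z))) @ 0^' -->
           pderiv s X}].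

Section Fields.
Variables (R : realType) (n : nat).
Local Notation V := 'rV[R[i]]_n.+1.
Local Notation "z `_[ j ]" := (crd z j) (at level 2, format "z `_[ j ]").
Local Notation "''d_' j" := (dd R n j) (at level 8, j at level 2, format "''d_' j").
Local Notation I := (Complex 0 1 : R[i]).

Definition Ydil (z : V) : V :=
  (2 * z`_[2]) *: 'd_2 + (2 * z`_[n.+1]) *: 'd_(n.+1)
    + \sum_(3 <= j < n.+1) z`_[j] *: 'd_j.

Definition Yrot (j k : nat) (z : V) : V := z`_[k] *: 'd_j - z`_[j] *: 'd_k.

(* The bare linear field i z_k d/dz_j + i z_j d/dz_k is not tangent to the
   hypersurface: it changes x_j^2 + x_k^2 at the rate -2 (x_j y_k + x_k y_j).
   The d/dz_2 component, with real part 2 (x_j y_k + x_k y_j), compensates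
   this, exactly as -i z_j^2 d/dz_2 does in [Ydiag]. *)
Definition Yherm (j k : nat) (z : V) : V :=
  (- (2 * I * z`_[j] * z`_[k])) *: 'd_2
    + (I * z`_[k]) *: 'd_j + (I * z`_[j]) *: 'd_k.

Definition Ydiag (j : nat) (z : V) : V :=
  (- (I * z`_[j] ^+ 2)) *: 'd_2 + (I * z`_[j]) *: 'd_j.

Definition Ypar (z : V) : V :=
  (2 * I * (z`_[1] - 1)) *: 'd_2 + (I * (z`_[1] ^+ 2 - 1)) *: 'd_(n.+1).

Definition Ymoeb (z : V) : V :=
  (I / 2 * (z`_[1] ^+ 2 - 1)) *: 'd_1 + (I * z`_[n.+1]) *: 'd_2
    + (I * z`_[1] * z`_[n.+1]) *: 'd_(n.+1).

Definition isotropy_fields : seq (V -> V) :=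
  Ydil
  :: [seq Yrot j k | j <- index_iota 3 n.+1, k <- index_iota j.+1 n.+1]
  ++ [seq Yherm j k | j <- index_iota 3 n.+1, k <- index_iota j.+1 n.+1]
  ++ [seq Ydiag j | j <- index_iota 3 n.+1]
  ++ [:: Ypar; Ymoeb].

Definition isotropy_field (m : nat) : V -> V := nth (fun=> 0) isotropy_fields m.

End Fields.

Definition isotropy_comb (R : realType) (n N : nat) (c : 'I_N -> R)
    (z : 'rV[R[i]]_n.+1) : 'rV[R[i]]_n.+1 :=
  \sum_(m < N) ((c m)%:C)%C *: isotropy_field m z.

(* Main.v *)
Require Import Defs.
From mathcomp Require Import all_boot all_order all_algebra.
From mathcomp Require Import complex.
From mathcomp Require Import all_classical all_reals all_analysis.
From mathcomp Require Import ring lra zify.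
Import Order.TTheory GRing.Theory Num.Theory.
Import numFieldNormedType.Exports.
Local Open Scope classical_set_scope.
Local Open Scope ring_scope.
Set Implicit Arguments.
Unset Strict Implicit.
Unset Printing Implicit Defensive.

(** Write u = z_1, zeta = (z_3, ..., z_n), v = z_{n+1} and w = z_2 + zeta.zeta / 2, where the dot
   is the bilinear product.  In the coordinates (u, w, zeta, v) the hypersurface is
     Re v = Re u (Re w + |zeta|^2 / 2),   Re u > 0,
   and p0 is (1, 0, 0, 0).

   An element X of the isotropy algebra is the velocity of a curve of automorphisms, so it
   vanishes at p0 and is tangent to the hypersurface ([isotropy_algebra_tangent]).  Tangency is
   an identity in the point and its conjugate.  It stays true when the conjugate is replaced by
   an independent point, on the set of pairs that satisfy the complexified equation
     2 (v + v') = (u + u') (w + w' + zeta.zeta')                          ([polarize]).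
   The reason is one-dimensional: every such pair lies on a holomorphic curve, with a parameter
   s, whose points with s real are conjugate pairs and whose point s = i is the given pair.  So it is enough to know that a holomorphic function of one variable that vanishes on a
   real segment vanishes at i ([identity_real]).  That follows from Cauchy's theorem on
   rectangles: the product of the function over the four rotations about i vanishes on the
   boundary of a square centred at i, hence at the centre.

   The polarized identity is a functional equation for the components of X and of the conjugate
   field.  Evaluating it at well chosen pairs shows in turn that the zeta-component depends
   neither on u nor on v, that the other components do not depend on zeta, that the
   zeta-component is linear in zeta, and how everything depends on w.  What is left is an
   equation in u and v that is solved by elimination ([vf_solve]).  Reality then puts X in the
   normal form [nform], with three real parameters and a skew-Hermitian matrix of size n - 2,
   so with 3 + (n - 2)^2 = n^2 - 4 n + 7 real parameters altogether.

   Conversely each normal form is the velocity of an explicit curve of automorphisms ([flow]):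
   dilations, shears, the Cayley transform of a multiple of the skew-Hermitian matrix, and
   Moebius transformations of u.  The curve is not a one-parameter group, only its velocity
   matters, and this keeps it rational in all coordinates.  Its difference quotients extend to
   t = 0 as members of a class of families of functions ([tame]) that is closed under partial
   derivatives and whose members converge uniformly as t tends to 0; hence all derivatives of
   the difference quotients converge.

   Finally the listed fields are matched with the parameters of the normal form:
   [isotropy_comb_nform], [isotropy_comb_surj] and [isotropy_comb_inj]. *)

(** Identities between explicit complex numbers, by real and imaginary parts. *)
Ltac cring := apply/eqP; rewrite eq_complex /=; apply/andP; split; apply/eqP; ring.

(** * Cauchy's theorem for rectangles *)

Section Cauchy.
Variable R : realType.
Local Notation mu := (@lebesgue_measure R).
Definition rint (g : R -> R) (a b : R) : R := \int[mu]_(x in `[a, b]) g x.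
Definition ctson (a b : R) (g : R -> R) := forall x, a <= x <= b -> {for x, continuous g}.

Lemma ctson_integrable a b g : ctson a b g -> mu.-integrable `[a, b] (EFin \o g).
Proof.
move=> cg; apply: continuous_compact_integrable; first exact: segment_compact.
apply: continuous_in_subspaceT => x; rewrite inE /= in_itv /=; exact: cg.
Qed.

Lemma rintD a b f g : ctson a b f -> ctson a b g ->
  rint (fun x => f x + g x) a b = rint f a b + rint g a b.
Proof. by move=> cf cg; rewrite /rint RintegralD//; exact: ctson_integrable. Qed.

Lemma rintZ a b f k : ctson a b f -> rint (fun x => k * f x) a b = k * rint f a b.
Proof. by move=> cf; rewrite /rint RintegralZl//; exact: ctson_integrable. Qed.

Lemma eq_rint a b f g : (forall x, a <= x <= b -> f x = g x) -> rint f a b = rint g a b.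
Proof. by move=> fg; apply: eq_Rintegral => x; rewrite inE /= in_itv /=; exact: fg. Qed.

Lemma rint_split a b c f : a <= b -> b <= c -> ctson a c f ->
  rint f a c = rint f a b + rint f b c.
Proof.
move=> ab bc cf; have cbc : ctson b c f.
  by move=> x /andP[bx xc]; apply: cf; rewrite xc (le_trans ab bx).
rewrite /rint -(Rintegral_itv_obnd_cbnd (r := b)).
  rewrite -(@Rintegral_itvB _ f (BLeft a) (BRight c) b) ?bnd_simp//.
    by rewrite addrC subrK.
  exact: ctson_integrable.
by apply: integrableS (ctson_integrable cbc) => //; apply: subset_itvr; rewrite bnd_simp.
Qed.

Lemma ctson_cst a b k : ctson a b (cst k).
Proof. by move=> x _; exact: cst_continuous. Qed.

Lemma rint_cst a b k : a <= b -> rint (fun=> k) a b = k * (b - a).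
Proof.
move=> ab; rewrite /rint Rintegral_cst//= lebesgue_measure_itv/= lte_fin.
by case: ltP => //= ba; have -> : a = b by [apply/le_anti/andP]; rewrite subrr.
Qed.

Lemma le_rint a b f g : ctson a b f -> ctson a b g ->
  (forall x, a <= x <= b -> f x <= g x) -> rint f a b <= rint g a b.
Proof.
move=> cf cg fg; apply: le_Rintegral => //; try exact: ctson_integrable.
Qed.

Lemma rint_id a b : a < b -> rint id a b = (b ^+ 2 - a ^+ 2) / 2.
Proof.
move=> ab; rewrite /rint /Rintegral (@continuous_FTC2 _ id (fun x => x ^+ 2 / 2))//=.
- by rewrite mulrBl.
- by apply: continuous_subspaceT => x; exact: cvg_id.
- have cF : forall x : R, {for x, continuous (fun x : R => x ^+ 2 / 2)}.
    by move=> x; apply: cvgM; [exact: exprn_continuous|exact: cvg_cst].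
  split.
  + by move=> x _; apply: derivableM.
  + exact: cvg_at_right_filter (cF _).
  + exact: cvg_at_left_filter (cF _).
- move=> x _; rewrite derive1E deriveM// derive_cst scaler0 add0r.
  by rewrite exp_derive /= expr1 /GRing.scale /= mulr1 mulrA mulVf ?mul1r// pnatr_eq0.
Qed.

Local Notation C := R[i].
Local Notation N := (@ComplexField.Normc.normc R).
Local Notation Re := (@complex.Re R).
Local Notation Im := (@complex.Im R).
Local Notation "x +i* y" := (Complex x y).

Lemma normc_real (x : R) : N (x%:C)%C = `|x|.
Proof. by rewrite /= expr0n addr0 sqrtr_sqr. Qed.

Lemma normc_ge0 z : 0 <= N z.
Proof. by case: z => a b; exact: sqrtr_ge0. Qed.

Lemma normc_eq0 z : (N z == 0) = (z == 0).
Proof.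
apply/eqP/eqP => [/ComplexField.Normc.eq0_normc//|->].
exact: ComplexField.Normc.normc0.
Qed.

Lemma normc_gt0 z : (0 < N z) = (z != 0).
Proof. by rewrite lt_def normc_eq0 normc_ge0 andbT. Qed.

Lemma normcM z w : N (z * w) = N z * N w.
Proof. exact: ComplexField.Normc.normcM. Qed.

Lemma normcB z w : N (z - w) = N (w - z).
Proof. by rewrite -[LHS]normcN opprB. Qed.

Lemma normcDB z w t : N (z - t) <= N (z - w) + N (w - t).
Proof. by rewrite -[z in z - t](subrK w) -addrA; exact: le_normcD. Qed.

Lemma ler_Re z : `|Re z| <= N z.
Proof.
by case: z => a b /=; rewrite -sqrtr_sqr ler_sqrt ?lerDl ?addr_ge0 ?sqr_ge0.
Qed.

Lemma ler_Im z : `|Im z| <= N z.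
Proof.
by case: z => a b /=; rewrite -sqrtr_sqr ler_sqrt ?lerDr ?addr_ge0 ?sqr_ge0.
Qed.

Lemma normc_le z : N z <= `|Re z| + `|Im z|.
Proof.
case: z => a b /=; rewrite -[leRHS]ger0_norm ?addr_ge0// -sqrtr_sqr ler_sqrt ?sqr_ge0//.
rewrite sqrrD !real_normK ?num_real// -addrA lerD2l.
by rewrite lerDr mulrn_wge0// mulr_ge0.
Qed.

Lemma ReB z w : Re (z - w) = Re z - Re w. Proof. by case: z w => a b []. Qed.
Lemma ImB z w : Im (z - w) = Im z - Im w. Proof. by case: z w => a b []. Qed.
Lemma ReM z w : Re (z * w) = Re z * Re w - Im z * Im w.
Proof. by case: z w => a b []. Qed.
Lemma ImM z w : Im (z * w) = Re z * Im w + Im z * Re w.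
Proof. by case: z w => a b []. Qed.
Lemma ReD z w : Re (z + w) = Re z + Re w. Proof. by case: z w => a b []. Qed.
Lemma ImD z w : Im (z + w) = Im z + Im w. Proof. by case: z w => a b []. Qed.

Definition ci (g : R -> C) (a b : R) : C :=
  rint (fun x => Re (g x)) a b +i* rint (fun x => Im (g x)) a b.

Definition cctson (a b : R) (g : R -> C) :=
  ctson a b (fun x => Re (g x)) /\ ctson a b (fun x => Im (g x)).

Lemma ctsonD a b f g : ctson a b f -> ctson a b g -> ctson a b (fun x => f x + g x).
Proof. by move=> cf cg x xab; apply: cvgD; [exact: cf|exact: cg]. Qed.

Lemma ctsonZ a b f (k : R) : ctson a b f -> ctson a b (fun x => k * f x).
Proof. by move=> cf x xab; apply: cvgM; [exact: cvg_cst|exact: cf]. Qed.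

Lemma ciD a b f g : cctson a b f -> cctson a b g ->
  ci (fun x => f x + g x) a b = ci f a b + ci g a b.
Proof.
move=> [f1 f2] [g1 g2]; rewrite /ci.
under eq_rint do rewrite ReD; under [in X in _ +i* X]eq_rint do rewrite ImD.
by rewrite !rintD.
Qed.

Lemma ciZ a b f (k : C) : cctson a b f -> ci (fun x => k * f x) a b = k * ci f a b.
Proof.
move=> [f1 f2]; rewrite /ci.
under eq_rint do rewrite ReM -mulNr; under [in X in _ +i* X]eq_rint do rewrite ImM.
rewrite !rintD ?rintZ//; try exact: ctsonZ.
by apply/eqP; rewrite eq_complex ReM ImM /= mulNr !eqxx.
Qed.

Lemma eq_ci a b f g : (forall x, a <= x <= b -> f x = g x) -> ci f a b = ci g a b.
Proof. by move=> fg; rewrite /ci; congr (_ +i* _); apply: eq_rint => x /fg ->. Qed.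

Lemma ci_split a b c f : a <= b -> b <= c -> cctson a c f ->
  ci f a c = ci f a b + ci f b c.
Proof. by move=> ab bc [f1 f2]; rewrite /ci (rint_split ab bc f1) (rint_split ab bc f2). Qed.

Lemma rint_bound a b f (M : R) : a <= b -> ctson a b f ->
  (forall x, a <= x <= b -> `|f x| <= M) -> `|rint f a b| <= M * (b - a).
Proof.
move=> ab cf fM; rewrite ler_norml -mulNr -!(rint_cst _ ab); apply/andP; split;
by apply: le_rint => //; [exact: ctson_cst|] => x /fM; rewrite ler_norml => /andP[].
Qed.

(** The factor 2 comes from bounding the real and the imaginary part separately; no constant
   below has to be sharp. *)
Lemma ci_bound a b f (M : R) : a <= b -> cctson a b f ->
  (forall x, a <= x <= b -> N (f x) <= M) -> N (ci f a b) <= 2 * M * (b - a).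
Proof.
move=> ab [f1 f2] fM; apply: (le_trans (normc_le _)) => /=.
rewrite -mulrA mulr_natl mulr2n lerD// rint_bound// => x /fM; apply: le_trans.
  exact: ler_Re.
exact: ler_Im.
Qed.

Lemma ci_affine a b (p q : C) : a <= b ->
  ci (fun x => p + q * (x%:C)%C) a b = p * ((b - a)%:C)%C + q * (((b ^+ 2 - a ^+ 2) / 2)%:C)%C.
Proof.
have [->|ne] := eqVneq a b.
  have -> f : ci f b b = 0.
    suff E g : rint g b b = 0 by rewrite /ci !E.
    by rewrite /rint set_itv1 Rintegral_set1.
  by rewrite !subrr mul0r !mulr0 addr0.
move=> ab; have cid : ctson a b id by move=> x _; exact: cvg_id.
have ab' : a < b by rewrite lt_neqAle ne.
have E (k l : R) : rint (fun x => k + l * x) a b = k * (b - a) + l * ((b ^+ 2 - a ^+ 2) / 2).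
  by rewrite rintD ?(rintZ _ cid) ?rint_cst ?rint_id//; [exact: ctson_cst|exact: ctsonZ].
rewrite /ci; under eq_rint do rewrite ReD ReM /= mulr0 subr0.
under [in X in _ +i* X]eq_rint do rewrite ImD ImM /= mulr0 add0r.
rewrite !E; apply/eqP; rewrite eq_complex ReD ImD !ReM !ImM /=.
by rewrite !mulr0 !subr0 !add0r !eqxx.
Qed.

(** Continuity and differentiability are stated with the real-valued modulus, so that all
   estimates take place in R. *)
Definition ccont (f : C -> C) (z : C) :=
  forall e : R, 0 < e -> exists2 d : R, 0 < d & forall w, N (w - z) < d -> N (f w - f z) < e.

Definition cdiff (f : C -> C) (z : C) :=
  exists l : C, forall e : R, 0 < e -> exists2 d : R, 0 < d &
    forall w, N (w - z) < d -> N (f w - f z - l * (w - z)) <= e * N (w - z).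

Lemma cdiff_ccont f z : cdiff f z -> ccont f z.
Proof.
case=> l fl e e0; have [d d0 fd] := fl 1 ltr01.
have l1 : 0 < N l + 1 by rewrite ltr_pwDr// normc_ge0.
exists (Num.min d (e / (N l + 1))); first by rewrite lt_min d0 divr_gt0.
move=> w; rewrite lt_min => /andP[/fd wd we].
rewrite -(subrK (l * (w - z)) (f w - f z)); apply: le_lt_trans (le_normcD _ _) _.
apply: le_lt_trans (lerD wd (lexx _)) _.
by rewrite normcM -mulrDl [1 + _]addrC mulrC -ltr_pdivlMr.
Qed.

(** Sides of rectangles are parametrized by arc length. *)
Definition path1 (g : R -> C) := forall x y, N (g y - g x) = `|y - x|.

Lemma ccont_path f g a b : path1 g -> (forall x, a <= x <= b -> ccont f (g x)) ->
  cctson a b (fun x => f (g x)).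
Proof.
move=> pg cf; split=> x xab; apply/cvgrPdist_lt => e e0;
  have [d d0 fd] := cf x xab e e0; near=> y;
  have yd : N (g y - g x) < d by
    [rewrite pg distrC; near: y; apply: cvgr_dist_lt => //; exact: cvg_id].
- by apply: le_lt_trans (fd _ yd); rewrite distrC -ReB; exact: ler_Re.
- by apply: le_lt_trans (fd _ yd); rewrite distrC -ImB; exact: ler_Im.
Unshelve. all: by end_near.
Qed.

Definition hor (y : R) (x : R) : C := x +i* y.
Definition ver (x : R) (y : R) : C := x +i* y.

Lemma hor_path1 y : path1 (hor y).
Proof. by move=> x x'; rewrite /hor /= subrr expr0n addr0 sqrtr_sqr. Qed.

Lemma ver_path1 x : path1 (ver x).
Proof. by move=> y y'; rewrite /ver /= subrr expr0n add0r sqrtr_sqr. Qed.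

(** The contour integral over the boundary of [a, b] x [c, d], counterclockwise. *)
Definition rect f (a b c d : R) : C :=
  ci (fun x => f (hor c x)) a b - ci (fun x => f (hor d x)) a b
  + (0 +i* 1) * (ci (fun y => f (ver b y)) c d - ci (fun y => f (ver a y)) c d).

Definition inrect (a b c d : R) (z : C) := a <= Re z <= b /\ c <= Im z <= d.

Lemma hor_ctson f a b c d y : (forall z, inrect a b c d z -> ccont f z) ->
  c <= y <= d -> cctson a b (fun x => f (hor y x)).
Proof. by move=> cf ycd; apply: (ccont_path (hor_path1 y)) => x xab; apply: cf. Qed.

Lemma ver_ctson f a b c d x : (forall z, inrect a b c d z -> ccont f z) ->
  a <= x <= b -> cctson c d (fun y => f (ver x y)).
Proof. by move=> cf ycd; apply: (ccont_path (ver_path1 x)) => y yab; apply: cf. Qed.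

Lemma rect_splitv f a b c d m : a <= m <= b -> c <= d ->
  (forall z, inrect a b c d z -> ccont f z) ->
  rect f a b c d = rect f a m c d + rect f m b c d.
Proof.
move=> /andP[am mb] cd cf; rewrite /rect.
rewrite (ci_split am mb); last by apply: hor_ctson cf _; rewrite lexx cd.
rewrite (ci_split am mb (f := fun x => f (hor d x))); last by apply: hor_ctson cf _; rewrite lexx cd.
ring.
Qed.

Lemma rect_splith f a b c d m : c <= m <= d -> a <= b ->
  (forall z, inrect a b c d z -> ccont f z) ->
  rect f a b c d = rect f a b c m + rect f a b m d.
Proof.
move=> /andP[am mb] cd cf; rewrite /rect.
rewrite (ci_split am mb); last by apply: ver_ctson cf _; rewrite lexx cd.
rewrite (ci_split am mb (f := fun x => f (ver a x))); last by apply: ver_ctson cf _; rewrite lexx cd.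
ring.
Qed.

(** Linearity of [rect] needs continuity on the boundary only, which allows integrands with a
   pole inside. *)
Definition bd_ctson f a b c d :=
  [/\ cctson a b (fun x => f (hor c x)), cctson a b (fun x => f (hor d x)),
      cctson c d (fun y => f (ver b y)) & cctson c d (fun y => f (ver a y))].

Lemma rect_bd_ctson f a b c d : a <= b -> c <= d ->
  (forall z, inrect a b c d z -> ccont f z) -> bd_ctson f a b c d.
Proof.
move=> ab cd cf; split; [apply: hor_ctson cf _|apply: hor_ctson cf _
  |apply: ver_ctson cf _|apply: ver_ctson cf _]; by rewrite lexx ?ab ?cd.
Qed.

Lemma rectD f g a b c d : bd_ctson f a b c d -> bd_ctson g a b c d ->
  rect (fun z => f z + g z) a b c d = rect f a b c d + rect g a b c d.
Proof. by move=> [f1 f2 f3 f4] [g1 g2 g3 g4]; rewrite /rect !ciD//; ring. Qed.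

Lemma rectZ f k a b c d : bd_ctson f a b c d ->
  rect (fun z => k * f z) a b c d = k * rect f a b c d.
Proof. by move=> [f1 f2 f3 f4]; rewrite /rect !ciZ//; ring. Qed.

Lemma rect_affine p q a b c d : a <= b -> c <= d ->
  rect (fun z => p + q * z) a b c d = 0.
Proof.
move=> ab cd; rewrite /rect.
have H y : (fun x : R => p + q * hor y x) = (fun x => (p + q * (0 +i* y)) + q * (x%:C)%C).
  apply/funext=> x; rewrite -addrA -mulrDr; congr (p + q * _).
  by cring.
have V x : (fun y : R => p + q * ver x y) = (fun y => (p + q * (x%:C)%C) + q * (0 +i* 1) * (y%:C)%C).
  apply/funext=> y; rewrite -addrA -mulrA -mulrDr; congr (p + q * _).
  by cring.
rewrite !H !V !ci_affine//.
have E (x : R) : 0 +i* x = (0 +i* 1) * (x%:C)%C.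
  by cring.
have i2 : (0 +i* 1) * (0 +i* 1) = -1 :> C.
  by rewrite -expr2 sqr_i.
rewrite (E c) (E d) !rmorphM /= !rmorphB /= !rmorphXn /= fmorphV rmorph_nat.
set i := 0 +i* 1 in i2 *; set a' := (a%:C)%C; set b' := (b%:C)%C; set c' := (c%:C)%C; set d' := (d%:C)%C.
have -> : i * ((p + q * b') * (d' - c') + q * i * ((d' ^+ 2 - c' ^+ 2) / 2) -
      ((p + q * a') * (d' - c') + q * i * ((d' ^+ 2 - c' ^+ 2) / 2))) =
   i * q * (b' - a') * (d' - c') by ring.
ring.
Qed.

Lemma rect_bound f a b c d (M : R) : a <= b -> c <= d -> bd_ctson f a b c d ->
  (forall z, inrect a b c d z -> (Re z == a) || (Re z == b) || (Im z == c) || (Im z == d) -> N (f z) <= M) ->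
  N (rect f a b c d) <= 4 * M * ((b - a) + (d - c)).
Proof.
move=> ab cd [f1 f2 f3 f4] fM; rewrite /rect.
apply: (le_trans (le_normcD _ _)); rewrite normcM.
have -> : N (0 +i* 1) = 1 by rewrite /= expr0n expr1n add0r sqrtr1.
rewrite mul1r mulrDr; apply: lerD; apply: (le_trans (le_normcD _ _)); rewrite normcN.
  have -> : 4 * M * (b - a) = 2 * M * (b - a) + 2 * M * (b - a) by ring.
  by apply: lerD; apply: ci_bound => // x xab; apply: fM => //=; rewrite ?eqxx ?orbT//; split; rewrite //= ?lexx ?ab ?cd.
have -> : 4 * M * (d - c) = 2 * M * (d - c) + 2 * M * (d - c) by ring.
by apply: lerD; apply: ci_bound => // x xab; apply: fM => //=; rewrite ?eqxx ?orbT//; split; rewrite //= ?lexx ?ab ?cd.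
Qed.

Lemma nested_interval (a b : nat -> R) : (forall n, a n <= a n.+1) -> (forall n, b n.+1 <= b n) ->
  (forall n, a n <= b n) -> exists x, forall n, a n <= x <= b n.
Proof.
move=> ha hb hab.
have am m k : a m <= a (m + k)%N by elim: k => [|k IH]; rewrite ?addn0// addnS (le_trans IH).
have bm m k : b (m + k)%N <= b m by elim: k => [|k IH]; rewrite ?addn0// addnS (le_trans _ IH).
have amn m n : a m <= b n.
  apply: le_trans (am m n) _; apply: le_trans (hab _) _; rewrite addnC; exact: bm.
exists (sup (range a)) => n; apply/andP; split.
  apply: ub_le_sup; last by exists n.
  by exists (b 0%N) => _ [m _ <-].
apply: ge_sup; first by exists (a 0%N), 0%N.
by move=> _ [m _ <-].
Qed.

(** Goursat's bisection as an induction principle: a property of rectangles that can be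
   assembled from the four quarters holds as soon as it holds near each point, for otherwise
   nested bad quarters would shrink to a point. *)
Lemma bisect (P : R -> R -> R -> R -> Prop) (a b c d : R) : a <= b -> c <= d ->
  (forall a b c d, a <= b -> c <= d -> let m := (a + b) / 2 in let k := (c + d) / 2 in
    P a m c k -> P m b c k -> P a m k d -> P m b k d -> P a b c d) ->
  (forall z, inrect a b c d z -> exists2 e : R, 0 < e & forall a' b' c' d',
     a <= a' -> b' <= b -> c <= c' -> d' <= d -> inrect a' b' c' d' z ->
     b' - a' < e -> d' - c' < e -> P a' b' c' d') ->
  P a b c d.
Proof.
move=> ab cd hsplit hloc; apply: contrapT => nP.
pose T := (R * R * R * R)%type.
pose bad (t : T) := [/\ t.1.1.1 <= t.1.1.2, t.1.2 <= t.2 & ~ P t.1.1.1 t.1.1.2 t.1.2 t.2].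
pose half (t s : T) := bad s /\ [/\
  t.1.1.1 <= s.1.1.1, s.1.1.2 <= t.1.1.2, t.1.2 <= s.1.2, s.2 <= t.2 &
  (s.1.1.2 - s.1.1.1 = (t.1.1.2 - t.1.1.1) / 2) /\ (s.2 - s.1.2 = (t.2 - t.1.2) / 2)].
have step t : exists s, bad t -> half t s.
  have [bt|nbt] := pselect (bad t); last by exists t.
  case: t bt => [[[a0 b0] c0] d0] [/= ab0 cd0 nP0].
  pose m := (a0 + b0) / 2; pose k := (c0 + d0) / 2.
  have am : a0 <= m by rewrite /m; lra.
  have mb : m <= b0 by rewrite /m; lra.
  have ck : c0 <= k by rewrite /k; lra.
  have kd : k <= d0 by rewrite /k; lra.
  apply: contrapT => nex; apply: nP0; apply: hsplit => //; apply: contrapT => nP1; apply: nex.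
  - by exists (a0, m, c0, k) => _; split; [by split|split=> /=; rewrite ?lexx//; split; rewrite /m /k; lra].
  - by exists (m, b0, c0, k) => _; split; [by split|split=> /=; rewrite ?lexx//; split; rewrite /m /k; lra].
  - by exists (a0, m, k, d0) => _; split; [by split|split=> /=; rewrite ?lexx//; split; rewrite /m /k; lra].
  - by exists (m, b0, k, d0) => _; split; [by split|split=> /=; rewrite ?lexx//; split; rewrite /m /k; lra].
have [next nextP] := choice step.
pose t n := iter n next (a, b, c, d).
have bt n : bad (t n).
  by elim: n => [|n IH]; [split|have [] := nextP _ IH].
have ht n : half (t n) (t n.+1) by apply: nextP.
have [x xP] := @nested_interval (fun n => (t n).1.1.1) (fun n => (t n).1.1.2)
  (fun n => let: conj _ (And5 h _ _ _ _) := ht n in h) (fun n => let: conj _ (And5 _ h _ _ _) := ht n in h)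
  (fun n => let: And3 h _ _ := bt n in h).
have [y yP] := @nested_interval (fun n => (t n).1.2) (fun n => (t n).2)
  (fun n => let: conj _ (And5 _ _ h _ _) := ht n in h) (fun n => let: conj _ (And5 _ _ _ h _) := ht n in h)
  (fun n => let: And3 _ h _ := bt n in h).
have size n : (t n).1.1.2 - (t n).1.1.1 = (b - a) / 2 ^+ n /\
    (t n).2 - (t n).1.2 = (d - c) / 2 ^+ n.
  elim: n => [|n [IH1 IH2]]; first by rewrite !divr1.
  case: (ht n) => _ [_ _ _ _ [-> ->]]; rewrite IH1 IH2 exprSr !invfM !mulrA //.
have inc n : [/\ a <= (t n).1.1.1, (t n).1.1.2 <= b, c <= (t n).1.2 & (t n).2 <= d].
  elim: n => [|n [h1 h2 h3 h4]]; first by split.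
  case: (ht n) => _ [g1 g2 g3 g4 _]; split.
  - exact: le_trans h1 g1.
  - exact: le_trans g2 h2.
  - exact: le_trans h3 g3.
  - exact: le_trans g4 h4.
have zin : inrect a b c d (x +i* y) by split; [exact: (xP 0%N)|exact: (yP 0%N)].
have [e e0 he] := hloc _ zin.
have small (r : R) : exists n0 : nat, forall n, (n0 <= n)%N -> r / 2 ^+ n < e.
  have /cvgrPdist_lt /(_ e e0) [n0 _ hn] : (fun n => r * (2^-1) ^+ n) @ \oo --> (0 : R).
    have := @cvg_geometric R r (2^-1); apply.
    by rewrite ger0_norm ?invr_ge0// invf_lt1// ltr1n.
  exists n0 => n /hn; rewrite sub0r normrN exprVn; apply: le_lt_trans.
  exact: ler_norm.
have [n1 h1] := small (b - a); have [n2 h2] := small (d - c).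
pose n := maxn n1 n2; have [_ _] := bt n; apply.
have [i1 i2 i3 i4] := inc n; have [s1 s2] := size n.
by apply: he => //; rewrite ?s1 ?s2 ?h1 ?h2 ?leq_maxl ?leq_maxr.
Qed.

(** Near a point the integrand is an affine function, whose contour integral vanishes, plus a
   remainder of first order, so the integral over a small rectangle is at most e times the sum
   of the squares of its sides. This bound adds up exactly over the four quarters of a
   rectangle. *)
Lemma goursat f a b c d : a <= b -> c <= d ->
  (forall z, inrect a b c d z -> cdiff f z) -> rect f a b c d = 0.
Proof.
move=> ab cd fd.
have fc z : inrect a b c d z -> ccont f z by move=> /fd /cdiff_ccont.
suff H e : 0 < e -> N (rect f a b c d) <= e * ((b - a) ^+ 2 + (d - c) ^+ 2).
  apply/eqP; rewrite -normc_eq0 eq_le normc_ge0 andbT.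
  apply/ler_addgt0Pr => e e0; rewrite add0r.
  set s := (b - a) ^+ 2 + (d - c) ^+ 2 in H.
  have s0 : 0 <= s by rewrite addr_ge0// sqr_ge0.
  have s1 : 0 < s + 1 by rewrite ltr_wpDl.
  apply: le_trans (H (e / (s + 1)) _) _; first by rewrite divr_gt0.
  by rewrite -mulrA ler_piMr ?(ltW e0)// mulrC ler_pdivrMr// mul1r lerDl.
move=> e0.
pose P a' b' c' d' := a <= a' -> b' <= b -> c <= c' -> d' <= d ->
  N (rect f a' b' c' d') <= e * ((b' - a') ^+ 2 + (d' - c') ^+ 2).
suff : P a b c d by apply.
apply: bisect => //.
- move=> a' b' c' d' ab' cd' m k P1 P2 P3 P4 ha hb hc hd.
  have am : a' <= m by rewrite /m; lra.
  have mb : m <= b' by rewrite /m; lra.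
  have ck : c' <= k by rewrite /k; lra.
  have kd : k <= d' by rewrite /k; lra.
  have ha' := le_trans ha am; have hb' := le_trans mb hb.
  have hc' := le_trans hc ck; have hd' := le_trans kd hd.
  have fc' z : inrect a' b' c' d' z -> ccont f z.
    move=> [/andP[z1 z2] /andP[z3 z4]]; apply: fc; split.
      by rewrite (le_trans ha z1) (le_trans z2 hb).
    by rewrite (le_trans hc z3) (le_trans z4 hd).
  rewrite (@rect_splith f a' b' c' d' k) ?ck ?kd//.
  rewrite !(@rect_splitv f a' b' _ _ m) ?am ?mb//; last 2 first.
  + move=> z [z1 /andP[z3 z4]]; apply: fc'; split=> //.
    by rewrite (le_trans ck z3) z4.
  + move=> z [z1 /andP[z3 z4]]; apply: fc'; split=> //.
    by rewrite (le_trans z4 kd) z3.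
  have {}P1 := P1 ha hb' hc hd'.
  have {}P2 := P2 ha' hb hc hd'.
  have {}P3 := P3 ha hb' hc' hd.
  have {}P4 := P4 ha' hb hc' hd.
  apply: le_trans (le_normcD _ _) _.
  apply: le_trans (lerD (le_normcD _ _) (le_normcD _ _)) _.
  apply: le_trans (lerD (lerD P1 P2) (lerD P3 P4)) _.
  by rewrite /m /k le_eqVlt; apply/orP; left; apply/eqP; field.
- move=> z zin; have [l hl] := fd z zin.
  have [g g0 hg] := hl (e / 8) ltac:(by rewrite divr_gt0).
  exists (g / 2); first by rewrite divr_gt0.
  move=> a' b' c' d' _ _ _ _ zin' w1 w2 ha hb hc hd.
  have ab' : a' <= b' by case: zin' => /andP[z1 z2] _; exact: le_trans z1 z2.
  have cd' : c' <= d' by case: zin' => _ /andP[z1 z2]; exact: le_trans z1 z2.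
  have fc' w : inrect a' b' c' d' w -> ccont f w.
    move=> [/andP[z1 z2] /andP[z3 z4]]; apply: fc; split.
      by rewrite (le_trans ha z1) (le_trans z2 hb).
    by rewrite (le_trans hc z3) (le_trans z4 hd).
  (* adding an affine function does not change the contour integral; f + h is the first-order
     remainder of f at z *)
  pose h w := (- f z + l * z) + (- l) * w.
  have ch w : ccont h w.
    apply: cdiff_ccont; exists (- l) => e' e'0; exists 1 => // v _.
    have -> : h v - h w - - l * (v - w) = 0 by rewrite /h; ring.
    by rewrite ComplexField.Normc.normc0 mulr_ge0 ?normc_ge0 ?ltW.
  have -> : rect f a' b' c' d' = rect (fun w => f w + h w) a' b' c' d'.
    rewrite rectD; [|exact: rect_bd_ctson|exact: rect_bd_ctson].
    by rewrite rect_affine// addr0.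
  pose M := e / 8 * ((b' - a') + (d' - c')).
  have bd w : inrect a' b' c' d' w -> N (f w + h w) <= M.
    move=> win; have nw : N (w - z) <= (b' - a') + (d' - c').
      apply: le_trans (normc_le _) _; rewrite ReB ImB.
      case: zin' win => /andP[z1 z2] /andP[z3 z4] [/andP[w3 w4] /andP[w5 w6]].
      by apply: lerD; rewrite ler_norml; apply/andP; split; lra.
    have -> : f w + h w = f w - f z - l * (w - z) by rewrite /h; ring.
    apply: le_trans (hg _ _) _; first by apply: le_lt_trans nw _; lra.
    by rewrite /M ler_pM2l// divr_gt0.
  apply: (le_trans (rect_bound (M := M) ab' cd' _ _)).
  + have [f1 f2 f3 f4] := rect_bd_ctson ab' cd' fc'.
    have [h1 h2 h3 h4] := rect_bd_ctson ab' cd' (fun w _ => ch w).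
    have D p q u v : cctson p q u -> cctson p q v -> cctson p q (fun x => u x + v x).
      move=> [u1 u2] [v1 v2]; split.
        by under [fun x => Re _]funext do rewrite ReD; exact: ctsonD.
      by under [fun x => Im _]funext do rewrite ImD; exact: ctsonD.
    by split; exact: D.
  + by move=> w win _; exact: bd.
  (* 4 (e / 8) (p + q)^2 <= e (p^2 + q^2), which is where e / 8 comes from *)
  rewrite /M; set p := b' - a'; set q := d' - c'.
  have -> : 4 * (e / 8 * (p + q)) * (p + q) = e / 2 * (p + q) ^+ 2 by field.
  have -> : e * (p ^+ 2 + q ^+ 2) = e / 2 * (p + q) ^+ 2 + e / 2 * (p - q) ^+ 2 by field.
  by rewrite lerDl mulr_ge0 ?sqr_ge0// divr_ge0// ltW.
Qed.
End Cauchy.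

(** * An identity principle on a real segment *)

Section Identity.
Variable R : realType.
Local Notation C := R[i].
Local Notation N := (@ComplexField.Normc.normc R).
Local Notation Re := (@complex.Re R).
Local Notation Im := (@complex.Im R).
Local Notation "x +i* y" := (Complex x y).

Lemma ReN z : Re (- z) = - Re z. Proof. by case: z. Qed.
Lemma ImN z : Im (- z) = - Im z. Proof. by case: z. Qed.

Lemma norm_normc (z : C) : `|z| = ((N z)%:C)%C. Proof. by []. Qed.

Lemma gt0_cplx (e : C) : 0 < e -> e = ((Re e)%:C)%C /\ 0 < Re e.
Proof. by case: e => a b; rewrite ltcE /= => /andP[/eqP -> ->]. Qed.

Lemma nbhs_normc (z : C) (P : C -> Prop) :
  (exists2 d : R, 0 < d & forall w, N (w - z) < d -> P w) <-> nbhs z P.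
Proof.
split=> [[d d0 dP]|/nbhs_ballP[e /= e0 eP]].
  apply/nbhs_ballP; exists (d%:C)%C => /=; first by rewrite ltcR.
  by move=> w; rewrite -ball_normE /= norm_normc ltcR normcB; exact: dP.
have [eE e'] := gt0_cplx e0; exists (Re e) => // w wd; apply: eP.
by rewrite -ball_normE /= norm_normc eE ltcR normcB.
Qed.

(** Gives access to the differentiation rules of the library, through derivability in the
   direction 1. *)
Lemma cdiffP (f : C -> C) z : cdiff f z <-> derivable f z 1.
Proof.
split=> [[l fl]|/cvg_ex[l /cvgrPdist_le fl]].
  apply/cvg_ex; exists l; apply/cvgrPdist_le => e /gt0_cplx[eE e0].
  have [d d0 fd] := fl _ e0; apply/nbhs_normc; exists d => //= h; rewrite subr0 => hd h0.
  have := fd (h + z); rewrite addrK => /(_ hd) H.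
  rewrite norm_normc eE lecR scaler1 -(ler_pM2r (x := N h)) ?normc_gt0//.
  apply: le_trans H; rewrite -normcM -normcN mulrBl opprB.
  rewrite /GRing.scale /= mulrAC mulVf// mul1r.
  by rewrite le_eqVlt eqxx.
exists l => e e0; have /nbhs_normc[d d0 fd] := fl (e%:C)%C ltac:(by rewrite ltcR).
exists d => // w wd; have [->|wz] := eqVneq w z.
  by rewrite !subrr mulr0 subr0 ComplexField.Normc.normc0 mulr0.
have h0 : w - z != 0 by rewrite subr_eq0.
have /= := fd (w - z); rewrite subr0 => /(_ wd h0).
rewrite norm_normc lecR scaler1 subrK -(ler_pM2r (x := N (w - z))) ?normc_gt0//.
apply: le_trans; rewrite -normcM -normcN mulrBl opprB.
by rewrite /GRing.scale /= mulrAC mulVf// mul1r.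
Qed.

Lemma cdiffM (f g : C -> C) z : cdiff f z -> cdiff g z -> cdiff (fun w => f w * g w) z.
Proof. by move=> /cdiffP fz /cdiffP gz; apply/cdiffP; exact: (derivableM fz gz). Qed.
Lemma cdiffD (f g : C -> C) z : cdiff f z -> cdiff g z -> cdiff (fun w => f w + g w) z.
Proof. by move=> /cdiffP fz /cdiffP gz; apply/cdiffP; exact: (derivableD fz gz). Qed.
Lemma cdiff_cst (k z : C) : cdiff (cst k) z.
Proof. by apply/cdiffP; exact: derivable_cst. Qed.
Lemma cdiff_id (z : C) : cdiff id z.
Proof. by apply/cdiffP; exact: derivable_id. Qed.
Lemma cdiffV (f : C -> C) z : f z != 0 -> cdiff f z -> cdiff (fun w => (f w)^-1) z.
Proof. by move=> f0 /cdiffP fz; apply/cdiffP; exact: (derivableV f0 fz). Qed.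

Lemma eq_cdiff (f g : C -> C) z : f =1 g -> cdiff f z -> cdiff g z.
Proof. by move=> /funext ->. Qed.

Lemma cdiff_affine (f : C -> C) (p q z : C) : cdiff f (p + q * z) -> cdiff (fun w => f (p + q * w)) z.
Proof.
case=> l fl; exists (l * q) => e e0.
have q1 : 0 < N q + 1 by rewrite ltr_pwDr// normc_ge0.
have [d d0 fd] := fl (e / (N q + 1)) ltac:(by rewrite divr_gt0).
exists (d / (N q + 1)); first by rewrite divr_gt0.
move=> w wd; have E : p + q * w - (p + q * z) = q * (w - z) by ring.
have qN : N q * N (w - z) <= N (w - z) * (N q + 1).
  by rewrite mulrC ler_wpM2l ?normc_ge0// lerDl.
have qw : N (q * (w - z)) < d.
  by rewrite normcM; apply: le_lt_trans qN _; rewrite -ltr_pdivlMr.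
have := fd (p + q * w); rewrite E [l * _]mulrA => H; apply: le_trans (H qw) _.
rewrite normcM -mulrA ler_pM2l// ler_pdivrMl//.
by rewrite ler_wpM2r ?normc_ge0// lerDl.
Qed.

Lemma conjcB (z w : C) : (z - w)^*%C = z^*%C - w^*%C. Proof. by rewrite rmorphB. Qed.
Lemma conjcM (z w : C) : (z * w)^*%C = z^*%C * w^*%C. Proof. by rewrite rmorphM. Qed.
Lemma normc_conj (z : C) : N (z^*)%C = N z.
Proof. by case: z => a b /=; rewrite sqrrN. Qed.

(** Schwarz reflection. *)
Lemma cdiff_conj (f : C -> C) z : cdiff f (z^*)%C -> cdiff (fun w => (f (w^*)%C)^*%C) z.
Proof.
case=> l fl; exists (l^*)%C => e e0; have [d d0 fd] := fl e e0.
exists d => // w wd; have E : N (w^*%C - z^*%C) = N (w - z) by rewrite -conjcB normc_conj.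
have := fd (w^*)%C; rewrite E => /(_ wd); congr (_ <= _).
by rewrite -normc_conj !conjcB conjcM !conjcB !conjcK.
Qed.

Lemma near_cdiff (f g : C -> C) (z : C) (r : R) : 0 < r -> (forall w, N (w - z) < r -> f w = g w) ->
  cdiff f z -> cdiff g z.
Proof.
move=> r0 fg [l fl]; exists l => e e0; have [d d0 fd] := fl e e0.
exists (Num.min d r) => [|w]; first by rewrite lt_min d0.
rewrite lt_min => /andP[wd wr]; rewrite -!fg//; first exact: fd.
by rewrite subrr ComplexField.Normc.normc0.
Qed.

(** Goursat's theorem applies to the four rectangles that surround the small square. *)
Lemma rect_centre (h : C -> C) (e : R) : 0 < e -> e < 1 ->
  (forall z, inrect (-1) 1 (-1) 1 z -> ccont h z) ->
  (forall z, inrect (-1) 1 (-1) 1 z -> z != 0 -> cdiff h z) ->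
  rect h (-1) 1 (-1) 1 = rect h (- e) e (- e) e.
Proof.
move=> e0 e1 hc hd.
have sub (a b c d' : R) : -1 <= a -> b <= 1 -> -1 <= c -> d' <= 1 -> forall z,
    inrect a b c d' z -> inrect (-1) 1 (-1) 1 z.
  move=> ha hb hc' hd' z [/andP[z1 z2] /andP[z3 z4]]; split.
    by rewrite (le_trans ha z1) (le_trans z2 hb).
  by rewrite (le_trans hc' z3) (le_trans z4 hd').
have rz (a b c d' : R) : -1 <= a -> a <= b -> b <= 1 -> -1 <= c -> c <= d' -> d' <= 1 ->
    (forall z, inrect a b c d' z -> z != 0) -> rect h a b c d' = 0.
  move=> ha ab hb hc' cd hd' nz; apply: goursat => // z zin; apply: hd (nz _ zin).
  exact: (sub a b c d' ha hb hc' hd' _ zin).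
have cin (a b c d' : R) : -1 <= a -> b <= 1 -> -1 <= c -> d' <= 1 -> forall z,
    inrect a b c d' z -> ccont h z.
  by move=> ha hb hc' hd' z zin; apply: hc; exact: (sub a b c d' ha hb hc' hd' _ zin).
rewrite (@rect_splith _ h _ _ _ _ (- e)); [|lra..|exact: cin].
rewrite (@rect_splith _ h (-1) 1 (- e) 1 e); [|lra..|by apply: cin; lra].
rewrite (@rect_splitv _ h (-1) 1 (- e) e (- e)); [|lra..|by apply: cin; lra].
rewrite (@rect_splitv _ h (- e) 1 (- e) e e); [|lra..|by apply: cin; lra].
rewrite (rz (-1) 1 (-1) (- e)); [|lra..|]; last first.
  by move=> z [_ /andP[_ z4]]; apply/eqP => z0; move: z4; rewrite z0 /=; lra.
rewrite (rz (-1) (- e) (- e) e); [|lra..|]; last first.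
  by move=> z [/andP[_ z4] _]; apply/eqP => z0; move: z4; rewrite z0 /=; lra.
rewrite (rz e 1 (- e) e); [|lra..|]; last first.
  by move=> z [/andP[z4 _] _]; apply/eqP => z0; move: z4; rewrite z0 /=; lra.
rewrite (rz (-1) 1 e 1); [|lra..|]; last first.
  by move=> z [_ /andP[z4 _]]; apply/eqP => z0; move: z4; rewrite z0 /=; lra.
by rewrite !add0r !addr0.
Qed.

(** This replaces Cauchy's integral formula. The quotient h = (g - g 0) / z extends
   continuously to 0, so its contour integral vanishes; on the boundary h = - g 0 / z, and the
   contour integral of 1 / z is not 0. *)
Lemma square_center (g : C -> C) : (forall z, inrect (-1) 1 (-1) 1 z -> cdiff g z) ->
  (forall z, inrect (-1) 1 (-1) 1 z ->
    (Re z == -1) || (Re z == 1) || (Im z == -1) || (Im z == 1) -> g z = 0) -> g 0 = 0.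
Proof.
move=> gd g0.
have in0 : inrect (-1) 1 (-1) 1 (0 : C) by split; rewrite /= oppr_le0 ler01.
have [l hl] := gd 0 in0.
pose h z := if z == 0 then l else (g z - g 0) * z^-1.
have hd z : inrect (-1) 1 (-1) 1 z -> z != 0 -> cdiff h z.
  move=> zin z0; apply: (@near_cdiff (fun z => (g z + - g 0) * z^-1) _ _ (N z)).
  - by rewrite normc_gt0.
  - move=> w wz; rewrite /h; case: eqP => // w0; move: wz.
    by rewrite w0 sub0r normcN ltxx.
  apply: cdiffM; last by apply: cdiffV => //; exact: cdiff_id.
  by apply: cdiffD; [exact: gd|exact: cdiff_cst].
have hc z : inrect (-1) 1 (-1) 1 z -> ccont h z.
  have [-> _|z0 zin] := eqVneq z 0; last by apply: cdiff_ccont; exact: hd.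
  move=> e e0; have [d d0 fd] := hl (e / 2) ltac:(by rewrite divr_gt0).
  exists d => // w wd; rewrite /h eqxx; case: eqVneq => [_|w0].
    by rewrite subrr ComplexField.Normc.normc0.
  have := fd w wd; rewrite subr0 => H.
  have -> : (g w - g 0) * w^-1 - l = (g w - g 0 - l * w) * w^-1.
    by rewrite [RHS]mulrBl mulfK.
  rewrite normcM ComplexField.Normc.normcV ltr_pdivrMr ?normc_gt0//.
  by apply: le_lt_trans H _; rewrite ltr_pM2r ?normc_gt0//; lra.
have lt11 : (-1 : R) < 1 by lra.
(* by [rect_centre] the integral is at most a multiple of e, for every e *)
have rh0 : rect h (-1) 1 (-1) 1 = 0.
  have [d d0 hd0] := hc 0 in0 1 ltr01.
  pose M := N l + 1; have M0 : 0 < M by rewrite ltr_pwDr// normc_ge0.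
  have H e : 0 < e -> e < 1 -> e < d / 2 -> N (rect h (-1) 1 (-1) 1) <= 16 * M * e.
    move=> e0 e1 ed.
    rewrite (rect_centre e0 e1 hc hd).
    apply: le_trans (rect_bound (M := M) _ _ _ _) _; [lra|lra| | |].
    - apply: rect_bd_ctson; [lra|lra|] => z [/andP[z1 z2] /andP[z3 z4]].
      by apply: hc; split; apply/andP; split; lra.
    - move=> z [z1 z2] _; rewrite -[h z](subrK (h 0)).
      apply: le_trans (le_normcD _ _) _; rewrite /M addrC lerD//.
        by rewrite /h eqxx.
      apply/ltW/hd0; rewrite subr0; apply: le_lt_trans (normc_le _) _.
      have : `|Re z| <= e by rewrite ler_norml.
      have : `|Im z| <= e by rewrite ler_norml.
      lra.
    by rewrite le_eqVlt; apply/orP; left; apply/eqP; ring.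
  apply/eqP; rewrite -normc_eq0 eq_le normc_ge0 andbT.
  apply/ler_addgt0Pr => e e0; rewrite add0r.
  pose k := Num.min (Num.min (1 / 2) (d / 4)) (e / (16 * M)).
  have M16 : 0 < 16 * M by rewrite mulr_gt0.
  have k0 : 0 < k by rewrite !lt_min !divr_gt0.
  have k1 : k <= 1 / 2 by rewrite /k !ge_min lexx.
  have k2 : k <= d / 4 by rewrite /k !ge_min lexx orbT.
  have k3 : k <= e / (16 * M) by rewrite /k !ge_min lexx orbT.
  apply: le_trans (H k _ _ _) _ => //; [lra|lra|].
  by rewrite mulrC -ler_pdivlMr.
pose v (z : C) := z^-1.
have bnz z : inrect (-1) 1 (-1) 1 z ->
    (Re z == -1) || (Re z == 1) || (Im z == -1) || (Im z == 1) -> z != 0.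
  move=> _ H; apply/eqP => z0; move: H; rewrite z0 /=.
  by rewrite -!orbA => /or4P[] /eqP e; lra.
have onb : [/\ forall x : R, -1 <= x <= 1 -> inrect (-1) 1 (-1) 1 (hor (-1) x),
   forall x : R, -1 <= x <= 1 -> inrect (-1) 1 (-1) 1 (hor 1 x),
   forall x : R, -1 <= x <= 1 -> inrect (-1) 1 (-1) 1 (ver 1 x) &
   forall x : R, -1 <= x <= 1 -> inrect (-1) 1 (-1) 1 (ver (-1) x)].
  by split=> x xab; split; rewrite //= ?lexx ?(ltW lt11).
have [ho1 ho2 ho3 ho4] := onb.
have cv (p : R -> C) : path1 p -> (forall x, -1 <= x <= 1 -> p x != 0) ->
    cctson (-1) 1 (fun x => v (p x)).
  move=> pp p0; apply: ccont_path pp _ => x xab.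
  by apply: cdiff_ccont; apply: cdiffV; [exact: p0|exact: cdiff_id].
have b1 (x : R) : -1 <= x <= 1 -> hor (-1) x != 0.
  by move=> xab; apply: bnz (ho1 _ xab) _; rewrite /= eqxx ?orbT.
have b2 (x : R) : -1 <= x <= 1 -> hor 1 x != 0.
  by move=> xab; apply: bnz (ho2 _ xab) _; rewrite /= eqxx ?orbT.
have b3 (x : R) : -1 <= x <= 1 -> ver 1 x != 0.
  by move=> xab; apply: bnz (ho3 _ xab) _; rewrite /= eqxx ?orbT.
have b4 (x : R) : -1 <= x <= 1 -> ver (-1) x != 0.
  by move=> xab; apply: bnz (ho4 _ xab) _; rewrite /= eqxx ?orbT.
have bdv : bd_ctson v (-1) 1 (-1) 1.
  by split; apply: cv => //; [exact: hor_path1|exact: hor_path1|exact: ver_path1|exact: ver_path1].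
have E : rect h (-1) 1 (-1) 1 = (- g 0) * rect v (-1) 1 (-1) 1.
  rewrite -rectZ//; rewrite /rect.
  congr (_ - _ + _ * (_ - _)); apply: eq_ci => x xab; rewrite /h.
  - by rewrite (negbTE (b1 _ xab)) (g0 _ (ho1 _ xab)) ?sub0r//= eqxx ?orbT.
  - by rewrite (negbTE (b2 _ xab)) (g0 _ (ho2 _ xab)) ?sub0r//= eqxx ?orbT.
  - by rewrite (negbTE (b3 _ xab)) (g0 _ (ho3 _ xab)) ?sub0r//= eqxx ?orbT.
  - by rewrite (negbTE (b4 _ xab)) (g0 _ (ho4 _ xab)) ?sub0r//= eqxx ?orbT.
suff v0 : rect v (-1) 1 (-1) 1 != 0.
  by move/eqP: rh0; rewrite E mulf_eq0 (negbTE v0) orbF oppr_eq0 => /eqP.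
(* each side contributes at least 1 to the imaginary part of the integral of 1 / z, since
   1 / (1 + x^2) >= 1 / 2 there *)
have [[_ c1] [_ c2] [c3 _] [c4 _]] := bdv.
have sq (x : R) : -1 <= x <= 1 -> 2^-1 <= (x ^+ 2 + 1)^-1.
  move=> /andP[x1 x2]; have x0 : 0 <= x ^+ 2 := sqr_ge0 x.
  have xle : x ^+ 2 <= 1 by nra.
  by rewrite lef_pV2 ?posrE; lra.
have low (p : R -> R) : ctson (-1) 1 p -> (forall x, -1 <= x <= 1 -> 2^-1 <= p x) ->
    1 <= rint p (-1) 1.
  move=> cp p2; have : rint (fun=> 2^-1) (-1) 1 <= rint p (-1) 1.
    by apply: le_rint => //; exact: ctson_cst.
  by rewrite rint_cst ?(ltW lt11)//; lra.
have up (p : R -> R) : ctson (-1) 1 p -> (forall x, -1 <= x <= 1 -> p x <= - 2^-1) ->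
    rint p (-1) 1 <= - 1.
  move=> cp p2; have : rint p (-1) 1 <= rint (fun=> - 2^-1) (-1) 1.
    by apply: le_rint => //; exact: ctson_cst.
  by rewrite rint_cst ?(ltW lt11)//; lra.
have l1 : 1 <= rint (fun x => Im (v (hor (-1) x))) (-1) 1.
  by apply: low => // x /sq /=; rewrite sqrrN expr1n mulN1r opprK.
have l2 : rint (fun x => Im (v (hor 1 x))) (-1) 1 <= -1.
  by apply: up => // x /sq /=; rewrite expr1n mul1r lerN2.
have l3 : 1 <= rint (fun x => Re (v (ver 1 x))) (-1) 1.
  by apply: low => // x /sq /=; rewrite expr1n mul1r addrC.
have l4 : rint (fun x => Re (v (ver (-1) x))) (-1) 1 <= -1.
  by apply: up => // x /sq /=; rewrite sqrrN expr1n mulN1r lerN2 addrC.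
apply/eqP => r0; have : Im (rect v (-1) 1 (-1) 1) = 0 by rewrite r0.
rewrite /rect !(ImD, ImM, ReD, ReN, ImN) /= mul0r add0r mul1r.
lra.
Qed.

(** The product of the values of f at i + z, i + i z, i - z, i - i z vanishes whenever z lies
   on the boundary of the square [-1, 1]^2, because one of the four points is then real. *)
Lemma identity_real (f : C -> C) : (forall z, N z < 4 -> cdiff f z) ->
  (forall x : R, `|x| <= 1 -> f (x%:C)%C = 0) -> f (0 +i* 1) = 0.
Proof.
move=> fd f0; set I := 0 +i* 1.
pose g z := (f (I + 1 * z) * f (I + I * z)) * (f (I + - 1 * z) * f (I + - I * z)).
have : g 0 = 0.
  apply: square_center => [z [z1 z2]|z [z1 z2]].
    have nz (q : C) : N q = 1 -> cdiff f (I + q * z).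
      move=> q1; apply: fd; apply: le_lt_trans (le_normcD _ _) _.
      rewrite normcM q1 mul1r; have -> : N I = 1 by rewrite /= expr0n expr1n add0r sqrtr1.
      have : N z <= 2.
        apply: le_trans (normc_le _) _; have : `|Re z| <= 1 by rewrite ler_norml.
        have : `|Im z| <= 1 by rewrite ler_norml.
        lra.
      lra.
    have NI : N I = 1 by rewrite /= expr0n expr1n add0r sqrtr1.
    have N1 : N 1 = 1 by exact: ComplexField.Normc.normc1.
    by apply: cdiffM; apply: cdiffM; apply: cdiff_affine; apply: nz; rewrite ?normcN.
  have i1 : `|Re z| <= 1 by rewrite ler_norml.
  have i2 : `|Im z| <= 1 by rewrite ler_norml.
  rewrite /g -!orbA => /or4P[] /eqP e.
  - have -> : I + I * z = ((- Im z)%:C)%C.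
      by case: z e {z1 z2 i1 i2} => a b /= ->; rewrite /I; cring.
    by rewrite (f0 (- Im z)) ?normrN// mulr0 mul0r.
  - have -> : I + - I * z = ((Im z)%:C)%C.
      by case: z e {z1 z2 i1 i2} => a b /= ->; rewrite /I; cring.
    by rewrite (f0 (Im z))// !mulr0.
  - have -> : I + 1 * z = ((Re z)%:C)%C.
      by case: z e {z1 z2 i1 i2} => a b /= ->; rewrite /I; cring.
    by rewrite (f0 (Re z))// !mul0r.
  - have -> : I + - 1 * z = ((- Re z)%:C)%C.
      by case: z e {z1 z2 i1 i2} => a b /= ->; rewrite /I; cring.
    by rewrite (f0 (- Re z)) ?normrN// mul0r mulr0.
rewrite /g !mulr0 !addr0 => /eqP.
by rewrite !mulf_eq0 !orbb => /eqP.
Qed.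
End Identity.

(** * The polarized tangency equation *)

Section Polarized.
Variable R : realType.
Local Notation C := R[i].
Local Notation N := (@ComplexField.Normc.normc R).

(** With [lcM] and [lcD], proves an equation as a linear combination of equations, the rest
   being left to [ring]. *)
Lemma lc (a b l r : C) : l = r -> a - b = l - r -> a = b.
Proof. by move=> ->; rewrite subrr => /eqP; rewrite subr_eq0 => /eqP. Qed.
Lemma lcM (c l r : C) : l = r -> c * l = c * r. Proof. by move->. Qed.
Lemma lcD (l r l' r' : C) : l = r -> l' = r' -> l + l' = r + r'. Proof. by move=> -> ->. Qed.

Lemma mul_eq0 (c x : C) : c != 0 -> c * x = 0 -> x = 0.
Proof. by move=> c0 /eqP; rewrite mulf_eq0 (negbTE c0) => /eqP. Qed.

Lemma normcD_lt (a b : C) (r s t : R) : N a < r -> N b < s -> r + s <= t -> N (a + b) < t.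
Proof. by move=> ar bs rst; apply: le_lt_trans (le_normcD _ _) _; lra. Qed.

Lemma normcM_lt (a b : C) (r s t : R) : N a <= r -> N b < s -> 0 < r -> r * s <= t -> N (a * b) < t.
Proof.
move=> ar bs r0 rst; rewrite normcM; apply: le_lt_trans (ler_wpM2r (normc_ge0 _) ar) _.
by apply: lt_le_trans rst; rewrite ltr_pM2l.
Qed.

Lemma normc_half (x : R) : 0 <= x -> N ((x%:C)%C / 2) = x / 2.
Proof.
move=> x0; rewrite normcM ComplexField.Normc.normcV normc_real ger0_norm//.
by rewrite -[2](rmorph_nat (real_complex R)) normc_real ger0_norm.
Qed.

Lemma normc00 : N 0 = 0.
Proof. exact: ComplexField.Normc.normc0. Qed.

Lemma normc2 : N 2 = 2.
Proof. by rewrite -[2](rmorph_nat (real_complex R)) normc_real ger0_norm. Qed.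

Section Alg.
Variable m : nat.
Local Notation Z := 'rV[C]_m.

Definition dot (z z' : Z) : C := \sum_j z ord0 j * z' ord0 j.

Lemma dotC z z' : dot z z' = dot z' z.
Proof. by apply: eq_bigr => j _; rewrite mulrC. Qed.

Lemma dot0l z : dot 0 z = 0.
Proof. by apply: big1 => j _; rewrite mxE mul0r. Qed.

Lemma dotZl k z z' : dot (k *: z) z' = k * dot z z'.
Proof. by rewrite /dot mulr_sumr; apply: eq_bigr => j _; rewrite mxE mulrA. Qed.

Lemma dotDl a b z' : dot (a + b) z' = dot a z' + dot b z'.
Proof. by rewrite /dot -big_split; apply: eq_bigr => j _; rewrite mxE mulrDl. Qed.

Lemma dotZr k z z' : dot z (k *: z') = k * dot z z'.
Proof. by rewrite dotC dotZl dotC. Qed.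

Lemma dotBr z a b : dot z (a - b) = dot z a - dot z b.
Proof. by rewrite -[- b]scaleN1r dotC dotDl dotZl mulN1r ![dot _ z]dotC. Qed.

Lemma dot_delta z (k : 'I_m) : dot z (delta_mx ord0 k) = z ord0 k.
Proof.
rewrite /dot (bigD1 k)//= mxE !eqxx mulr1 big1 ?addr0// => j jk.
by rewrite mxE (negbTE jk) andbF mulr0.
Qed.

Lemma dotZd z y (k : 'I_m) : dot z (y *: delta_mx ord0 k) = y * z ord0 k.
Proof. by rewrite dotC dotZl dotC dot_delta. Qed.

Lemma dot_deltal z y (k : 'I_m) : dot (y *: delta_mx ord0 k) z = y * z ord0 k.
Proof. by rewrite dotC dotZd. Qed.

(** A vector field in the coordinates (u, w, zeta, v): vA, vB, vK, vD are its components along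
   u, w, zeta and v. *)
Record vf := VF {
  vA : C -> C -> Z -> C -> C; vB : C -> C -> Z -> C -> C;
                  vK : C -> C -> Z -> C -> Z; vD : C -> C -> Z -> C -> C }.

(** The polydisc of radius d centred at the base point (1, 0, 0, 0). *)
Definition pt (d : R) (u w : C) (z : Z) (v : C) :=
  [/\ N (u - 1) < d, N w < d, (forall j, N (z ord0 j) < d) & N v < d].

(** Tangency after polarization: the pair of fields X, Y annihilates the complexified equation
   at all small pairs of points that satisfy it. For Y the conjugate of X and conjugate points
   this is tangency of the real part of X. *)
Definition pol (d : R) (X Y : vf) := forall u w z v u' w' z' v',
  pt d u w z v -> pt d u' w' z' v' ->
  2 * (v + v') = (u + u') * (w + w' + dot z z') ->
  2 * (vD X u w z v + vD Y u' w' z' v') =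
    (vA X u w z v + vA Y u' w' z' v') * (w + w' + dot z z')
    + (u + u') * (vB X u w z v + vB Y u' w' z' v'
        + dot (vK X u w z v) z' + dot z (vK Y u' w' z' v')).

Lemma pol_sym d X Y : pol d X Y -> pol d Y X.
Proof.
move=> E u w z v u' w' z' v' h h' e.
have e2 : 2 * (v' + v) = (u' + u) * (w' + w + dot z' z).
  by rewrite (addrC v') e (addrC u') (addrC w') (dotC z').
have := E _ _ _ _ _ _ _ _ h' h e2; rewrite (dotC z' z) (dotC (vK X _ _ _ _)) (dotC z').
by move=> H; apply: (lc H); ring.
Qed.

Lemma pol_le d d' X Y : d' <= d -> pol d X Y -> pol d' X Y.
Proof.
move=> dd E u w z v u' w' z' v' [h1 h2 h3 h4] [g1 g2 g3 g4].
by apply: E; split=> [||j|]; apply: lt_le_trans dd.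
Qed.

Lemma pt_le d d' u w z v : d' <= d -> pt d' u w z v -> pt d u w z v.
Proof. by move=> dd [h1 h2 h3 h4]; split=> [||j|]; apply: lt_le_trans dd. Qed.

(** The second point has zeta' on a coordinate axis, and v' is computed from the equation. The
   radii d / 32 and d / 8 make v' smaller than d. *)
Lemma pol_line_pt (d : R) X Y (u w : C) (z : Z) (v u' w' y : C) (k : 'I_m) : 0 < d <= 1 -> pol d X Y ->
  N (u - 1) < d -> N w < d / 32 -> (forall j, N (z ord0 j) < d / 32) -> N v < d / 8 ->
  N (u' - 1) < d -> N w' < d / 32 -> N y < d ->
  let p := w + w' + y * z ord0 k in
  let z' := y *: delta_mx ord0 k in
  let v' := (u + u') * p / 2 - v in
  pt d u' w' z' v' /\
  2 * (vD X u w z v + vD Y u' w' z' v') =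
    (vA X u w z v + vA Y u' w' z' v') * p
    + (u + u') * (vB X u w z v + vB Y u' w' z' v'
        + y * vK X u w z v ord0 k + dot z (vK Y u' w' z' v')).
Proof.
move=> /andP[d0 d1] E hu hw hz hv hu' hw' hy p z' v'.
have zz : dot z z' = y * z ord0 k by rewrite /z' dotZd.
have pE : w + w' + dot z z' = p by rewrite zz.
have hyz : N (y * z ord0 k) < d / 32 by apply: (normcM_lt (r := 1) (s := d / 32)) => //; lra.
have hp : N p < 3 * d / 32.
  apply: (normcD_lt _ hyz (r := 2 * d / 32)); last by lra.
  by apply: (normcD_lt hw hw'); lra.
have hs : N (u + u') <= 4.
  have -> : u + u' = (u - 1) + (u' - 1) + 2 by ring.
  apply: le_trans (le_normcD _ _) _; rewrite normc2.
  have : N (u - 1 + (u' - 1)) < 2 * d by apply: normcD_lt hu hu' _; lra.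
  lra.
have hv' : N v' < d.
  apply: (normcD_lt (r := 6 * d / 32) (s := d / 8)); [|by rewrite normcN|by lra].
  rewrite normcM ComplexField.Normc.normcV normc2.
  have : N ((u + u') * p) < 4 * (3 * d / 32) by apply: (normcM_lt hs hp); lra.
  lra.
have pt' : pt d u' w' z' v'.
  split=> // [|j]; first by apply: lt_le_trans hw' _; lra.
  rewrite /z' mxE mxE eqxx /=; case: (j == k); rewrite ?mulr1// mulr0.
  by rewrite ComplexField.Normc.normc0.
split=> //; have H := E u w z v u' w' z' v'; rewrite pE in H; rewrite H //.
- by rewrite /z' dotZd.
- by split=> // [|j|]; [apply: lt_le_trans hw _|apply: lt_le_trans (hz j) _|apply: lt_le_trans hv _]; lra.
- by rewrite /v'; field.
Qed.

Lemma pol_line (d : R) X Y (u w : C) (z : Z) (v u' w' y : C) (k : 'I_m) : 0 < d <= 1 -> pol d X Y ->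
  N (u - 1) < d -> N w < d / 32 -> (forall j, N (z ord0 j) < d / 32) -> N v < d / 8 ->
  N (u' - 1) < d -> N w' < d / 32 -> N y < d ->
  let p := w + w' + y * z ord0 k in
  let z' := y *: delta_mx ord0 k in
  let v' := (u + u') * p / 2 - v in
  2 * (vD X u w z v + vD Y u' w' z' v') =
    (vA X u w z v + vA Y u' w' z' v') * p
    + (u + u') * (vB X u w z v + vB Y u' w' z' v'
        + y * vK X u w z v ord0 k + dot z (vK Y u' w' z' v')).
Proof. by move=> d01 E h1 h2 h3 h4 h5 h6 h7; have [] := pol_line_pt k d01 E h1 h2 h3 h4 h5 h6 h7. Qed.

Lemma normc_scale (d : R) : 0 < d -> N ((d%:C)%C / 2) = d / 2.
Proof. by move=> d0; apply: normc_half; exact: ltW. Qed.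

Lemma half_neq0 (d : R) : 0 < d -> (d%:C)%C / 2 != 0.
Proof. by move=> d0; rewrite -normc_gt0 normc_scale// divr_gt0. Qed.

Lemma second_difference (p S S1 S2 t h D0 D1 D2 E E0 A0 A1 A2 A A' B0 B1 B2 B B' g0 g1 g2 c c' : C) :
  S1 = S + t / 2 -> S2 = S + t ->
  2 * (D0 + E) = (A0 + A) * p + S * (B0 + B + h * g0 + c) ->
  2 * (D0 + E0) = (A0 + A') * p + S * (B0 + B' + 0 * g0 + c') ->
  2 * (D1 + E) = (A1 + A) * p + S1 * (B1 + B + h * g1 + c) ->
  2 * (D1 + E0) = (A1 + A') * p + S1 * (B1 + B' + 0 * g1 + c') ->
  2 * (D2 + E) = (A2 + A) * p + S2 * (B2 + B + h * g2 + c) ->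
  2 * (D2 + E0) = (A2 + A') * p + S2 * (B2 + B' + 0 * g2 + c') ->
  h * (S * (g0 - 2 * g1 + g2) + t * (g2 - g1)) = 0.
Proof.
move=> -> -> F1 F2 F3 F4 F5 F6.
apply: (lc (lcD (lcD (lcD (lcM (- 1) F1) F2) (lcM (- 2) (lcD (lcM (- 1) F3) F4))) (lcD (lcM (- 1) F5) F6))).
by field.
Qed.

(** Moving the first point along (1, 0, 0, p / 2) leaves v' = (u + u') p / 2 - v unchanged.
   With the second point fixed, the equation is then affine in u + u' along the line, and
   comparing three points of the line for two values of u' and two of zeta' isolates the
   zeta-component. *)
Lemma vK_line (d : R) X Y (u u3 w : C) (z : Z) (v p : C) (k : 'I_m) : 0 < d <= 1 -> pol d X Y ->
  N (u - 1) < 3 * d / 4 -> N (u3 - 1) < 3 * d / 4 -> N w < d / 128 ->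
  (forall j, N (z ord0 j) < d / 128) -> N v < d / 16 -> N p < d / 128 ->
  vK X u3 w z (v + p / 2 * (u3 - u)) ord0 k = vK X u w z v ord0 k.
Proof.
move=> d01 E hu hu3 hw hz hv hp; have /andP[d0 d1] := d01.
have [->|ne] := eqVneq u3 u; first by rewrite subrr mulr0 addr0.
set t := u3 - u; have t0 : t != 0 by rewrite subr_eq0.
set h := (d%:C)%C / 2; have h0 : h != 0 := half_neq0 d0.
have Nh : N h = d / 2 := normc_scale d0.
pose g s := vK X (u + s) w z (v + p / 2 * s) ord0 k.
pose w' (y : C) := p - w - y * z ord0 k.
have F s y u' : N (u + s - 1) < 3 * d / 4 -> N s < 2 * d -> N y <= d / 2 -> N (u' - 1) < d ->
  let v' := (u + u') * p / 2 - v in let z' := y *: delta_mx ord0 k in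
  2 * (vD X (u + s) w z (v + p / 2 * s) + vD Y u' (w' y) z' v') =
   (vA X (u + s) w z (v + p / 2 * s) + vA Y u' (w' y) z' v') * p
   + (u + s + u') * (vB X (u + s) w z (v + p / 2 * s) + vB Y u' (w' y) z' v' + y * g s
      + dot z (vK Y u' (w' y) z' v')).
  move=> hs1 hs2 hy hu' v' z'.
  have pE : w + w' y + y * z ord0 k = p by rewrite /w'; ring.
  have /= := @pol_line d X Y (u + s) w z (v + p / 2 * s) u' (w' y) y k d01 E.
  rewrite pE; have -> : (u + s + u') * p / 2 - (v + p / 2 * s) = v' by rewrite /v'; field.
  apply.
  - by apply: lt_le_trans hs1 _; lra.
  - by apply: lt_le_trans hw _; lra.
  - by move=> j; apply: lt_le_trans (hz j) _; lra.
  - apply: (normcD_lt hv (s := d / 16)); last by lra.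
    rewrite normcM; have -> : N (p / 2) = N p / 2 by rewrite normcM ComplexField.Normc.normcV normc2.
    by have := normc_ge0 p; have := normc_ge0 s; nra.
  - by [].
  - rewrite /w'; apply: (normcD_lt (r := d / 64) (s := d / 64)); last by lra.
      by apply: (normcD_lt hp (s := d / 128)); rewrite ?normcN//; lra.
    rewrite normcN; apply: (normcM_lt (r := 1) (s := d / 128)) => //; lra.
  - by apply: le_lt_trans hy _; lra.
have Nt : N t < 2 * d.
  have -> : t = (u3 - 1) + - (u - 1) by rewrite /t; ring.
  by apply: (normcD_lt hu3 (s := 3 * d / 4)); rewrite ?normcN//; lra.
have Nt2 : N (t / 2) < 2 * d.
  by rewrite normcM ComplexField.Normc.normcV normc2; have := normc_ge0 t; lra.
have s0 : N (u + 0 - 1) < 3 * d / 4 by rewrite addr0.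
have s2 : N (u + t - 1) < 3 * d / 4 by have -> : u + t = u3 by rewrite /t addrC subrK.
have s1 : N (u + t / 2 - 1) < 3 * d / 4.
  have -> : u + t / 2 - 1 = ((u3 - 1) + (u - 1)) / 2 by rewrite /t; field.
  rewrite normcM ComplexField.Normc.normcV normc2.
  have : N (u3 - 1 + (u - 1)) < 6 * d / 4 by apply: normcD_lt hu3 hu _; lra.
  lra.
(* second difference in s at 0, t / 2, t, and difference in y at h, 0: the components of Y cancel *)
have Q u' : N (u' - 1) < d ->
  (u + u') * (g 0 - 2 * g (t / 2) + g t) + t * (g t - g (t / 2)) = 0.
  move=> hu'.
  have n0 : N 0 < 2 * d by rewrite ComplexField.Normc.normc0 mulr_gt0.
  have y0 : N 0 <= d / 2 by rewrite ComplexField.Normc.normc0 divr_ge0// ltW.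
  have yh : N h <= d / 2 by rewrite Nh.
  have F1 := F 0 h u' s0 n0 yh hu'.
  have F2 := F 0 0 u' s0 n0 y0 hu'.
  have F3 := F (t / 2) h u' s1 Nt2 yh hu'.
  have F4 := F (t / 2) 0 u' s1 Nt2 y0 hu'.
  have F5 := F t h u' s2 Nt yh hu'.
  have F6 := F t 0 u' s2 Nt y0 hu'.
  apply: (mul_eq0 h0).
  rewrite -{1}[u]addr0.
  by apply: (second_difference _ _ F1 F2 F3 F4 F5 F6); ring.
have d1' : N (1 - 1 : C) < d by rewrite subrr ComplexField.Normc.normc0.
have d2' : N (1 + h - 1 : C) < d by rewrite addrC addKr Nh; lra.
have Q1 := Q 1 d1'; have Q2 := Q (1 + h) d2'.
have G : g 0 - 2 * g (t / 2) + g t = 0.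
  by apply: (mul_eq0 h0); apply: (lc (lcD Q2 (lcM (- 1) Q1))); ring.
have G2 : g t - g (t / 2) = 0.
  by apply: (mul_eq0 t0); rewrite G mulr0 add0r in Q1.
have : g t = g 0 by apply: (lc (lcD (lcM 2 G2) (lcM (- 1) G))); ring.
by rewrite /g mulr0 !addr0 /t [u + _]addrC subrK.
Qed.

(** The line of [vK_line] through (u, v) is chosen to end at v = 0 and at a fixed u different
   from 1. *)
Lemma vK_uv (d : R) X Y (u w : C) (z : Z) (v : C) : 0 < d <= 1 -> pol d X Y ->
  N (u - 1) < d / 128 -> N w < d / 128 -> (forall j, N (z ord0 j) < d / 128) ->
  N v < d ^+ 2 / 1024 ->
  vK X u w z v = vK X (1 + (d%:C)%C / 2) w z 0.
Proof.
move=> d01 E hu hw hz hv; have /andP[d0 d1] := d01.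
set h := (d%:C)%C / 2; have Nh : N h = d / 2 := normc_scale d0.
apply/rowP => k; have e0 : 1 + h - u != 0.
  rewrite -normc_gt0; have := normcDB (1 + h) u 1; rewrite [1 + h - 1]addrC addKr Nh.
  lra.
have dd : d ^+ 2 <= d by rewrite expr2 ler_piMr// ltW.
(* the slope for which the line through (u, v) reaches v = 0 at u = 1 + h *)
pose p := - v * 2 / (1 + h - u).
have <- : v + p / 2 * (1 + h - u) = 0 by rewrite /p; field.
symmetry; apply: vK_line E _ _ _ _ _ _ => //.
- by apply: lt_le_trans hu _; lra.
- by rewrite addrC addKr Nh; lra.
- by apply: lt_le_trans hv _; lra.
rewrite /p normcM ComplexField.Normc.normcV ltr_pdivrMr ?normc_gt0// normcM normcN normc2.
have : d / 4 <= N (1 + h - u).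
  have := normcDB (1 + h) u 1; rewrite [1 + h - 1]addrC addKr Nh; lra.
nra.
Qed.

End Alg.
End Polarized.

(** * Dependence on zeta *)

Section Affine.
Variable R : realType.
Local Notation C := R[i].
Local Notation N := (@ComplexField.Normc.normc R).
Section Alg.
Variable m : nat.
Local Notation Z := 'rV[C]_m.
Local Notation vf := (@vf R m).
Variable k0 : 'I_m.

(** The shape of the components once their dependence on zeta is known. *)
Definition red (d : R) (X : vf) := forall u w z v, pt d u w z v ->
  [/\ vA X u w z v = vA X u w 0 v, vB X u w z v = vB X u w 0 v,
      vD X u w z v = vD X u w 0 v, vK X u w z v = vK X 1 w z 0 & vK X 1 w 0 0 = 0].

Definition Kuv (d : R) (X : vf) := forall u w z v, pt d u w z v -> vK X u w z v = vK X 1 w z 0.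

(** With zeta' = 0 the product zeta.zeta' vanishes, so zeta and 0 have the same second point.
   The difference of the two equations is affine in u' and in w', which separates the
   components. *)
Lemma zeta_indep (d : R) (X Y : vf) : 0 < d <= 1 -> pol d X Y -> Kuv d Y -> vK Y 1 0 0 0 = 0 ->
  (forall u w z v, pt (d / 32) u w z v ->
    [/\ vA X u w z v = vA X u w 0 v, vB X u w z v = vB X u w 0 v & vD X u w z v = vD X u w 0 v])
  /\ (forall w, N w < d / 32 -> vK Y 1 w 0 0 = 0).
Proof.
move=> d01 E hK K0; have /andP[d0 d1] := d01.
set h := (d%:C)%C / 2; have h0 : h != 0 := half_neq0 d0; have Nh : N h = d / 2 := normc_scale d0.
have d320 : 0 < d / 32 by rewrite divr_gt0.
set g := ((d / 32)%:C)%C / 2; have g0 : g != 0 := half_neq0 d320.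
have Ng : N g = d / 32 / 2 := normc_scale d320.
have nm0 : N 0 = 0 by exact: normc00.
have F u w z v u' w' : pt (d / 32) u w z v -> N (u' - 1) < d -> N w' < d / 32 ->
    2 * (vD X u w z v - vD X u w 0 v) = (vA X u w z v - vA X u w 0 v) * (w + w')
     + (u + u') * (vB X u w z v - vB X u w 0 v + dot z (vK Y 1 w' 0 0)).
  move=> [hu hw hz hv] hu' hw'.
  have hu1 : N (u - 1) < d by apply: lt_le_trans hu _; lra.
  have hv1 : N v < d / 8 by apply: lt_le_trans hv _; lra.
  have z0 j : N ((0 : Z) ord0 j) < d / 32 by rewrite mxE nm0.
  have y0 : N 0 < d by rewrite nm0.
  have := pol_line_pt k0 d01 E hu1 hw hz hv1 hu' hw' y0.
  have := pol_line_pt k0 d01 E hu1 hw z0 hv1 hu' hw' y0.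
  rewrite /= !mul0r !scale0r !addr0 => -[pt' E0] [_ E1].
  rewrite (hK _ _ _ _ pt') in E0 E1; rewrite dot0l in E0.
  by apply: (lc (lcD E1 (lcM (- 1) E0))); ring.
have u1 : N (1 - 1 : C) < d by rewrite subrr nm0.
have u2 : N (1 + h - 1 : C) < d by rewrite addrC addKr Nh; lra.
have w0 : N 0 < d / 32 by rewrite nm0.
have w1 : N g < d / 32 by rewrite Ng; lra.
have dK z : dot z (vK Y 1 0 0 0) = 0 by rewrite K0 dotC dot0l.
have q0 u w z v w' : pt (d / 32) u w z v -> N w' < d / 32 -> 
   vB X u w z v - vB X u w 0 v + dot z (vK Y 1 w' 0 0) = 0.
  move=> pz hw'; have F1 := F _ _ _ _ _ _ pz u1 hw'; have F2 := F _ _ _ _ _ _ pz u2 hw'.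
  by apply: (mul_eq0 h0); apply: (lc (lcD F1 (lcM (- 1) F2))); ring.
split=> [u w z v pz|w hw].
  have B0 := q0 _ _ _ _ _ pz w0; rewrite dK addr0 in B0.
  have F1 := F _ _ _ _ _ _ pz u1 w0; have F2 := F _ _ _ _ _ _ pz u1 w1.
  rewrite (q0 _ _ _ _ _ pz w0) mulr0 !addr0 in F1.
  rewrite (q0 _ _ _ _ _ pz w1) mulr0 !addr0 in F2.
  have A0 : vA X u w z v - vA X u w 0 v = 0.
    by apply: (mul_eq0 g0); apply: (lc (lcD F1 (lcM (- 1) F2))); ring.
  rewrite A0 mul0r in F1.
  have D0 : vD X u w z v - vD X u w 0 v = 0.
    by apply: (mul_eq0 _ F1); rewrite pnatr_eq0.
  by split; apply/eqP; rewrite -subr_eq0; apply/eqP.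
apply/rowP => k; rewrite [RHS]mxE; apply: (mul_eq0 g0).
have pz : pt (d / 32) 1 0 (g *: delta_mx ord0 k) 0.
  split=> //; first by rewrite subrr nm0.
  move=> j; rewrite mxE mxE eqxx /=; case: (j == k); rewrite ?mulr1// mulr0 nm0 //.
have := q0 _ _ _ _ _ pz hw; have := q0 _ _ _ _ _ pz w0.
by rewrite dK addr0 => ->; rewrite add0r dot_deltal.
Qed.

(** Directional differentiability of the zeta-component at zeta = 0, the only regularity of
   the fields used in solving the polarized equation. *)
Definition Kdiff (d : R) (X : vf) := forall w, N w < d -> exists M : 'M[C]_m,
  forall (z : Z) (e : R), 0 < e -> exists2 t0 : R, 0 < t0 & forall t : R, 0 < t < t0 -> forall k,
    N (vK X 1 w ((t%:C)%C *: z) 0 ord0 k - vK X 1 w 0 0 ord0 k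
      - (t%:C)%C * (z *m M) ord0 k) <= e * t.

Lemma normc_dot (z a : Z) (e : R) : (forall j, N (z ord0 j) <= 1) -> (forall j, N (a ord0 j) <= e) ->
  N (dot z a) <= m%:R * e.
Proof.
move=> hz ha; rewrite /dot; have -> : m%:R * e = \sum_(j < m) e.
  by rewrite sumr_const card_ord mulr_natl.
apply: (big_ind2 (fun x y => N x <= y)); first by rewrite normc00.
  by move=> x1 x2 y1 y2 h1 h2; apply: le_trans (le_normcD _ _) (lerD h1 h2).
move=> j _; rewrite normcM; apply: le_trans (ha j).
by rewrite ler_piMl ?normc_ge0.
Qed.

Lemma normc_eq0_eps (x : C) (c : R) : (forall e : R, 0 < e -> N x <= c * e) -> x = 0.
Proof.
move=> H; apply/eqP; rewrite -normc_eq0 eq_le normc_ge0 andbT.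
apply/ler_addgt0Pr => e e0; rewrite add0r.
have c1 : 0 < `|c| + 1 by rewrite ltr_wpDl.
apply: le_trans (H (e / (`|c| + 1)) _) _; first by rewrite divr_gt0.
rewrite mulrA ler_pdivrMr// mulrC ler_pM2l//; have := ler_norm c; lra.
Qed.

(** The algebra of [K_linear], with the components of the fields as variables. *)
Lemma scaling_difference (S D Q B T h x x' y y' : C) : S != 0 ->
  D = Q + S * (B + h * x + T * y) -> D = Q + S * (B + T * h * x' + y') ->
  h * (x - T * x') = y' - T * y.
Proof. by move=> S0 E1 E2; apply: (mulfI S0); apply: (lc (lcD E2 (lcM (- 1) E1))); ring. Qed.

Lemma scaling_remainder (T h l d x x' y y' : C) : h * (x - T * x') = y' - T * y ->
  T * (h * (l - x') - (d - y)) = - (h * (x - T * l)) + (y' - T * d).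
Proof. by move=> E; apply: (lc E); ring. Qed.

(** The pairs (t zeta, zeta') and (zeta, t zeta') have the same product zeta.zeta', hence the
   same equation. Their comparison expresses vK at t zeta, divided by t, through vK at zeta;
   letting t tend to 0 makes vK agree with a linear map. *)
Lemma K_linear (d : R) (X Y : vf) : 0 < d <= 1 -> pol d X Y -> red d X -> red d Y ->
  Kdiff d X -> Kdiff d Y ->
  exists L : C -> 'M[C]_m, forall w (z : Z), N w < d / 32 -> (forall j, N (z ord0 j) < d / 32) ->
    vK X 1 w z 0 = z *m L w.
Proof.
move=> d01 E rX rY dX dY; have /andP[d0 d1] := d01.
set h := (d%:C)%C / 2; have h0 : h != 0 := half_neq0 d0; have Nh : N h = d / 2 := normc_scale d0.
have nm0 : N 0 = 0 by exact: normc00.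
have d2 : d / 2 <= 1 by lra.
have d2' : d / 2 < d by lra.
have d32 : d / 32 <= d by lra.
have d32' : 1 * (d / 32) <= d / 32 by lra.
have d32'' : d / 32 <= 1 by lra.
have dd : 1 * d <= d by lra.
have [M' hM'] := dY 0 ltac:(by rewrite nm0).
pose c k : Z := (h *: delta_mx ord0 k) *m M' - vK Y 1 0 (h *: delta_mx ord0 k) 0.
suff H w : N w < d / 32 -> exists L : 'M[C]_m, forall z : Z, (forall j, N (z ord0 j) < d / 32) ->
    vK X 1 w z 0 = z *m L.
  have H' w : exists L : 'M[C]_m, N w < d / 32 -> forall z : Z, (forall j, N (z ord0 j) < d / 32) ->
    vK X 1 w z 0 = z *m L.
    have [/H[L hL]|nw] := pselect (N w < d / 32); first by exists L.
    by exists 0.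
  by have [L hL] := choice H'; exists L => w z hw hz; exact: hL.
move=> hw; have hwd : N w < d by apply: lt_le_trans hw _; lra.
have [M hM] := dX w hwd.
have K0 (A : vf) x : red d A -> N x < d -> vK A 1 x 0 0 = 0.
  move=> rA hx; have q : pt d 1 x (0 : Z) 0.
    by split=> //; [rewrite subrr nm0|move=> j; rewrite mxE nm0|rewrite nm0].
  by have [] := rA _ _ _ _ q.
have KX0 := K0 _ _ rX hwd.
have KY0 : vK Y 1 0 0 0 = 0 by apply: K0 rY _; rewrite nm0.
exists (M - h^-1 *: \matrix_(j, k) c k ord0 j) => z hz; apply/rowP => k.
have key : h * ((z *m M) ord0 k - vK X 1 w z 0 ord0 k) - dot z (c k) = 0.
  apply: (@normc_eq0_eps _ (1 + m%:R)) => e e0.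
  have [t1 t10 ht1] := hM z e e0.
  have [t2 t20 ht2] := hM' (h *: delta_mx ord0 k) e e0.
  pose t := Num.min (Num.min t1 t2) 1 / 2.
  have tt0 : 0 < Num.min (Num.min t1 t2) 1 by rewrite !lt_min t10 t20 ltr01.
  have t0 : 0 < t by rewrite /t divr_gt0.
  have lt1 : t < t1 by apply: (@lt_le_trans _ _ (Num.min (Num.min t1 t2) 1)); [rewrite /t; lra|rewrite !ge_min lexx].
  have lt2 : t < t2 by apply: (@lt_le_trans _ _ (Num.min (Num.min t1 t2) 1)); [rewrite /t; lra|rewrite !ge_min lexx orbT].
  have lt3 : t < 1 by apply: (@lt_le_trans _ _ (Num.min (Num.min t1 t2) 1)); [rewrite /t; lra|rewrite ge_min lexx orbT].
  set T := (t%:C)%C; have NT : N T = t by rewrite normc_real ger0_norm// ltW.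
  have T0 : T != 0 by rewrite -normc_gt0 NT.
  have b1 := ht1 t ltac:(by rewrite t0 lt1) k; rewrite KX0 [X in _ - X - _]mxE subr0 in b1.
  have b2 := ht2 t ltac:(by rewrite t0 lt2).
  have u1 : N (1 - 1 : C) < d by rewrite subrr nm0.
  have v0 : N 0 < d / 8 by rewrite nm0 divr_gt0.
  have w0 : N 0 < d / 32 by rewrite nm0 divr_gt0.
  have hTz j : N ((T *: z) ord0 j) < d / 32.
    by rewrite mxE; apply: (normcM_lt (r := 1) (s := d / 32)) => //; rewrite NT ltW.
  have yh : N h < d by rewrite Nh.
  have yTh : N (T * h) < d.
    by apply: (normcM_lt (r := 1) (s := d)) => //; rewrite NT ltW.
  have [pt1 E1] := pol_line_pt k d01 E u1 hw hTz v0 u1 w0 yh.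
  have [pt2 E2] := pol_line_pt k d01 E u1 hw hz v0 u1 w0 yTh.
  have pE : h * (T *: z) ord0 k = T * h * z ord0 k by rewrite mxE; ring.
  rewrite pE in E1 pt1.
  have small x : N x < d / 32 -> N x < d by move=> hx; exact: lt_le_trans hx d32.
  have q1 : pt d 1 w (T *: z) 0 by split=> //; [move=> j; exact: small|rewrite nm0].
  have q2 : pt d 1 w z 0 by split=> //; [move=> j; exact: small|rewrite nm0].
  have [a1 a2 a3 _ _] := rX _ _ _ _ q1; have [a1' a2' a3' _ _] := rX _ _ _ _ q2.
  have [e1 e2 e3 e4 _] := rY _ _ _ _ pt1; have [e1' e2' e3' e4' _] := rY _ _ _ _ pt2.
  rewrite a1 a2 a3 e1 e2 e3 e4 in E1; rewrite a1' a2' a3' e1' e2' e3' e4' in E2.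
  have Eq : h * (vK X 1 w (T *: z) 0 ord0 k - T * vK X 1 w z 0 ord0 k) =
     dot z (vK Y 1 0 (T * h *: delta_mx ord0 k) 0) - T * dot z (vK Y 1 0 (h *: delta_mx ord0 k) 0).
    have two0 : (1 + 1 : C) != 0 := ltac:(by rewrite (pnatr_eq0 _ 2)).
    by rewrite dotZl in E1; exact: (scaling_difference two0 E1 E2).
  rewrite -(ler_pM2l t0) -{1}NT -normcM.
  have -> : T * (h * ((z *m M) ord0 k - vK X 1 w z 0 ord0 k) - dot z (c k)) =
     - (h * (vK X 1 w (T *: z) 0 ord0 k - T * (z *m M) ord0 k)) +
       dot z (vK Y 1 0 (T *: (h *: delta_mx ord0 k)) 0 - T *: ((h *: delta_mx ord0 k) *m M')).
    rewrite /c scalerA !dotBr dotZr.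
    exact: scaling_remainder Eq.
  apply: le_trans (le_normcD _ _) _; rewrite normcN.
  have -> : t * ((1 + m%:R) * e) = e * t + m%:R * (e * t) by ring.
  apply: lerD.
    rewrite normcM; apply: le_trans b1.
    by apply: ler_piMl; [exact: normc_ge0|rewrite Nh].
  apply: normc_dot => j; first exact/ltW/(lt_le_trans (hz j)).
  by rewrite !mxE; have := b2 j; rewrite KY0 !mxE subr0.
rewrite mulmxBr mxE -[RHS]/(_ + _).
apply: (mulfI h0).
have -> : (- (z *m (h^-1 *: (\matrix_(j, k1) c k1 ord0 j)))) ord0 k = - (h^-1 * dot z (c k)).
  rewrite -scalemxAr !mxE; congr (- (_ * _)).
  by apply: eq_bigr => j _; rewrite mxE.
rewrite mulrDr mulrN mulVKf//.
by apply: (lc (lcM (- 1) key)); ring.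
Qed.
End Alg.
End Affine.

(** * The equation in u and v *)

Section Reduced.
Variable R : realType.
Local Notation C := R[i].
Local Notation N := (@ComplexField.Normc.normc R).
Lemma two_neq0 : (2 : C) != 0. Proof. by rewrite pnatr_eq0. Qed.

(** What remains of the polarized equation at w = w' = 0: the product p = zeta.zeta' is
   eliminated through (u + u') p = 2 (v + v'). *)
Definition reduced_pol (e : R) (a b d a' b' d' : C -> C -> C) := forall u v u' v',
  N (u - 1) < e -> N v < e -> N (u' - 1) < e -> N v' < e ->
  2 * (u + u') * (d u v + d' u' v') =
    2 * (a u v + a' u' v') * (v + v') + (u + u') ^+ 2 * (b u v + b' u' v').

Lemma reduced_sym e a b d a' b' d' : reduced_pol e a b d a' b' d' -> reduced_pol e a' b' d' a b d.
Proof.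
move=> H u v u' v' h1 h2 h3 h4; have E := H _ _ _ _ h3 h4 h1 h2.
by apply: (lc E); ring.
Qed.

Lemma small_pts (e : R) : 0 < e <= 1 -> exists2 h : C, h != 0 & N h < e / 4.
Proof.
move=> /andP[e0 e1]; exists ((e / 8)%:C)%C; rewrite -?normc_gt0 normc_real ger0_norm; lra.
Qed.

(** Differences in v' show that a is affine in v with a constant slope q; second differences
   in v then leave a quadratic polynomial in 1 + u' whose coefficients must vanish, and q with
   them. *)
Lemma reduced_a_indep (e : R) a b d a' b' d' : 0 < e <= 1 -> reduced_pol e a b d a' b' d' ->
  forall u v, N (u - 1) < e -> N v < e -> a u v = a u 0.
Proof.
move=> e01 H; have /andP[e0 e1] := e01; have [h h0 hN] := small_pts e01.
have nm0 : N 0 = 0 by exact: normc00.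
have z0 : N 0 < e by rewrite nm0.
have hh : N h < e by have := normc_ge0 h; lra.
have h2 : N (2 * h) < e by rewrite normcM normc2; have := normc_ge0 h; lra.
have u1 : N (1 - 1 : C) < e by rewrite subrr nm0.
have u2 : N (1 + h - 1 : C) < e by rewrite addrC addKr.
have u3 : N (1 + 2 * h - 1 : C) < e by rewrite addrC addKr.
(* linear in v, with a slope independent of u *)
pose q := - ((a' 1 h - a' 1 0) / h).
have lin u v : N (u - 1) < e -> N v < e -> a u v = a u 0 + q * v.
  move=> hu hv.
  have E1 := H u v 1 h hu hv u1 hh; have E2 := H u 0 1 h hu z0 u1 hh.
  have E3 := H u v 1 0 hu hv u1 z0; have E4 := H u 0 1 0 hu z0 u1 z0.
  apply/eqP; rewrite -subr_eq0; apply/eqP.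
  apply: (mul_eq0 (mulf_neq0 two_neq0 h0)).
  apply: (lc (lcD (lcD (lcM (- 1) E1) E2) (lcD E3 (lcM (- 1) E4)))).
  by rewrite /q; field.
suff q0 : q = 0 by move=> u v hu hv; rewrite lin// q0 mul0r addr0.
(* second difference in v at 0, h, 2 h, a polynomial identity in 1 + u' *)
have S u' : N (u' - 1) < e ->
   (1 + u') * (2 * ((2 * (d 1 h - d 1 0) - (d 1 (2 * h) - d 1 0))))
   - (1 + u') ^+ 2 * (2 * (b 1 h - b 1 0) - (b 1 (2 * h) - b 1 0)) = - (4 * q * h ^+ 2).
  move=> hu'.
  have E0 := H 1 0 u' 0 u1 z0 hu' z0; have E1 := H 1 h u' 0 u1 hh hu' z0.
  have E2 := H 1 (2 * h) u' 0 u1 h2 hu' z0.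
  rewrite (lin 1 h)// in E1; rewrite (lin 1 (2 * h))// in E2.
  by apply: (lc (lcD (lcM (- 1) E0) (lcD (lcM 2 E1) (lcM (- 1) E2)))); ring.
have S1 := S 1 u1; have S2 := S _ u2; have S3 := S _ u3.
set P := 2 * _ in S1 S2 S3; set Q := 2 * (b 1 h - b 1 0) - _ in S1 S2 S3.
have Q0 : Q = 0.
  apply: (mul_eq0 (mulf_neq0 two_neq0 (expf_neq0 2 h0))).
  by apply: (lc (lcD (lcM (- 1) S1) (lcD (lcM 2 S2) (lcM (- 1) S3)))); ring.
have P0 : P = 0.
  apply: (mul_eq0 h0); rewrite Q0 in S1 S2 S3.
  by apply: (lc (lcD S2 (lcM (- 1) S1))); ring.
have q4 : 4 * h ^+ 2 != 0 by rewrite mulf_neq0 ?expf_neq0// pnatr_eq0.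
apply: (mul_eq0 q4); rewrite P0 Q0 in S1.
by apply: (lc S1); ring.
Qed.

(** Setting one of the points to (1, 0) expresses d and d' by the other components, and a and
   a' turn out to be multiples of 1 - u^2. The remaining relation between b and b' determines
   both. *)
Lemma reduced_solve (e : R) a b d a' b' d' : 0 < e <= 1 -> reduced_pol e a b d a' b' d' ->
  a 1 0 = 0 -> b 1 0 = 0 -> d 1 0 = 0 -> a' 1 0 = 0 -> b' 1 0 = 0 -> d' 1 0 = 0 ->
  exists k l, forall u v, N (u - 1) < e -> N v < e ->
   [/\ a u v = k / 2 * (u ^+ 2 - 1), b u v = l * (u - 1) + k * v,
       d u v = l / 2 * (u ^+ 2 - 1) + k * u * v & b' u v = - l * (u - 1) - k * v].
Proof.
move=> e01 H a0 b0 d0 a'0 b'0 d'0; have /andP[e0 e1] := e01; have [h h0 hN] := small_pts e01.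
have H' := reduced_sym H.
have nm0 : N 0 = 0 by exact: normc00.
have z0 : N 0 < e by rewrite nm0.
have hh : N h < e by have := normc_ge0 h; lra.
have u1 : N (1 - 1 : C) < e by rewrite subrr nm0.
have u2 : N (1 + h - 1 : C) < e by rewrite addrC addKr.
have n2h : 2 + h != 0.
  rewrite -normc_gt0; have := normcDB 2 (- h) 0; rewrite !subr0 opprK normcN normc2.
  have := normc_ge0 h; lra.
have inda := reduced_a_indep e01 H; have inda' := reduced_a_indep e01 H'.
have u10 (u : C) : N (u - 1) < e -> u + 1 != 0.
  move=> hu; rewrite -normc_gt0; have := normcDB 2 (1 - u) 0.
  have -> : 2 - (1 - u) = u + 1 by ring.
  by rewrite !subr0 normc2 normcB; lra.
(* Segre variety of the base point *)
have D1 u v : N (u - 1) < e -> N v < e -> 2 * (u + 1) * d u v = 2 * a u 0 * v + (u + 1) ^+ 2 * b u v.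
  move=> hu hv; have := H u v 1 0 hu hv u1 z0.
  by rewrite a'0 b'0 d'0 (inda u v)// !addr0.
have D1' u v : N (u - 1) < e -> N v < e -> 2 * (u + 1) * d' u v = 2 * a' u 0 * v + (u + 1) ^+ 2 * b' u v.
  move=> hu hv; have := H' u v 1 0 hu hv u1 z0.
  by rewrite a0 b0 d0 (inda' u v)// !addr0.
(* elimination of d and d' *)
have M u v u' v' : N (u - 1) < e -> N v < e -> N (u' - 1) < e -> N v' < e ->
  (u + u') * (u + 1) * (u' + 1) * ((1 - u') * b u v + (1 - u) * b' u' v') =
  2 * (u' + 1) * a u 0 * ((u + 1) * v' + (1 - u') * v) + 2 * (u + 1) * a' u' 0 * ((u' + 1) * v + (1 - u) * v').
  move=> hu hv hu' hv'; have E := H u v u' v' hu hv hu' hv'.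
  have E1 := D1 u v hu hv; have E2 := D1' u' v' hu' hv'.
  rewrite (inda u v)// (inda' u' v')// in E.
  apply: (lc (lcD (lcM ((u + 1) * (u' + 1)) E) (lcD (lcM (- (u + u') * (u' + 1)) E1) (lcM (- (u + u') * (u + 1)) E2)))).
  by ring.
pose k := - (2 * a' (1 + h) 0 / (h * (2 + h))).
pose k' := - (2 * a (1 + h) 0 / (h * (2 + h))).
have hk : b 1 h = k * h /\ b' 1 h = k' * h.
  split.
    have E := M 1 h (1 + h) 0 u1 hh u2 z0; rewrite a0 in E.
    have n : 2 * (2 + h) ^+ 2 * h != 0 by rewrite !mulf_neq0 ?expf_neq0 ?two_neq0.
    apply/eqP; rewrite -subr_eq0; apply/eqP; apply: (mul_eq0 n).
    by apply: (lc (lcM (- 1) E)); rewrite /k; field; rewrite h0 n2h.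
  have E := M (1 + h) 0 1 h u2 z0 u1 hh; rewrite a'0 in E.
  have n : 2 * (2 + h) ^+ 2 * h != 0 by rewrite !mulf_neq0 ?expf_neq0 ?two_neq0.
  apply/eqP; rewrite -subr_eq0; apply/eqP; apply: (mul_eq0 n).
  by apply: (lc (lcM (- 1) E)); rewrite /k'; field; rewrite h0 n2h.
have [hk1 hk2] := hk.
have A u : N (u - 1) < e -> 2 * a u 0 = k' * (1 - u ^+ 2).
  move=> hu; have E := M u 0 1 h hu z0 u1 hh; rewrite a'0 hk2 in E.
  apply/eqP; rewrite -subr_eq0; apply/eqP.
  apply: (mul_eq0 (mulf_neq0 (mulf_neq0 two_neq0 (u10 _ hu)) h0)).
  by apply: (lc (lcM (- 1) E)); ring.
have A' u : N (u - 1) < e -> 2 * a' u 0 = k * (1 - u ^+ 2).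
  move=> hu; have E := M 1 h u 0 u1 hh hu z0; rewrite a0 hk1 in E.
  apply/eqP; rewrite -subr_eq0; apply/eqP.
  apply: (mul_eq0 (mulf_neq0 (mulf_neq0 two_neq0 (u10 _ hu)) h0)).
  by apply: (lc (lcM (- 1) E)); ring.
have M2 u v u' v' : N (u - 1) < e -> N v < e -> N (u' - 1) < e -> N v' < e ->
  (u + u') * ((1 - u') * b u v + (1 - u) * b' u' v') =
   k' * (1 - u) * ((u + 1) * v' + (1 - u') * v) + k * (1 - u') * ((u' + 1) * v + (1 - u) * v').
  move=> hu hv hu' hv'; have E := M u v u' v' hu hv hu' hv'.
  apply/eqP; rewrite -subr_eq0; apply/eqP.
  apply: (mul_eq0 (mulf_neq0 (u10 _ hu) (u10 _ hu'))).
  have F1 := lcM ((u' + 1) * ((u + 1) * v' + (1 - u') * v)) (A _ hu).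
  have F2 := lcM ((u + 1) * ((u' + 1) * v + (1 - u) * v')) (A' _ hu').
  by apply: (lc (lcD E (lcD F1 F2))); ring.
pose l := b (1 + h) 0 / h.
have h2N : N (2 * h) < e by rewrite normcM normc2; have := normc_ge0 h; lra.
have u3 : N (1 + 2 * h - 1 : C) < e by rewrite addrC addKr.
have nz2 (u u' : C) : N (u - 1) < e -> N (u' - 1) < e -> u + u' != 0.
  move=> hu hu'; rewrite -normc_gt0; have := normcDB 2 (2 - (u + u')) 0.
  have -> : 2 - (2 - (u + u')) = u + u' by ring.
  rewrite !subr0 normc2.
  have -> : 2 - (u + u') = (1 - u) + (1 - u') by ring.
  have := le_normcD (1 - u) (1 - u'); rewrite (normcB 1 u) (normcB 1 u'); lra.
have B0 u : N (u - 1) < e -> b' u 0 = - l * (u - 1).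
  move=> hu; have E := M2 (1 + h) 0 u 0 u2 z0 hu z0.
  apply/eqP; rewrite -subr_eq0; apply/eqP.
  apply: (mul_eq0 (mulf_neq0 (nz2 _ _ u2 hu) h0)).
  by apply: (lc (lcM (- 1) E)); rewrite /l; field.
have Bform u v : N (u - 1) < e -> N v < e -> b u v = l * (u - 1) + k * v.
  move=> hu hv; have E1 := M2 u v (1 + h) 0 hu hv u2 z0; have E2 := M2 u v (1 + 2 * h) 0 hu hv u3 z0.
  rewrite B0// in E1; rewrite B0// in E2.
  apply/eqP; rewrite -subr_eq0; apply/eqP.
  apply: (mul_eq0 (mulf_neq0 two_neq0 (expf_neq0 2 h0))).
  by apply: (lc (lcD (lcM 2 E1) (lcM (- 1) E2))); ring.
have kk : k' = - k.
  have E := M2 (1 + h) h (1 + h) 0 u2 hh u2 z0.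
  rewrite B0// Bform// in E.
  apply/eqP; rewrite -subr_eq0; apply/eqP.
  have h3 : h ^+ 3 != 0 by rewrite expf_neq0.
  apply: (mul_eq0 h3).
  by apply: (lc (lcM (- 1) E)); ring.
exists k, l => u v hu hv.
have Bf := Bform u v hu hv.
have Af : a u v = k / 2 * (u ^+ 2 - 1).
  rewrite inda//; apply/eqP; rewrite -subr_eq0; apply/eqP; apply: (mul_eq0 two_neq0).
  by apply: (lc (A u hu)); rewrite kk; field.
split=> //.
- have E := D1 u v hu hv; rewrite Bf -(inda u v)// Af in E.
  apply/eqP; rewrite -subr_eq0; apply/eqP; apply: (mul_eq0 (mulf_neq0 two_neq0 (u10 _ hu))).
  by apply: (lc E); field.
- have E1 := M2 (1 + h) 0 u v u2 z0 hu hv.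
  rewrite Bform// kk in E1.
  apply/eqP; rewrite -subr_eq0; apply/eqP.
  apply: (mul_eq0 (mulf_neq0 (nz2 _ _ u2 hu) h0)).
  by apply: (lc (lcM (- 1) E1)); ring.
Qed.
End Reduced.
Arguments two_neq0 {R}. Arguments normc00 {R}.

(** * Solution of the polarized equation *)

Section Solution.
Variable R : realType.
Local Notation C := R[i].
Local Notation N := (@ComplexField.Normc.normc R).
Section Alg.
Variable m : nat.
Local Notation Z := 'rV[C]_m.
Local Notation vf := (@vf R m).
Variable k0 : 'I_m.

Definition Klin (d : R) (X : vf) (L : C -> 'M[C]_m) := forall w (z : Z), N w < d ->
  (forall j, N (z ord0 j) < d) -> vK X 1 w z 0 = z *m L w.

Lemma delta_lt (d : R) (y : C) (k : 'I_m) : 0 < d -> N y < d ->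
  forall j, N ((y *: delta_mx ord0 k : Z) ord0 j) < d.
Proof.
move=> d0 hy j; rewrite mxE mxE eqxx /=; case: (j == k); rewrite ?mulr1// mulr0.
by have -> : N 0 = 0 by exact: normc00.
Qed.

Lemma mul_delta (y : C) (j k : 'I_m) (L : 'M[C]_m) : ((y *: delta_mx ord0 j : Z) *m L) ord0 k = y * L j k.
Proof. by rewrite -scalemxAl mxE -rowE mxE. Qed.

(** The polarized equation at zeta = x e_j and zeta' = y e_k. *)
Lemma pol_linear (d : R) X Y L L' : 0 < d <= 1 -> pol d X Y -> red d X -> red d Y ->
  Klin d X L -> Klin d Y L' ->
  forall (u w v u' w' x y : C) (j k : 'I_m), N (u - 1) < d -> N w < d / 32 -> N v < d / 8 ->
  N (u' - 1) < d -> N w' < d / 32 -> N x < d / 32 -> N y < d ->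
  let p := w + w' + x * y * (j == k)%:R in
  let v' := (u + u') * p / 2 - v in
  2 * (vD X u w 0 v + vD Y u' w' 0 v') =
    (vA X u w 0 v + vA Y u' w' 0 v') * p
    + (u + u') * (vB X u w 0 v + vB Y u' w' 0 v' + x * y * (L w j k + L' w' k j)).
Proof.
move=> d01 E rX rY lX lY u w v u' w' x y j k hu hw hv hu' hw' hx hy; have /andP[d0 d1] := d01.
have d32 : 0 < d / 32 by rewrite divr_gt0.
have hz := delta_lt j d32 hx.
have [pt' H] := pol_line_pt k d01 E hu hw hz hv hu' hw' hy.
have pE : y * (x *: delta_mx ord0 j : Z) ord0 k = x * y * (j == k)%:R.
  by rewrite mxE mxE eqxx /= eq_sym; ring.
have small z : N z < d / 32 -> N z < d by move=> h; apply: lt_le_trans h _; lra.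
have q : pt d u w (x *: delta_mx ord0 j) v.
  split=> //; [exact: small|by move=> i; apply: small|by apply: lt_le_trans hv _; lra].
have [a1 a2 a3 a4 _] := rX _ _ _ _ q; have [b1 b2 b3 b4 _] := rY _ _ _ _ pt'.
rewrite pE in H b1 b2 b3 b4; move: H; rewrite a1 a2 a3 a4 b1 b2 b3 b4.
rewrite lX; [|exact: small|by move=> i; apply: small].
rewrite lY; [|exact: small|exact: delta_lt].
rewrite mul_delta dot_deltal mul_delta => H p v'.
by apply: (lc H); rewrite /p; ring.
Qed.

(** Comparison of the coefficients of x y in [pol_linear]. *)
Lemma K_entries (d : R) X Y L L' : 0 < d <= 1 -> pol d X Y -> red d X -> red d Y ->
  Klin d X L -> Klin d Y L' ->
  forall w w', N w < d / 64 -> N w' < d / 64 -> forall j k,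
    L w j k + L' w' k j = (j == k)%:R * (L w k0 k0 + L' w' k0 k0).
Proof.
move=> d01 E rX rY lX lY w w' hw hw' j k; have /andP[d0 d1] := d01.
have d64 : 0 < d / 64 by rewrite divr_gt0.
have nm0 : N 0 = 0 by exact: normc00.
set g := ((d / 64)%:C)%C / 2; have g0 : g != 0 := half_neq0 d64.
have Ng : N g = d / 64 / 2 := normc_scale d64.
have u1 : N (1 - 1 : C) < d by rewrite subrr nm0.
have v0 : N 0 < d / 8 by rewrite nm0 divr_gt0.
have g1 : N g < d / 32 by rewrite Ng; lra.
have g2 : N g < d by rewrite Ng; lra.
have g3 : N 0 < d by rewrite nm0.
have w1 : N w < d / 32 by lra. have w1' : N w' < d / 32 by lra.
have P x j k := pol_linear d01 E rX rY lX lY j k u1 w1 v0 u1 w1' g1 (y := x).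
have n : 2 * g ^+ 2 != 0 by rewrite mulf_neq0 ?expf_neq0 ?two_neq0.
apply/eqP; rewrite -subr_eq0; apply/eqP; apply: (mul_eq0 n).
have [jk|jk] := eqVneq j k.
  have := P g j k g2; have := P g k0 k0 g2; rewrite jk !eqxx /= => E1 E2.
  by apply: (lc (lcD E1 (lcM (- 1) E2))); ring.
have := P g j k g2; have := P 0 j k g3; rewrite (negbTE jk) /= !mulr0 !mul0r !addr0 => E1 E2.
by apply: (lc (lcD E1 (lcM (- 1) E2))); ring.
Qed.

(** Only the product r = x y enters for j = k, and it takes all small values. *)
Lemma pol_trace (d : R) X Y L L' : 0 < d <= 1 -> pol d X Y -> red d X -> red d Y ->
  Klin d X L -> Klin d Y L' ->
  forall (u w v u' w' r : C), N (u - 1) < d -> N w < d / 32 -> N v < d / 8 ->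
  N (u' - 1) < d -> N w' < d / 32 -> N r < d ^+ 2 / 64 ->
  let p := w + w' + r in
  let v' := (u + u') * p / 2 - v in
  2 * (vD X u w 0 v + vD Y u' w' 0 v') =
    (vA X u w 0 v + vA Y u' w' 0 v') * p
    + (u + u') * (vB X u w 0 v + vB Y u' w' 0 v' + r * (L w k0 k0 + L' w' k0 k0)).
Proof.
move=> d01 E rX rY lX lY u w v u' w' r hu hw hv hu' hw' hr; have /andP[d0 d1] := d01.
have d32 : 0 < d / 32 by rewrite divr_gt0.
set g := ((d / 32)%:C)%C / 2; have g0 : g != 0 := half_neq0 d32.
have Ng : N g = d / 32 / 2 := normc_scale d32.
have g1 : N g < d / 32 by rewrite Ng; lra.
have hy : N (r / g) < d.
  rewrite normcM ComplexField.Normc.normcV ltr_pdivrMr ?normc_gt0// Ng.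
  by have -> : d * (d / 32 / 2) = d ^+ 2 / 64 by field.
have := pol_linear d01 E rX rY lX lY k0 k0 hu hw hv hu' hw' g1 hy.
by rewrite /= eqxx mulr1; have -> : g * (r / g) = r by field.
Qed.

(** The pairs (w, r) = (w, p - w) and (0, p) have the same sum w + r, hence the same second
   point. *)
Lemma w_indep (d : R) X Y L L' : 0 < d <= 1 -> pol d X Y -> red d X -> red d Y ->
  Klin d X L -> Klin d Y L' ->
  forall u w v, N (u - 1) < d -> N w < d ^+ 2 / 256 -> N v < d / 8 ->
  [/\ vA X u w 0 v = vA X u 0 0 v, vD X u w 0 v = vD X u 0 0 v,
      vB X u w 0 v = vB X u 0 0 v + w * (L 0 k0 k0 + L' 0 k0 k0) & L w = L 0].
Proof.
move=> d01 E rX rY lX lY u w v hu hw hv; have /andP[d0 d1] := d01.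
have nm0 : N 0 = 0 by exact: normc00.
have dd : d ^+ 2 <= d by rewrite expr2 ler_piMr// ltW.
have dd0 : 0 < d ^+ 2 by rewrite exprn_gt0.
have e0 : 0 < d ^+ 2 / 256 by lra.
set g := ((d ^+ 2 / 256)%:C)%C / 2; have g0 : g != 0 := half_neq0 e0.
have Ng : N g = d ^+ 2 / 256 / 2 := normc_scale e0.
set h := (d%:C)%C / 2; have h0 : h != 0 := half_neq0 d0; have Nh : N h = d / 2 := normc_scale d0.
have w1 : N w < d / 32 by apply: lt_le_trans hw _; lra.
have w0 : N 0 < d / 32 by rewrite nm0 divr_gt0.
have P u' p : N (u' - 1) < d -> N p < d ^+ 2 / 256 ->
  2 * (vD X u w 0 v - vD X u 0 0 v) = (vA X u w 0 v - vA X u 0 0 v) * p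
   + (u + u') * (vB X u w 0 v - vB X u 0 0 v - w * (L w k0 k0 + L' 0 k0 k0)
                 + p * (L w k0 k0 - L 0 k0 k0)).
  move=> hu' hp.
  have r1 : N (p - w) < d ^+ 2 / 64 by apply: (normcD_lt hp (s := d ^+ 2 / 256)); rewrite ?normcN//; lra.
  have r2 : N p < d ^+ 2 / 64 by lra.
  have E1 := pol_trace d01 E rX rY lX lY hu w1 hv hu' w0 r1.
  have E2 := pol_trace d01 E rX rY lX lY hu w0 hv hu' w0 r2.
  move: E1 E2; rewrite /= !addr0 !add0r.
  have -> : w + (p - w) = p by ring.
  by move=> E1 E2; apply: (lc (lcD E1 (lcM (- 1) E2))); ring.
have u1 : N (1 - 1 : C) < d by rewrite subrr nm0.
have u2 : N (1 + h - 1 : C) < d by rewrite addrC addKr Nh; lra.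
have p0 : N 0 < d ^+ 2 / 256 by rewrite nm0.
have p1 : N g < d ^+ 2 / 256 by rewrite Ng; lra.
have E1 := P _ _ u1 p0; have E2 := P _ _ u2 p0; have E3 := P _ _ u1 p1; have E4 := P _ _ u2 p1.
set c := vB X u w 0 v - vB X u 0 0 v - _ in E1 E2 E3 E4.
set D := vD X u w 0 v - _ in E1 E2 E3 E4; set A := vA X u w 0 v - _ in E1 E2 E3 E4.
set l := L w k0 k0 - _ in E1 E2 E3 E4.
have c0 : c = 0 by apply: (mul_eq0 h0); apply: (lc (lcD E1 (lcM (- 1) E2))); ring.
have D0 : D = 0.
  by apply: (mul_eq0 two_neq0); rewrite c0 in E1; apply: (lc E1); ring.
have l0 : l = 0.
  by apply: (mul_eq0 (mulf_neq0 h0 g0)); apply: (lc (lcD E3 (lcM (- 1) E4))); rewrite c0; ring.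
have A0 : A = 0.
  by apply: (mul_eq0 g0); rewrite D0 c0 l0 in E3; apply: (lc (lcM (- 1) E3)); ring.
have ll : L w k0 k0 = L 0 k0 k0 by apply/eqP; rewrite -subr_eq0; apply/eqP.
split.
- by apply/eqP; rewrite -subr_eq0; apply/eqP.
- by apply/eqP; rewrite -subr_eq0; apply/eqP.
- by rewrite /c ll in c0; apply: (lc c0); ring.
have w2 : N w < d / 64 by apply: lt_le_trans hw _; lra.
have w3 : N 0 < d / 64 by rewrite nm0 divr_gt0.
apply/matrixP => j k.
have F1 := K_entries d01 E rX rY lX lY w2 w3 j k.
have F2 := K_entries d01 E rX rY lX lY w3 w3 j k.
by rewrite ll -F2 in F1; apply: (addIr _ F1).
Qed.

Definition vanishes (X : vf) := [/\ vA X 1 0 0 0 = 0, vB X 1 0 0 0 = 0, vK X 1 0 0 0 = 0 & vD X 1 0 0 0 = 0].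

Lemma pol_red (d : R) X Y : 0 < d <= 1 -> pol d X Y -> vanishes X -> vanishes Y ->
  exists2 e : R, 0 < e <= d & red e X /\ red e Y.
Proof.
move=> d01 E x0 y0; have /andP[d0 d1] := d01.
have dd : d ^+ 2 <= d by rewrite expr2 ler_piMr// ltW.
have dd0 : 0 < d ^+ 2 by rewrite exprn_gt0.
have nm0 : N 0 = 0 by exact: normc00.
pose e := d ^+ 2 / 1024.
have e0 : 0 < e by rewrite /e; lra.
have ed : e <= d / 128 by rewrite /e; lra.
have KX (A B : vf) : pol d A B -> Kuv e A.
  move=> AB u w z v [h1 h2 h3 h4].
  have s x : N x < e -> N x < d / 128 by move=> hx; apply: lt_le_trans hx _.
  rewrite (vK_uv d01 AB (s _ h1) (s _ h2) _ h4); last by move=> j; exact: s.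
  rewrite (vK_uv d01 AB (u := 1) (v := 0) _ (s _ h2))//.
  - by rewrite subrr nm0 divr_gt0.
  - by move=> j; exact: s.
  - by rewrite nm0.
have ed' : e <= d by lra.
have e01 : 0 < e <= 1 by rewrite e0 /=; lra.
have H (A B : vf) : pol d A B -> vanishes A -> vanishes B -> red (e / 32) A.
  move=> AB [_ _ a0 _] [_ _ b0 _] u w z v p.
  have ABe := pol_le ed' AB.
  have [h1 _] := zeta_indep k0 e01 ABe (KX _ _ (pol_sym AB)) b0.
  have [_ h2] := zeta_indep k0 e01 (pol_sym ABe) (KX _ _ AB) a0.
  have [q1 q2 q3] := h1 _ _ _ _ p; split=> //.
    by apply: (KX _ _ AB); apply: pt_le p; lra.
  by apply: h2; case: p.
exists (e / 32); first by apply/andP; split; lra.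
by split; [apply: H E _ _|apply: H (pol_sym E) _ _].
Qed.

(** Collects the restrictions on the radii met below in one choice. *)
Lemma smaller_radius (f : R) : 0 < f <= 1 -> exists g : R,
  [/\ 0 < g <= 1, g <= f / 32, g <= f / 64 /\ g <= f / 8, g <= f & g <= f ^+ 2 / 256].
Proof.
move=> /andP[f0 f1]; exists (f ^+ 2 / 256).
have : f ^+ 2 <= f by rewrite expr2 ler_piMr ?(ltW f0).
have : 0 < f ^+ 2 by rewrite exprn_gt0.
by split; [apply/andP; split; lra|lra|split; lra|lra|].
Qed.

(** The dilation part th is the common value of the diagonal entries of L + L'^T; once its
   contribution is subtracted from vD, the components at w = zeta = 0 satisfy [reduced_pol]. *)
Theorem vf_solve (d : R) X Y : 0 < d <= 1 -> pol d X Y -> vanishes X -> vanishes Y ->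
  Kdiff d X -> Kdiff d Y ->
  exists (e : R) (th k l : C) (L L' : 'M[C]_m), [/\ 0 < e,
   forall u w z v, pt e u w z v ->
    [/\ vA X u w z v = k / 2 * (u ^+ 2 - 1), vB X u w z v = l * (u - 1) + k * v + th * w,
        vK X u w z v = z *m L & vD X u w z v = l / 2 * (u ^+ 2 - 1) + k * u * v + th * v],
   forall u w z v, pt e u w z v -> vB Y u 0 0 v = - l * (u - 1) - k * v /\ vK Y u w z v = z *m L' &
   forall i j, L i j + L' j i = (i == j)%:R * th].
Proof.
move=> d01 E x0 y0 dX dY; have /andP[d0 d1] := d01.
have nm0 : N 0 = 0 by exact: normc00.
have [e /andP[e0 ed] [rX rY]] := pol_red d01 E x0 y0.
have e01 : 0 < e <= 1 by rewrite e0 (le_trans ed d1).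
have Kle (A : vf) : Kdiff d A -> Kdiff e A.
  by move=> H w hw; apply: H; apply: lt_le_trans hw ed.
have Ee := pol_le ed E.
have [L1 hL] := K_linear e01 Ee rX rY (Kle _ dX) (Kle _ dY).
have [L1' hL'] := K_linear e01 (pol_sym Ee) rY rX (Kle _ dY) (Kle _ dX).
have [f [f01 fe32 _ fe _]] := smaller_radius e01.
have {}hL : Klin f X L1.
  by move=> w z hw hz; apply: hL => [|j]; apply: lt_le_trans fe32.
have {}hL' : Klin f Y L1'.
  by move=> w z hw hz; apply: hL' => [|j]; apply: lt_le_trans fe32.
have Ef := pol_le fe Ee.
have sub_red (A : vf) : red e A -> red f A by move=> H u w z v p; apply: H; apply: pt_le p.
have {}rX := sub_red _ rX; have {}rY := sub_red _ rY.
have W := w_indep f01 Ef rX rY hL hL'; have W' := w_indep f01 (pol_sym Ef) rY rX hL' hL.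
set th := L1 0 k0 k0 + L1' 0 k0 k0 in W.
have thE : L1' 0 k0 k0 + L1 0 k0 k0 = th by rewrite addrC.
rewrite thE in W'.
have [g [g01 gf32 [gf64 gf8] gf gff]] := smaller_radius f01.
have /andP[f0 _] := f01; have /andP[g0 _] := g01.
pose a u v := vA X u 0 0 v; pose b u v := vB X u 0 0 v; pose dd u v := vD X u 0 0 v - th * v.
pose a' u v := vA Y u 0 0 v; pose b' u v := vB Y u 0 0 v; pose dd' u v := vD Y u 0 0 v - th * v.
have RP : reduced_pol g a b dd a' b' dd'.
  move=> u v u' v' hu hv hu' hv'.
  have Ns : 1 <= N (u + u').
    have := normcDB 2 (2 - (u + u')) 0.
    have -> : 2 - (2 - (u + u')) = u + u' by ring.
    rewrite !subr0 normc2; have -> : 2 - (u + u') = (1 - u) + (1 - u') by ring.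
    have := le_normcD (1 - u) (1 - u'); rewrite (normcB 1 u) (normcB 1 u').
    by move: hu hu' gf8 f01; clear => ? ? ? /andP[? ?]; lra.
  have s0 : u + u' != 0 by rewrite -normc_gt0; apply: lt_le_trans Ns.
  pose p := 2 * (v + v') / (u + u').
  have hp : N p < f ^+ 2 / 64.
    rewrite /p normcM ComplexField.Normc.normcV ltr_pdivrMr ?normc_gt0// normcM normc2.
    move: hv hv' Ns gff; clear => hv hv' Ns gff.
    have : N (v + v') < 2 * g by apply: normcD_lt hv hv' _; lra.
    nra.
  have nw : N 0 < f / 32 by rewrite nm0 divr_gt0.
  have hu1 := lt_le_trans hu gf; have hu1' := lt_le_trans hu' gf.
  have hv1 := lt_le_trans hv gf8.
  have := pol_trace f01 Ef rX rY hL hL' hu1 nw hv1 hu1' nw hp.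
  rewrite /= !add0r -/th.
  have -> : (u + u') * p / 2 - v = v' by rewrite /p; field.
  move=> H; have pE : (u + u') * p = 2 * (v + v') by rewrite /p; field.
  rewrite /a /b /dd /a' /b' /dd'.
  apply: (lc (lcD (lcM (u + u') H) (lcM (vA X u 0 0 v + vA Y u' 0 0 v' + (u + u') * th) pE))).
  by ring.
have [xa xb _ xd] := x0; have [ya yb _ yd] := y0.
have [k [l S]] := reduced_solve g01 RP xa xb ltac:(by rewrite /dd xd mulr0 subrr) ya yb
  ltac:(by rewrite /dd' yd mulr0 subrr).
have K0 : N 0 < f / 64 by rewrite nm0 divr_gt0.
exists g, th, k, l, (L1 0), (L1' 0); split=> //.
- move=> u w z v p.
  have pf : pt f u w z v by apply: pt_le p.
  have [r1 r2 r3 r4 _] := rX _ _ _ _ pf.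
  case: p => hu hw hz hv.
  have [q1 q2 q3 q4] := S u v hu hv.
  have hu1 := lt_le_trans hu gf; have hw1 := lt_le_trans hw gff.
  have hv1 := lt_le_trans hv gf8.
  have [t1 t2 t3 t4] := W u w v hu1 hw1 hv1.
  split.
  + by rewrite r1 t1 -q1.
  + by rewrite r2 t3; apply: (lc q2); rewrite /b; ring.
  + rewrite r4 hL ?t4//; first exact: lt_le_trans hw gf.
    by move=> j; exact: lt_le_trans (hz j) gf.
  + by rewrite r3 t2; apply: (lc q3); rewrite /dd; ring.
- move=> u w z v p.
  have pf : pt f u w z v by apply: pt_le p.
  have [r1 r2 r3 r4 _] := rY _ _ _ _ pf.
  case: p => hu hw hz hv.
  have hu1 := lt_le_trans hu gf; have hw1 := lt_le_trans hw gff.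
  have hv1 := lt_le_trans hv gf8.
  have [_ _ _ t4] := W' u w v hu1 hw1 hv1.
  have [_ _ _ q4] := S u v hu hv.
  split; first exact: q4.
  rewrite r4 hL' ?t4//; first exact: lt_le_trans hw gf.
  by move=> j; exact: lt_le_trans (hz j) gf.
- by move=> i j; exact: (K_entries f01 Ef rX rY hL hL' K0 K0).
Qed.
End Alg.
End Solution.

(** * Coordinates adapted to the hypersurface *)

Section Coordinates.
Variable R : realType.
Local Notation C := R[i].
Local Notation N := (@ComplexField.Normc.normc R).
Local Notation Re := (@complex.Re R).
Lemma cdiff_differentiable (f : C -> C) (s : C) : cdiff f s -> differentiable f s.
Proof. by move=> /cdiffP h; apply/derivable1_diffP. Qed.

Lemma differentiable_cdiff (f : C -> C) (s : C) : differentiable f s -> cdiff f s.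
Proof. by move=> /derivable1_diffP h; apply/cdiffP. Qed.

Lemma differentiable_row (W : normedModType C) q (F : W -> 'rV[C]_q.+1) (a : W) :
  (forall k, differentiable (fun x => F x ord0 k) a) -> differentiable F a.
Proof.
move=> H.
have -> : F = \sum_(k < q.+1) (fun x => F x ord0 k *: delta_mx ord0 k : 'rV[C]_q.+1).
  by apply/funext => t; rewrite fct_sumE [LHS]row_sum_delta.
by apply: differentiable_sum => k; apply: differentiableZl.
Qed.

Lemma cdiff_comp p (F : 'rV[C]_p.+1 -> 'rV[C]_p.+1) (g : C -> 'rV[C]_p.+1) (s : C) j :
  (forall k, cdiff (fun s => g s ord0 k) s) -> differentiable F (g s) ->
  cdiff (fun s => F (g s) ord0 j) s.
Proof.
move=> hg dF; apply: differentiable_cdiff.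
have dg : differentiable g s by apply: differentiable_row => k; exact: cdiff_differentiable.
apply: (@differentiable_comp _ _ _ _ (F \o g) (fun v : 'rV[C]_p.+1 => v ord0 j)).
  exact: differentiable_comp.
exact: differentiable_coord.
Qed.

Section Coord.
Variable m : nat.
Local Notation n := m.+2.
Local Notation V := 'rV[C]_n.+1.
Local Notation Z := 'rV[C]_m.

Lemma crdD (a b : V) j : crd (a + b) j = crd a j + crd b j.
Proof. by rewrite /crd mxE. Qed.
Lemma crdZ k (a : V) j : crd (k *: a) j = k * crd a j.
Proof. by rewrite /crd mxE. Qed.
Lemma crdN (a : V) j : crd (- a) j = - crd a j.
Proof. by rewrite /crd mxE. Qed.
Lemma crd_sum I (r : seq I) (P : pred I) (F : I -> V) j :
  crd (\sum_(i <- r | P i) F i) j = \sum_(i <- r | P i) crd (F i) j.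
Proof. by rewrite /crd summxE. Qed.
Lemma crd0 j : crd (0 : V) j = 0. Proof. by rewrite /crd mxE. Qed.

(** The bounds matter: outside 1 <= i <= n.+1 the index of a coordinate is a default value. *)
Lemma crd_dd i j : (0 < i <= n.+1)%N -> (0 < j <= n.+1)%N -> crd (dd R n i) j = (i == j)%:R.
Proof.
case: i j => [|i] [|j] // hi hj; rewrite /crd /dd mxE eqxx /= eqSS.
congr (_%:R); congr nat_of_bool; apply/eqP/eqP => [|->//].
by move/(congr1 val); rewrite /= !inordK.
Qed.

Definition mkV (u w : C) (z : Z) (v : C) : V :=
  u *: dd R n 1 + w *: dd R n 2 + v *: dd R n n.+1 + \sum_(i < m) z ord0 i *: dd R n (i + 3)%N.

Lemma crd_mkV u w z v j : (0 < j <= n.+1)%N -> crd (mkV u w z v) j =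
  u * (1%N == j)%:R + w * (2%N == j)%:R + v * (n.+1 == j)%:R + \sum_(i < m) z ord0 i * ((i + 3)%N == j)%:R.
Proof.
move=> hj; rewrite /mkV !crdD !crdZ crd_sum !crd_dd ?leqnn//.
congr (_ + _); apply: eq_bigr => i _; rewrite crdZ crd_dd//.
by rewrite addn3 /= ltnS; apply: ltnW; rewrite !ltnS.
Qed.

Lemma sum_neq (z : Z) j : (forall i : 'I_m, (i + 3 != j)%N) -> \sum_(i < m) z ord0 i * ((i + 3)%N == j)%:R = 0.
Proof. by move=> H; apply: big1 => i _; rewrite (negbTE (H i)) mulr0. Qed.

Lemma crd_mkV1 u w z v : crd (mkV u w z v) 1 = u.
Proof.
rewrite crd_mkV// sum_neq => [|i]; last by rewrite addn3.
by rewrite eqxx /= !mulr0 !addr0 mulr1.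
Qed.

Lemma crd_mkV2 u w z v : crd (mkV u w z v) 2 = w.
Proof.
rewrite crd_mkV// sum_neq => [|i]; last by rewrite addn3.
by rewrite eqxx /= !mulr0 !addr0 add0r mulr1.
Qed.

Lemma crd_mkVn u w z v : crd (mkV u w z v) n.+1 = v.
Proof.
rewrite crd_mkV ?leqnn// sum_neq => [|i]; last by rewrite addn3 !eqSS ltn_eqF.
by rewrite eqxx /= !mulr0 addr0 !add0r mulr1.
Qed.

Lemma crd_mkVz u w z v (i : 'I_m) : crd (mkV u w z v) (i + 3) = z ord0 i.
Proof.
have hi : (0 < i + 3 <= n.+1)%N by rewrite addn3 /= !ltnS ltnW.
rewrite crd_mkV// (bigD1 i)//= eqxx mulr1 big1 => [|k ki]; last first.
  by rewrite eqn_add2r (_ : (k == i :> nat) = false) ?mulr0//; apply/negbTE.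
have -> : (n.+1 == i + 3)%N = false by rewrite addn3 !eqSS gtn_eqF.
by rewrite addn3 /= !mulr0 !addr0 !add0r.
Qed.

Lemma ord_cases (P : 'I_n.+1 -> Prop) : P (inord 0) -> P (inord 1) -> (forall i : 'I_m, P (inord (i + 2))) ->
  P (inord n) -> forall k, P k.
Proof.
move=> p0 p1 pz pn k; rewrite -(inord_val k).
case: k => -[|[|k]] hk //=.
have [km|mk] := ltnP k m; first by have := pz (Ordinal km); rewrite /= addn2.
by have -> : k = m by apply/eqP; rewrite eqn_leq mk andbT -ltnS -ltnS -ltnS.
Qed.

Lemma crd_eq (a b : V) : crd a 1 = crd b 1 -> crd a 2 = crd b 2 ->
  (forall i : 'I_m, crd a (i + 3) = crd b (i + 3)) -> crd a n.+1 = crd b n.+1 -> a = b.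
Proof.
move=> h1 h2 hz hn; apply/rowP; apply: ord_cases => //.
by move=> i; have := hz i; rewrite /crd addn3 addn2.
Qed.

Definition zpart (a : V) : Z := \row_i crd a (i + 3).

Lemma mkV_crd a : mkV (crd a 1) (crd a 2) (zpart a) (crd a n.+1) = a.
Proof.
apply: crd_eq; rewrite ?crd_mkV1 ?crd_mkV2 ?crd_mkVn// => i.
by rewrite crd_mkVz mxE.
Qed.

Lemma sum_zpart (T : nmodType) (F : nat -> T) : \sum_(3 <= j < n.+1) F j = \sum_(i < m) F (i + 3)%N.
Proof. by rewrite -{1}[3%N]add0n big_addn big_mkord !subSS subn0. Qed.

(** Here w stands for z_2 + zeta.zeta / 2, which turns the defining equation into the
   Hermitian one of [Gammat_Tm]. *)
Definition Tm (u w : C) (z : Z) (v : C) : V := mkV u (w - dot z z / 2) z v.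

Lemma p0_Tm : p0 R n = Tm 1 0 0 0.
Proof.
rewrite /Tm /mkV dot0l mul0r subrr scale1r !scale0r !addr0 big1 ?addr0// => i _.
by rewrite mxE scale0r.
Qed.

Lemma Tm_crd a : Tm (crd a 1) (crd a 2 + dot (zpart a) (zpart a) / 2) (zpart a) (crd a n.+1) = a.
Proof. by rewrite /Tm addrK mkV_crd. Qed.

Definition conjz (z : Z) : Z := map_mx (@conjc R) z.

Lemma conjcD (a b : C) : (a + b)^*%C = a^*%C + b^*%C. Proof. by rewrite rmorphD. Qed.
Lemma conjc2 : (2 : C)^*%C = 2. Proof. exact: conjc_nat. Qed.
Lemma conjc_half : ((2 : C)^-1)^*%C = 2^-1. Proof. by rewrite conjc_inv conjc2. Qed.
Lemma addc_conj (a : C) : a + a^*%C = 2 * ((Re a)%:C)%C.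
Proof. by case: a => a b; rewrite -[2](rmorph_nat (real_complex R)) -rmorphM /=; cring. Qed.

(** Since w = z_2 + zeta.zeta / 2, the real part of w + |zeta|^2 / 2 is x_2 plus the sum of
   the x_j^2: the imaginary parts of zeta cancel. *)
Lemma Gammat_Tm u w z v : Gammat (Tm u w z v) <->
  2 * (v + v^*%C) = (u + u^*%C) * (w + w^*%C + dot z (conjz z)) /\ 0 < Re u.
Proof.
rewrite /Gammat /= crd_mkVn crd_mkV1 crd_mkV2 sum_zpart.
under eq_bigr => i do rewrite crd_mkVz.
suff E : (w + w^*%C + dot z (conjz z)) =
   2 * ((Re (w - dot z z / 2) + \sum_(i < m) Re (z ord0 i) ^+ 2)%:C)%C.
  rewrite E !addc_conj; set x1 := Re u; set xv := Re v; rewrite -mulrDr; set y := _ + _.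
  have -> : 2 * (2 * (xv%:C)%C) = 2 * ((x1%:C)%C) * (2 * (y%:C)%C) <-> xv = x1 * y; last by [].
  split=> [H|->]; last by rewrite rmorphM /=; ring.
  have : (xv%:C)%C = ((x1 * y)%:C)%C.
    have n4 : (4 : C) != 0 by rewrite pnatr_eq0.
    by apply: (mulfI n4); rewrite rmorphM /=; apply: (lc H); ring.
  by case.
rewrite rmorphD /= rmorph_sum /= mulrDr -addc_conj conjcB conjcM conjc_half.
rewrite /dot [((\sum_j _)^*)%C]rmorph_sum.
have -> : w - (\sum_j z ord0 j * z ord0 j) / 2 + (w^*%C - (\sum_i (z ord0 i * z ord0 i)^*%C) / 2) =
   w + w^*%C + (- 2^-1) * (\sum_j z ord0 j * z ord0 j + \sum_i (z ord0 i * z ord0 i)^*%C) by ring.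
rewrite -[RHS]addrA; congr (_ + _); rewrite -big_split /= !mulr_sumr -big_split /=.
apply: eq_bigr => i _; rewrite mxE.
have n2 : (2 : C) != 0 by rewrite pnatr_eq0.
have -> : ((Re (z ord0 i) ^+ 2)%:C)%C = ((z ord0 i + (z ord0 i)^*%C) / 2) ^+ 2.
  by rewrite addc_conj mulrC mulKf// rmorphXn.
by rewrite conjcM; field.
Qed.
End Coord.
End Coordinates.

(** * Elements of the isotropy algebra are tangent fields *)

Section Tangency.
Variable R : realType.
Local Notation C := R[i].
Local Notation N := (@ComplexField.Normc.normc R).
Local Notation Re := (@complex.Re R).
Lemma conjc_continuous : continuous (@conjc R : C -> C).
Proof.
move=> z A /nbhs_normc[d d0 dA]; apply/nbhs_normc; exists d => // w wd.
by apply: dA; rewrite -conjcB normc_conj.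
Qed.

Lemma cvg_conjc (F : set_system R) (FF : Filter F) (f : R -> C) (l : C) :
  f @ F --> l -> (fun t => (f t)^*%C) @ F --> l^*%C.
Proof. by move=> h; apply: (cvg_comp _ _ h); exact: conjc_continuous. Qed.

Lemma cvg_realC : (fun t : R => (t%:C)%C : C) @ 0^' --> (0 : C).
Proof.
move=> A /nbhs_normc[d d0 dA]; apply/nbhs_ballP; exists d => //= t.
rewrite -ball_normE /= sub0r normrN => td _; apply: dA.
by rewrite subr0 normc_real.
Qed.

Lemma cvgDC (f g : R -> C) (a b : C) : f @ 0^' --> a -> g @ 0^' --> b ->
  (fun t => f t + g t) @ 0^' --> a + b.
Proof. by move=> c1 c2; exact: (cvgD c1 c2). Qed.

Lemma cvgMC (f g : R -> C) (a b : C) : f @ 0^' --> a -> g @ 0^' --> b ->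
  (fun t => f t * g t) @ 0^' --> a * b.
Proof. by move=> c1 c2; exact: (cvgM c1 c2). Qed.

Lemma cvgBC (f g : R -> C) (a b : C) : f @ 0^' --> a -> g @ 0^' --> b ->
  (fun t => f t - g t) @ 0^' --> a - b.
Proof. by move=> c1 c2; exact: (cvgB c1 c2). Qed.

Lemma conjcN (a : C) : (- a)^*%C = - a^*%C. Proof. by rewrite rmorphN. Qed.

Section Tangent.
Variable m : nat.
Local Notation n := m.+2.
Local Notation V := 'rV[C]_n.+1.
Local Notation Z := 'rV[C]_m.

(** The second component is the velocity of w = z_2 + zeta.zeta / 2, not of z_2. *)
Definition vf_of (X : V -> V) : @vf R m :=
  VF (fun u w z v => crd (X (Tm u w z v)) 1)
     (fun u w z v => crd (X (Tm u w z v)) 2 + dot z (zpart (X (Tm u w z v))))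
     (fun u w z v => zpart (X (Tm u w z v)))
     (fun u w z v => crd (X (Tm u w z v)) n.+1).

(** The real part of X annihilates the defining equation, whose gradient is expressed with
   conjugates. *)
Definition tangent_at (X : @vf R m) u w (z : Z) v :=
  2 * (vD X u w z v + (vD X u w z v)^*%C) =
    (vA X u w z v + (vA X u w z v)^*%C) * (w + w^*%C + dot z (conjz z))
    + (u + u^*%C) * (vB X u w z v + (vB X u w z v)^*%C
        + dot (vK X u w z v) (conjz z) + dot z (conjz (vK X u w z v))).

Lemma conj_dot (z z' : Z) : (dot z z')^*%C = dot (conjz z) (conjz z').
Proof. by rewrite /dot rmorph_sum; apply: eq_bigr => i _; rewrite !mxE rmorphM. Qed.

Lemma conjzD (a b : Z) : conjz (a + b) = conjz a + conjz b.
Proof. by apply/rowP => i; rewrite !mxE rmorphD. Qed.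

Lemma conjzZ k (a : Z) : conjz (k *: a) = k^*%C *: conjz a.
Proof. by apply/rowP => i; rewrite !mxE rmorphM. Qed.

Lemma zpartD (a b : V) : zpart (a + b) = zpart a + zpart b.
Proof. by apply/rowP => i; rewrite !mxE crdD. Qed.

Lemma zpartZ k (a : V) : zpart (k *: a) = k *: zpart a.
Proof. by apply/rowP => i; rewrite !mxE crdZ. Qed.

Lemma cvg_dot (f g : R -> Z) (a b : Z) : (forall i, (fun t => f t ord0 i) @ 0^' --> a ord0 i) ->
  (forall i, (fun t => g t ord0 i) @ 0^' --> b ord0 i) ->
  (fun t => dot (f t) (g t)) @ 0^' --> dot a b.
Proof.
move=> hf hg; have -> : (fun t => dot (f t) (g t)) = \sum_j (fun t => f t ord0 j * g t ord0 j).
  by apply/funext => t; rewrite fct_sumE.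
apply: (big_ind2 (fun (h : R -> C) (l : C) => h @ 0^' --> l)); first exact: cvg_cst.
  by move=> h1 l1 h2 l2 c1 c2; exact: cvgDC.
by move=> j _; apply: cvgMC; [exact: hf|exact: hg].
Qed.

Lemma dotDr (z a b : Z) : dot z (a + b) = dot z a + dot z b.
Proof. by rewrite !(dotC z) dotDl. Qed.

Lemma Gammat_crd (a : V) : Gammat a <->
  2 * (crd a n.+1 + (crd a n.+1)^*%C) = (crd a 1 + (crd a 1)^*%C) *
    (crd a 2 + (crd a 2)^*%C + (dot (zpart a) (zpart a) + dot (conjz (zpart a)) (conjz (zpart a))) / 2
     + dot (zpart a) (conjz (zpart a))) /\ 0 < Re (crd a 1).
Proof.
rewrite -{1}[a]Tm_crd; set z := zpart a; set w := crd a 2.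
apply: (iff_trans (Gammat_Tm _ _ _ _)).
rewrite conjcD conjcM conjc_half conj_dot.
by have -> : w + dot z z / 2 + (w^*%C + dot (conjz z) (conjz z) / 2) + dot z (conjz z) =
   w + w^*%C + (dot z z + dot (conjz z) (conjz z)) / 2 + dot z (conjz z) by ring.
Qed.

(** The defining equation at the base of a segment, subtracted from the one at its end, is
   divisible by T. *)
Lemma graph_difference (av av' xv xv' au au' xu xu' a2 a2' x2 x2' T : C) (za zx ca cx : Z) :
  2 * (av + T * xv + (av' + T * xv')) = (au + T * xu + (au' + T * xu')) *
    (a2 + T * x2 + (a2' + T * x2')
     + (dot (za + T *: zx) (za + T *: zx) + dot (ca + T *: cx) (ca + T *: cx)) / 2
     + dot (za + T *: zx) (ca + T *: cx)) ->
  2 * (av + av') = (au + au') * (a2 + a2' + (dot za za + dot ca ca) / 2 + dot za ca) ->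
  T * (2 * (xv + xv') - (xu + xu') * (a2 + a2' + (dot za za + dot ca ca) / 2 + dot za ca)
   - (au + au' + T * (xu + xu')) *
    (x2 + x2' + (dot za zx + dot zx za + T * dot zx zx + dot ca cx + dot cx ca + T * dot cx cx) / 2
     + dot za cx + dot zx ca + T * dot zx cx)) = 0.
Proof.
rewrite !dotDl !dotDr !dotZl !dotZr => E F.
by apply: (lc (lcD E (lcM (- 1) F))); field.
Qed.

(** The quotient by T of the difference of the values at a + T f and at a of the defining
   equation, as a polynomial in T; at T = 0 it is the tangency condition for f at a. *)
Definition difference_quotient (a f : V) (T : C) : C :=
  2 * (crd f n.+1 + (crd f n.+1)^*%C)
  - (crd f 1 + (crd f 1)^*%C) * (crd a 2 + (crd a 2)^*%C
      + (dot (zpart a) (zpart a) + dot (conjz (zpart a)) (conjz (zpart a))) / 2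
     + dot (zpart a) (conjz (zpart a)))
  - (crd a 1 + (crd a 1)^*%C + T * (crd f 1 + (crd f 1)^*%C)) *
    (crd f 2 + (crd f 2)^*%C
     + (dot (zpart a) (zpart f) + dot (zpart f) (zpart a) + T * dot (zpart f) (zpart f)
        + dot (conjz (zpart a)) (conjz (zpart f)) + dot (conjz (zpart f)) (conjz (zpart a))
        + T * dot (conjz (zpart f)) (conjz (zpart f))) / 2
     + dot (zpart a) (conjz (zpart f)) + dot (zpart f) (conjz (zpart a)) + T * dot (zpart f) (conjz (zpart f))).

Lemma difference_quotient0 (a f : V) (t : R) : t != 0 -> Gammat a -> Gammat (a + (t%:C)%C *: f) ->
  difference_quotient a f (t%:C)%C = 0.
Proof.
move=> t0 /Gammat_crd[Ga _] /Gammat_crd[+ _].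
rewrite !zpartD !zpartZ !crdD !crdZ !conjzD !conjzZ !conjcD !conjcM conjc_real => E.
have T0 : ((t%:C)%C : C) != 0 by rewrite -normc_eq0 normc_real normr_eq0.
by apply: (mul_eq0 T0); exact: (graph_difference E Ga).
Qed.

Lemma cvg_difference_quotient (a y : V) (x : R -> V) :
  (forall j, (fun t => crd (x t) j) @ 0^' --> crd y j) ->
  (fun t => difference_quotient a (x t) ((t%:C)%C)) @ 0^' --> difference_quotient a y 0.
Proof.
move=> c.
have cc j : (fun t => (crd (x t) j)^*%C) @ 0^' --> (crd y j)^*%C by apply: cvg_conjc; exact: c.
have cz i : (fun t => (zpart (x t)) ord0 i) @ 0^' --> (zpart y) ord0 i.
  by under eq_fun do rewrite mxE; rewrite mxE; exact: c.
have ccz i : (fun t => (conjz (zpart (x t))) ord0 i) @ 0^' --> (conjz (zpart y)) ord0 i.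
  by under eq_fun do rewrite !mxE; rewrite !mxE; exact: cc.
have ca i : (fun t : R => (zpart a) ord0 i) @ 0^' --> (zpart a) ord0 i by exact: cvg_cst.
have cca i : (fun t : R => (conjz (zpart a)) ord0 i) @ 0^' --> (conjz (zpart a)) ord0 i by exact: cvg_cst.
have sc j := cvgDC (c j) (cc j).
have k (q : C) : (fun t : R => q) @ 0^' --> q by exact: cvg_cst.
have T := cvg_realC.
have md (f g : R -> Z) (p q : Z) : (forall i, (fun t => f t ord0 i) @ 0^' --> p ord0 i) ->
   (forall i, (fun t => g t ord0 i) @ 0^' --> q ord0 i) ->
   (fun t => ((t%:C)%C) * dot (f t) (g t)) @ 0^' --> 0 * dot p q.
  by move=> hf hg; exact: (cvgMC T (cvg_dot hf hg)).
exact: (cvgBC (cvgBC (cvgMC (k 2) (sc n.+1)) (cvgMC (sc 1%N) (k _)))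
  (cvgMC (cvgDC (k _) (cvgMC T (sc 1%N)))
    (cvgDC (cvgDC (cvgDC (cvgDC (sc 2%N) (cvgMC (cvgDC (cvgDC (cvgDC (cvgDC (cvgDC
      (cvg_dot ca cz) (cvg_dot cz ca)) (md _ _ _ _ cz cz)) (cvg_dot cca ccz))
      (cvg_dot ccz cca)) (md _ _ _ _ ccz ccz)) (k 2^-1)))
      (cvg_dot ca ccz)) (cvg_dot cz cca)) (md _ _ _ _ cz ccz)))).
Qed.

(** Tangency at a point is the limit of [difference_quotient0] as t tends to 0; p0 is fixed by
   the whole curve. *)
Lemma isotropy_algebra_tangent (X : V -> V) : isotropy_algebra X ->
  exists U : set V, [/\ open U, U (p0 R n), holomorphic_on U X, X (p0 R n) = 0 &
    forall u w z v, U (Tm u w z v) -> 2 * (v + v^*%C) = (u + u^*%C) * (w + w^*%C + dot z (conjz z)) ->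
     0 < Re u -> tangent_at (vf_of X) u w z v].
Proof.
move=> [U [e [phi [e0 iso phi0 hX cv]]]].
have [U0 _ [W [oU _ _ _ _]] _] := iso 0 ltac:(by rewrite normr0).
pose xi (z : V) (t : R) : V := ((t^-1)%:C)%C *: (phi t z - z).
have cvX z : U z -> xi z @ 0^' --> X z.
  move=> Uz; have /fam_cvgP H := cv [::].
  have := H [set z] ltac:(by split; [move=> _ ->|exact: compact_set1]).
  by rewrite uniform_set1.
have cvcrd z j : U z -> (fun t => crd (xi z t) j) @ 0^' --> crd (X z) j.
  move=> Uz; apply: (@cvg_comp _ _ _ (xi z) (fun a : V => a ord0 (inord j.-1)) _ _ _ (cvX z Uz)).
  exact: (@coord_continuous C 1 n.+1 ord0 (inord j.-1) (X z)).
have xiE z (t : R) : t != 0 -> phi t z = z + ((t%:C)%C) *: xi z t.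
  move=> t0; rewrite /xi scalerA -rmorphM /= divff// rmorph1 scale1r.
  by rewrite addrC subrK.
have neart : \forall t \near (0 : R)^', `|t| < e /\ t != 0.
  apply/nbhs_ballP; exists e => //= t; rewrite -ball_normE /= sub0r normrN => te t0; split => //.
have isoG t z : `|t| < e -> U z -> Gammat z -> Gammat (phi t z).
  by move=> te Uz Gz; have [_ _ _ h] := iso t te; apply: h; exists z.
exists U; split=> //.
  apply: (@cvg_unique _ (@norm_hausdorff _ _) _ _ _ _ (cvX _ U0)).
  apply: cvg_near_cst; apply: filterS neart => t [te _].
  by rewrite /xi; have [_ -> _ _] := iso t te; rewrite subrr scaler0.
move=> u w z v UT hG u0.
set a := Tm u w z v in UT *.
have G0 : Gammat a by apply/Gammat_Tm.
pose x t := xi a t; pose y := X a.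
pose d := difference_quotient a.
have dx0 : \forall t \near (0 : R)^', 0 = d (x t) ((t%:C)%C).
  apply: filterS neart => t [te t0]; symmetry; apply: difference_quotient0 => //.
  by rewrite -(xiE a t t0); exact: isoG.
have dcv : (fun t => d (x t) ((t%:C)%C)) @ 0^' --> d y 0.
  by apply: cvg_difference_quotient => j; exact: cvcrd.
have y0 : d y 0 = 0.
  apply: (@cvg_unique _ (@norm_hausdorff _ _) _ _ _ _ dcv).
  by apply: cvg_near_cst; apply: filterS dx0 => t <-.
move: y0; rewrite /d /difference_quotient /a /Tm crd_mkV1 crd_mkV2 -/a.
have -> : zpart (mkV u (w - dot z z / 2) z v) = z by apply/rowP => i; rewrite mxE crd_mkVz.
move=> y0; rewrite /tangent_at /= -/a -/y.
rewrite (dotC (zpart y) z) (dotC (conjz (zpart y)) (conjz z)) in y0.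
rewrite !(conjcN, conjcD, conjcM, conjc_half, conj_dot) in y0.
rewrite !(conjcN, conjcD, conjcM, conjc_half, conj_dot).
by apply: (lc y0); field.
Qed.
End Tangent.
End Tangency.

(** * Polarization of tangency *)

Section Polarization.
Variable R : realType.
Local Notation C := R[i].
Local Notation N := (@ComplexField.Normc.normc R).
Local Notation Re := (@complex.Re R).
Local Notation "x +i* y" := (Complex x y).
Local Notation II := (0 +i* 1 : C).

Lemma II_neq0 : II != 0.
Proof. by rewrite eq_complex /= negb_and oner_eq0 orbT. Qed.

Lemma conjc_II : II^*%C = - II.
Proof. by cring. Qed.

(** The affine map C -> C with value a at i whose values at real parameters are conjugate to
   those of [lin] b a. *)
Definition lin (a b s : C) : C := (a + b^*%C) / 2 + (a - b^*%C) / (2 * II) * s.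

Lemma lin_II a b : lin a b II = a.
Proof. by rewrite /lin; field; rewrite II_neq0. Qed.

Lemma lin_conj a b s : (lin a b (s^*)%C)^*%C = lin b a s.
Proof.
rewrite /lin conjcD !conjcM conjcD conjcB !conjcK !conjc_inv conjcM conjc_II !conjc2.
by field; rewrite II_neq0.
Qed.

Lemma lin_sub1 a b s : lin a b s - 1 = lin (a - 1) (b - 1) s.
Proof. by rewrite /lin conjcB conjc1; field; rewrite II_neq0. Qed.

Lemma linN a b s : lin (- a) (- b) s = - lin a b s.
Proof. by rewrite /lin conjcN; field; rewrite II_neq0. Qed.

Lemma lin_cdiff a b s : cdiff (lin a b) s.
Proof.
apply: cdiffD; first exact: cdiff_cst.
by apply: cdiffM; [exact: cdiff_cst|exact: cdiff_id].
Qed.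

Lemma lin_bound a b s (d : R) : N a < d -> N b < d -> N s < 4 -> N (lin a b s) < 5 * d.
Proof.
move=> ha hb hs; have d0 : 0 < d by apply: le_lt_trans ha; exact: normc_ge0.
have NI : N (2 * II) = 2 by rewrite normcM normc2 /= expr0n expr1n add0r sqrtr1 mulr1.
have hb' : N (b^*)%C < d by rewrite normc_conj.
have s1 : N (a + b^*%C) < 2 * d by apply: normcD_lt ha hb' _; lra.
have s2 : N (a - b^*%C) < 2 * d by apply: (normcD_lt ha (s := d)); rewrite ?normcN//; lra.
rewrite /lin; apply: le_lt_trans (le_normcD _ _) _.
rewrite !normcM !ComplexField.Normc.normcV NI normc2.
have : N (a - b^*%C) / 2 * N s <= d * 4 by apply: ler_pM => //; rewrite ?divr_ge0 ?normc_ge0//; lra.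
lra.
Qed.

Section Polar.
Variable m : nat.
Local Notation n := m.+2.
Local Notation V := 'rV[C]_n.+1.
Local Notation Z := 'rV[C]_m.

Lemma cdiff_dot (f g : C -> Z) s : (forall i, cdiff (fun s => f s ord0 i) s) ->
  (forall i, cdiff (fun s => g s ord0 i) s) -> cdiff (fun s => dot (f s) (g s)) s.
Proof.
move=> hf hg; have -> : (fun t => dot (f t) (g t)) = \sum_j (fun t => f t ord0 j * g t ord0 j).
  by apply/funext => t; rewrite fct_sumE.
apply: (big_ind (fun h : C -> C => cdiff h s)); first exact: cdiff_cst.
  by move=> h1 h2; exact: cdiffD.
by move=> j _; apply: cdiffM; [exact: hf|exact: hg].
Qed.

Lemma cdiff_Tm (u w v : C -> C) (z : C -> Z) s : cdiff u s -> cdiff w s -> cdiff v s ->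
  (forall i, cdiff (fun s => z s ord0 i) s) ->
  forall k, cdiff (fun s => Tm (u s) (w s) (z s) (v s) ord0 k) s.
Proof.
move=> hu hw hv hz; apply: ord_cases => [|||].
- by apply: eq_cdiff hu => t; rewrite -[RHS]/(crd _ 1) crd_mkV1.
- apply: (eq_cdiff (f := fun s => w s + (- (2^-1)) * dot (z s) (z s))).
    by move=> t; rewrite -[RHS]/(crd _ 2) crd_mkV2; ring.
  apply: cdiffD => //; apply: cdiffM; first exact: cdiff_cst.
  exact: cdiff_dot.
- move=> i; apply: eq_cdiff (hz i) => t.
  have -> : (i + 2 = (i + 3).-1)%N by rewrite addn3 addn2.
  by rewrite -[RHS]/(crd _ (i + 3)) crd_mkVz.
- by apply: eq_cdiff hv => t; rewrite -[RHS]/(crd _ n.+1) crd_mkVn.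
Qed.

(** Small polydiscs in the coordinates (u, w, zeta, v) are contained in a given neighbourhood
   of the base point; the factor m + 1 accounts for zeta.zeta. *)
Lemma pt_open (U : set V) : open U -> U (p0 R n) -> exists2 r : R, 0 < r <= 1 &
  forall u w (z : Z) v, pt r u w z v -> U (Tm u w z v).
Proof.
move=> oU U0; have /nbhs_ballP[e /= e0 eU] := open_nbhs_nbhs (conj oU U0).
have [eE e'] := gt0_cplx e0.
pose q := Num.min (Re e) 1; pose r := q / (m%:R + 1).
have m0 : (0 : R) <= m%:R by rewrite ler0n.
have m1 : (0 : R) < m%:R + 1 by lra.
have q0 : 0 < q by rewrite lt_min e' ltr01.
have q1 : q <= 1 by rewrite ge_min lexx orbT.
have qe : q <= Re e by rewrite ge_min lexx.
have r0 : 0 < r by rewrite divr_gt0.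
have rq : r * (m%:R + 1) = q by rewrite /r divfK// gt_eqF.
have rleq : r <= q by rewrite -rq; nra.
exists r; first by rewrite r0 (le_trans rleq).
move=> u w z v [hu hw hz hv]; apply: eU; split=> // i.
rewrite (ord1 i); apply: ord_cases => [|||]; rewrite -ball_normE /=.
- rewrite -[X in `|X - _|]/(crd _ 1) -[X in `|_ - X|]/(crd _ 1) crd_mkV1 crd_dd//= norm_normc eE ltcR normcB.
  exact: lt_le_trans hu (le_trans rleq qe).
- rewrite -[X in `|X - _|]/(crd _ 2) -[X in `|_ - X|]/(crd _ 2) crd_mkV2 crd_dd//= norm_normc eE ltcR.
  rewrite sub0r normcN; apply: lt_le_trans qe; rewrite -rq.
  have hz2 : N (dot z z) <= m%:R * r.
    apply: normc_dot => j; apply/ltW; last exact: hz.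
    exact: lt_le_trans (hz j) (le_trans rleq q1).
  apply: le_lt_trans (le_normcD _ _) _.
  rewrite normcN normcM ComplexField.Normc.normcV normc2.
  have mr : 0 <= m%:R * r by rewrite mulr_ge0 // ltW.
  by move: hw hz2 mr; clear; move: (N w) (N (dot z z)) => x y ? ? ?; lra.
- move=> k; have -> : (k + 2 = (k + 3).-1)%N by rewrite addn3 addn2.
  rewrite -[X in `|X - _|]/(crd _ (k + 3)) -[X in `|_ - X|]/(crd _ (k + 3)) crd_mkVz crd_dd; last 2 first.
  + by [].
  + by rewrite addn3 /= !ltnS ltnW.
  rewrite addn3 /= norm_normc eE ltcR sub0r normcN.
  exact: lt_le_trans (hz k) (le_trans rleq qe).
- rewrite -[X in `|X - _|]/(crd _ n.+1) -[X in `|_ - X|]/(crd _ n.+1) crd_mkVn crd_dd ?leqnn//=.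
  rewrite norm_normc eE ltcR sub0r normcN.
  exact: lt_le_trans hv (le_trans rleq qe).
Qed.

(** The conjugate field: its components are the Schwarz reflections of those of X. *)
Definition conj_vf (X : @vf R m) : @vf R m :=
  VF (fun u w z v => (vA X u^*%C w^*%C (conjz z) v^*%C)^*%C)
     (fun u w z v => (vB X u^*%C w^*%C (conjz z) v^*%C)^*%C)
     (fun u w z v => conjz (vK X u^*%C w^*%C (conjz z) v^*%C))
     (fun u w z v => (vD X u^*%C w^*%C (conjz z) v^*%C)^*%C).

Lemma conjzK (z : Z) : conjz (conjz z) = z.
Proof. by apply/rowP => i; rewrite !mxE conjcK. Qed.

(** Given a pair satisfying the complexified equation, take u, w, zeta along [lin], and v so
   that the equation holds for every parameter s. For real s the two points are conjugate and
   lie on the hypersurface, so the defect f of the tangency equation vanishes; by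
   [identity_real] it vanishes at s = i, which is the given pair. The radius d is small enough
   for the curve to stay in U for |s| < 4. *)
Lemma polarize (X : V -> V) (U : set V) : open U -> U (p0 R n) -> holomorphic_on U X ->
  (forall u w z v, U (Tm u w z v) -> 2 * (v + v^*%C) = (u + u^*%C) * (w + w^*%C + dot z (conjz z)) ->
     0 < Re u -> tangent_at (vf_of X) u w z v) ->
  exists2 d : R, 0 < d <= 1 & pol d (vf_of X) (conj_vf (vf_of X)) /\
    forall u w z v, pt d u w z v -> U (Tm u w z v).
Proof.
move=> oU U0 hX tan; have [r /andP[r0 r1] rU] := pt_open oU U0.
have m0 : (0 : R) <= m%:R by rewrite ler0n.
have [d [/andP[d0 dr] dm d1]] : exists d : R, [/\ 0 < d <= r, 30 * (m%:R + 1) * d <= r & d <= 1 / 30].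
  have m1 : 0 < 30 * (m%:R + 1) :> R by lra.
  exists (r / (30 * (m%:R + 1))); have e : 30 * (m%:R + 1) * (r / (30 * (m%:R + 1))) = r.
    by rewrite mulrC divfK// gt_eqF.
  have p : 0 < r / (30 * (m%:R + 1)) by rewrite divr_gt0.
  split; [|by rewrite e|].
  - by rewrite p /= ler_pdivrMr//; nra.
  - by rewrite ler_pdivrMr//; nra.
exists d; first by rewrite d0 /=; lra.
split; last by move=> u w z v p; apply: rU; exact: pt_le p.
move=> u w z v u' w' z' v' [hu hw hz hv] [hu' hw' hz' hv'] E.
pose t := (v - v') / 2.
pose us := lin u u'; pose us' := lin u' u.
pose ws := lin w w'; pose ws' := lin w' w.
pose zs s : Z := \row_j lin (z ord0 j) (z' ord0 j) s.
pose zs' s : Z := \row_j lin (z' ord0 j) (z ord0 j) s.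
pose S s := us s + us' s.
pose P s := ws s + ws' s + dot (zs s) (zs' s).
pose vs s := S s * P s / 4 + lin t (- t) s.
have conj_zs s : conjz (zs s^*%C) = zs' s by apply/rowP => i; rewrite !mxE lin_conj.
have conj_zs' s : conjz (zs' s^*%C) = zs s by apply/rowP => i; rewrite !mxE lin_conj.
have cu s : (us s^*%C)^*%C = us' s by exact: lin_conj.
have cu' s : (us' s^*%C)^*%C = us s by exact: lin_conj.
have cw s : (ws s^*%C)^*%C = ws' s by exact: lin_conj.
have cw' s : (ws' s^*%C)^*%C = ws s by exact: lin_conj.
have conj_S s : (S s^*%C)^*%C = S s by rewrite /S conjcD cu cu' addrC.
have conj_P s : (P s^*%C)^*%C = P s.
  by rewrite /P conjcD (conjcD (ws _)) cw cw' conj_dot conj_zs conj_zs' (addrC (ws' s)) dotC.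
have conj_vs s : (vs s^*%C)^*%C = S s * P s / 4 - lin t (- t) s.
  rewrite /vs conjcD !conjcM conj_S conj_P lin_conj conjc_inv conjc_nat.
  by rewrite -linN opprK.
have usI : us II = u by exact: lin_II.
have usI' : us' II = u' by exact: lin_II.
have wsI : ws II = w by exact: lin_II.
have wsI' : ws' II = w' by exact: lin_II.
have zsI : zs II = z by apply/rowP => i; rewrite mxE lin_II.
have zsI' : zs' II = z' by apply/rowP => i; rewrite mxE lin_II.
have SP : S II * P II / 4 = (v + v') / 2.
  rewrite /S /P usI usI' wsI wsI' zsI zsI'; apply: (lc (lcM (- 4^-1) E)).
  by field.
have vsI : vs II = v by rewrite /vs SP lin_II /t; field.
have big s : N s < 4 -> pt r (us s) (ws s) (zs s) (vs s).
  move=> hs.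
  have b1 : N (us s - 1) < 5 * d by rewrite lin_sub1; apply: lin_bound.
  have b1' : N (us' s - 1) < 5 * d by rewrite lin_sub1; apply: lin_bound.
  have b2 : N (ws s) < 5 * d by apply: lin_bound.
  have b2' : N (ws' s) < 5 * d by apply: lin_bound.
  have b3 j : N (zs s ord0 j) < 5 * d by rewrite mxE; apply: lin_bound.
  have b3' j : N (zs' s ord0 j) < 5 * d by rewrite mxE; apply: lin_bound.
  have ht : N t < d.
    rewrite /t normcM ComplexField.Normc.normcV normc2.
    have : N (v - v') < 2 * d by apply: (normcD_lt hv (s := d)); rewrite ?normcN//; lra.
    by move: (N _) => x ?; lra.
  have b4 : N (lin t (- t) s) < 5 * d by apply: lin_bound; rewrite ?normcN.
  have d5 : 5 * d <= r.
    by move: dm m0 d0; clear; move: (m%:R) => M; nra.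
  have bD : N (dot (zs s) (zs' s)) <= m%:R * (5 * d).
    apply: normc_dot => j; apply/ltW; last exact: b3'.
    by apply: lt_le_trans (b3 j) _; lra.
  have bP : N (P s) <= 10 * d + m%:R * (5 * d).
    apply: le_trans (le_normcD _ _) _; apply: lerD => //.
    by apply/ltW/(normcD_lt b2 b2'); lra.
  have bS : N (S s) <= 3.
    have -> : S s = (us s - 1 + (us' s - 1)) + 2 by rewrite /S; ring.
    apply: le_trans (le_normcD _ _) _; rewrite normc2.
    have : N (us s - 1 + (us' s - 1)) < 10 * d by apply: normcD_lt b1 b1' _; lra.
    by move: (N _) => x ?; lra.
  split.
  - exact: lt_le_trans b1 d5.
  - exact: lt_le_trans b2 d5.
  - by move=> j; exact: lt_le_trans (b3 j) d5.
  - rewrite /vs; apply: le_lt_trans (le_normcD _ _) _.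
    rewrite !normcM ComplexField.Normc.normcV.
    have -> : N 4 = 4 by rewrite -[4](rmorph_nat (real_complex R)) normc_real ger0_norm.
    have : N (S s) * N (P s) <= 3 * (10 * d + m%:R * (5 * d)).
      by apply: ler_pM => //; exact: normc_ge0.
    have md : 0 <= m%:R * d by rewrite mulr_ge0// ltW.
    move: b4 dm d0 md; clear; move: (N _) (N (S s) * N (P s)) (m%:R) => x y M.
    by move=> *; lra.
have cd (s : C) : N s < 4 -> forall k, cdiff (fun s => X (Tm (us s) (ws s) (zs s) (vs s)) ord0 k) s.
  move=> hs k; apply: cdiff_comp; last by apply: hX; apply: rU; exact: big.
  have cz i : cdiff (fun s => zs s ord0 i) s.
    by apply: (eq_cdiff (f := lin (z ord0 i) (z' ord0 i))); [move=> x; rewrite mxE|exact: lin_cdiff].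
  have cz' i : cdiff (fun s => zs' s ord0 i) s.
    by apply: (eq_cdiff (f := lin (z' ord0 i) (z ord0 i))); [move=> x; rewrite mxE|exact: lin_cdiff].
  have cS : cdiff S s by apply: cdiffD; exact: lin_cdiff.
  have cP : cdiff P s.
    by apply: cdiffD; [apply: cdiffD; exact: lin_cdiff|exact: cdiff_dot].
  apply: cdiff_Tm; [exact: lin_cdiff|exact: lin_cdiff| |exact: cz].
  apply: cdiffD; last exact: lin_cdiff.
  by apply: cdiffM; [exact: cdiffM|exact: cdiff_cst].
pose gA s := vA (vf_of X) (us s) (ws s) (zs s) (vs s).
pose gB s := vB (vf_of X) (us s) (ws s) (zs s) (vs s).
pose gK s := vK (vf_of X) (us s) (ws s) (zs s) (vs s).
pose gD s := vD (vf_of X) (us s) (ws s) (zs s) (vs s).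
pose f s := 2 * (gD s + (gD s^*%C)^*%C) - ((gA s + (gA s^*%C)^*%C) * P s
  + S s * (gB s + (gB s^*%C)^*%C + dot (gK s) (zs' s) + dot (zs s) (conjz (gK s^*%C)))).
have fcd s : N s < 4 -> cdiff f s.
  move=> hs; have hs' : N s^*%C < 4 by rewrite normc_conj.
  have cz (p q : Z) (x : C) i : cdiff (fun x => (\row_j lin (p ord0 j) (q ord0 j) x : Z) ord0 i) x.
    by apply: (eq_cdiff (f := lin (p ord0 i) (q ord0 i))); [move=> y; rewrite mxE|exact: lin_cdiff].
  have cS : cdiff S s by apply: cdiffD; exact: lin_cdiff.
  have cP : cdiff P s.
    by apply: cdiffD; [apply: cdiffD; exact: lin_cdiff|apply: cdiff_dot => i; exact: cz].
  have cK x : N x < 4 -> forall i, cdiff (fun x => gK x ord0 i) x.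
    by move=> hx i; apply: eq_cdiff (cd x hx (inord (i + 3).-1)) => y; rewrite mxE.
  have cA x : N x < 4 -> cdiff gA x by move=> hx; exact: cd.
  have cD x : N x < 4 -> cdiff gD x by move=> hx; exact: cd.
  have cB x : N x < 4 -> cdiff gB x.
    move=> hx; apply: cdiffD; first exact: cd.
    by apply: cdiff_dot => i; [exact: cz|exact: cK].
  have cKc i : cdiff (fun x => conjz (gK x^*%C) ord0 i) s.
    apply: (eq_cdiff (f := fun x => (gK x^*%C ord0 i)^*%C)); first by move=> x; rewrite [RHS]mxE.
    exact: (cdiff_conj (cK _ hs' i)).
  have two : cdiff (cst (2 : C)) s by exact: cdiff_cst.
  have neg : cdiff (cst (- 1 : C)) s by exact: cdiff_cst.
  have L := cdiffM two (cdiffD (cD _ hs) (cdiff_conj (cD _ hs'))).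
  have M1 := cdiffM (cdiffD (cA _ hs) (cdiff_conj (cA _ hs'))) cP.
  have M2 := cdiffM cS (cdiffD (cdiffD (cdiffD (cB _ hs) (cdiff_conj (cB _ hs')))
     (cdiff_dot (cK _ hs) (cz z' z s))) (cdiff_dot (cz z z' s) cKc)).
  apply: eq_cdiff (cdiffD L (cdiffM neg (cdiffD M1 M2))) => x.
  by rewrite /f /= mulN1r.
(* for a real parameter the two points are conjugate, and tangency applies *)
have freal (x : R) : `|x| <= 1 -> f (x%:C)%C = 0.
  move=> hx; have Nx : N ((x%:C)%C) < 4 by rewrite normc_real; apply: le_lt_trans hx _; lra.
  have [h1 h2 h3 h4] := big _ Nx.
  set c := (x%:C)%C in Nx h1 h2 h3 h4 *.
  have cc : c^*%C = c by exact: conjc_real.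
  have ru : (us c)^*%C = us' c by rewrite -cu cc.
  have rw : (ws c)^*%C = ws' c by rewrite -cw cc.
  have rz : conjz (zs c) = zs' c by rewrite -conj_zs cc.
  have rv : (vs c)^*%C = S c * P c / 4 - lin t (- t) c by rewrite -conj_vs cc.
  have re0 : 0 < Re (us c).
    have := ler_Re (us c - 1); rewrite ReB /= => hre.
    have {}hre : `|Re (us c) - 1| < 1 by apply: le_lt_trans hre _; apply: lt_le_trans h1 r1.
    by move: hre; rewrite ltr_norml => /andP[+ _]; move: (Re _) => y; clear; lra.
  have := tan (us c) (ws c) (zs c) (vs c) (rU _ _ _ _ (And4 h1 h2 h3 h4)).
  rewrite rv ru rw rz => H; have {}H := H _ re0.
  have e4 : 2 * (vs c + (S c * P c / 4 - lin t (- t) c)) =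
    (us c + us' c) * (ws c + ws' c + dot (zs c) (zs' c)).
    by rewrite {1}/vs -/(S c) -/(P c); field.
  have {H} := H e4; rewrite /tangent_at ru rw rz => H.
  by rewrite /f cc; apply/eqP; rewrite subr_eq0; apply/eqP.
have := identity_real fcd freal; rewrite /f.
have cI (g : C -> C) y : (g II^*%C)^*%C = y -> g II^*%C = y^*%C by move=> <-; rewrite conjcK.
have uI : us II^*%C = u'^*%C by apply: cI; rewrite cu usI'.
have wI : ws II^*%C = w'^*%C by apply: cI; rewrite cw wsI'.
have zI : zs II^*%C = conjz z' by rewrite -zsI' -conj_zs conjzK.
have vI : vs II^*%C = v'^*%C.
  by apply: cI; rewrite conj_vs SP lin_II /t; field.
rewrite /gA /gB /gK /gD uI wI zI vI usI wsI zsI vsI zsI' => H.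
have PI : P II = w + w' + dot z z' by rewrite /P wsI wsI' zsI zsI'.
have SI : S II = u + u' by rewrite /S usI usI'.
by rewrite PI SI in H; apply/eqP; rewrite -subr_eq0; apply/eqP.
Qed.
End Polar.
End Polarization.

(** * Differentiability of the zeta-component *)

Section Frechet.
Variable R : realType.
Local Notation C := R[i].
Local Notation N := (@ComplexField.Normc.normc R).
Local Notation Re := (@complex.Re R).
Section NormalForm.
Variable m : nat.
Local Notation n := m.+2.
Local Notation V := 'rV[C]_n.+1.
Local Notation Z := 'rV[C]_m.

Lemma mx_norm_lt (h : V) (r : R) : 0 < r -> `|h| < (r%:C)%C <-> forall k, N (h ord0 k) < r.
Proof.
move=> r0; have rC : 0 < (r%:C)%C :> C by rewrite ltcR.
have E : ball (0 : V) (r%:C)%C h <-> `|h| < (r%:C)%C.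
  by rewrite mx_norm_ball /ball_ /= sub0r normrN.
rewrite -E; split=> [[_ H] k|H].
  by have := H ord0 k; rewrite -ball_normE /= mxE sub0r normrN norm_normc ltcR.
split=> // i k; rewrite (ord1 i) -ball_normE /= mxE sub0r normrN norm_normc ltcR.
exact: H.
Qed.

(** Differentiability with real estimates on the entries in place of Landau symbols over the
   complex numbers. *)
Lemma diff_eps (X : V -> V) (a : V) : differentiable X a -> forall e : R, 0 < e ->
  exists2 r : R, 0 < r & forall (h : V) (B : R), 0 < B < r -> (forall k, N (h ord0 k) <= B) ->
    forall j, N ((X (a + h) - X a - 'd X a h) ord0 j) <= e * B.
Proof.
move=> dX e e0.
have := diff_locally dX; rewrite funeqE => E.
have /eqaddoP H : X \o shift a = cst (X a) + 'd X a +o_ (0 : V) id.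
  by apply/funext => h; exact: E.
have e2 : 0 < ((e / 4)%:C)%C :> C by rewrite ltcR divr_gt0.
have /nbhs_ballP[r0 /= r00 hr] := H _ e2.
have [rE rp] := gt0_cplx r00.
exists (Re r0 / 2); first by rewrite divr_gt0.
move=> h B /andP[B0 Br] hB j.
have B2 : 0 < 2 * B by rewrite mulr_gt0.
have hh : `|h| < ((2 * B)%:C)%C.
  by apply/mx_norm_lt => // k; apply: le_lt_trans (hB k) _; lra.
have hb : ball (0 : V) r0 h.
  rewrite rE; have [_ T] := mx_norm_lt h rp.
  rewrite mx_norm_ball /ball_ /= sub0r normrN; apply: T => k.
  by apply: le_lt_trans (hB k) _; lra.
have := hr h hb; rewrite /= => K.
have eB : 0 < e * B by rewrite mulr_gt0.
have L : `|X (a + h) - X a - 'd X a h| < ((e * B)%:C)%C.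
  have -> : X (a + h) - X a - 'd X a h = (X \o shift a - (cst (X a) + 'd X a)) h.
    by rewrite -[RHS]/(X (h + a) - (X a + 'd X a h)) [h + a]addrC opprD addrA.
  apply: le_lt_trans K _; apply: (@lt_le_trans _ _ (((e / 4)%:C)%C * ((2 * B)%:C)%C)).
    by rewrite ltr_pM2l.
  by rewrite -rmorphM /= lecR; nra.
by apply/ltW; exact: ((mx_norm_lt _ eB).1 L j).
Qed.

Lemma mkV_z (z : Z) : mkV 0 0 z 0 = \sum_(i < m) z ord0 i *: dd R n (i + 3).
Proof. by rewrite /mkV !scale0r !add0r. Qed.

(** The coordinates are quadratic in zeta: the correction along z_2 is of second order in s
   and does not affect the derivative. *)
Lemma Tm_move w (z : Z) (s : C) : Tm 1 w (s *: z) 0 =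
  Tm 1 w 0 0 + (s *: (\sum_(i < m) z ord0 i *: dd R n (i + 3)) + (- (s ^+ 2 * dot z z / 2)) *: dd R n 2).
Proof.
rewrite -mkV_z /Tm; apply: crd_eq.
- by rewrite crd_mkV1 crdD crd_mkV1 crdD crdZ crd_mkV1 crdZ crd_dd// !mulr0 !addr0.
- rewrite crd_mkV2 crdD crd_mkV2 crdD crdZ crd_mkV2 crdZ crd_dd// dot0l dotZl dotZr /=; ring.
- move=> i; rewrite crd_mkVz crdD crd_mkVz crdD crdZ crd_mkVz crdZ crd_dd//; last first.
    by rewrite addn3 /= !ltnS ltnW.
  have -> : (2 == i + 3)%N = false by rewrite addn3.
  by rewrite !mxE mulr0 addr0 add0r.
- by rewrite crd_mkVn crdD crd_mkVn crdD crdZ crd_mkVn crdZ crd_dd ?leqnn//= !mulr0 !addr0.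
Qed.

Lemma Kdiff_vf_of (X : V -> V) (d : R) : (forall w, N w < d -> differentiable X (Tm 1 w 0 0)) ->
  Kdiff d (vf_of X).
Proof.
move=> dX w hw; have df := dX w hw; set a := Tm 1 w 0 0 in df.
exists (\matrix_(i, k) zpart ('d X a (dd R n (i + 3))) ord0 k) => z e e0.
pose l : V := \sum_(i < m) z ord0 i *: dd R n (i + 3).
pose q := - (dot z z / 2).
(* |h| <= t c for the displacement h below, and the second-order term is at most t^2 b *)
pose c := 1 + \sum_(k < n.+1) (N (l ord0 k) + N ((q *: dd R n 2 : V) ord0 k)).
have c1 : 1 <= c.
  rewrite /c lerDl; apply: sumr_ge0 => k _; apply: addr_ge0; exact: normc_ge0.
have cb k : N (l ord0 k) + N ((q *: dd R n 2 : V) ord0 k) <= c.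
  rewrite /c (bigD1 k)//= addrCA lerDl addr_ge0 ?ler01//.
  by apply: sumr_ge0 => i _; apply: addr_ge0; exact: normc_ge0.
have c0 : 0 < c by lra.
pose b := \sum_(k < n.+1) N ((q *: 'd X a (dd R n 2)) ord0 k).
have b0 : 0 <= b by apply: sumr_ge0 => k _; exact: normc_ge0.
have bb k : N ((q *: 'd X a (dd R n 2)) ord0 k) <= b.
  rewrite /b (bigD1 k)//= lerDl.
  by apply: sumr_ge0 => i _; exact: normc_ge0.
have [r r0 hr] := diff_eps df (e := e / (2 * c)) ltac:(by rewrite divr_gt0// mulr_gt0).
pose t0 := Num.min (Num.min (r / c) 1) (e / (2 * (b + 1))).
have b1 : 0 < b + 1 by lra.
exists t0; first by rewrite !lt_min !divr_gt0 ?ltr01// mulr_gt0.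
move=> t /andP[tp]; rewrite !lt_min => /andP[/andP[tr t1] te] k.
set T := (t%:C)%C; have NT : N T = t by rewrite normc_real ger0_norm// ltW.
have tc : 0 < t * c < r by rewrite mulr_gt0//= -ltr_pdivlMr.
pose h : V := T *: l + (- (T ^+ 2 * dot z z / 2)) *: dd R n 2.
have hE : h = T *: l + T *: (T *: (q *: dd R n 2)).
  by rewrite /h !scalerA; congr (_ + _ *: _); rewrite /q; ring.
have hB j : N (h ord0 j) <= t * c.
  have ZE (x : C) (y : V) : (x *: y) ord0 j = x * y ord0 j by rewrite mxE.
  rewrite hE mxE (ZE T l) (ZE T (T *: _)) (ZE T (q *: _)).
  apply: le_trans (le_normcD _ _) _; rewrite !normcM NT.
  apply: le_trans (_ : t * (N (l ord0 j) + N ((q *: dd R n 2 : V) ord0 j)) <= _); last by rewrite ler_pM2l.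
  rewrite mulrDr lerD2l ler_pM2l// ler_piMl ?normc_ge0//; exact: ltW.
have := hr h (t * c) tc hB (inord (k + 3).-1).
rewrite {1}/h -Tm_move -/a => K.
have dh : 'd X a h = T *: \sum_(i < m) z ord0 i *: 'd X a (dd R n (i + 3)) + T *: (T *: (q *: 'd X a (dd R n 2))).
  have dZ (x : C) (y : V) : 'd X a (x *: y) = x *: 'd X a y by exact: linearZ.
  rewrite hE linearD dZ (dZ T (T *: _)) (dZ T (q *: _)) (dZ q) /l linear_sum.
  by congr (_ *: _ + _); apply: eq_bigr => i _; exact: dZ.
have sE : (z *m \matrix_(i, k) zpart ('d X a (dd R n (i + 3))) ord0 k) ord0 k =
   crd (\sum_(i < m) z ord0 i *: 'd X a (dd R n (i + 3))) (k + 3).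
  by rewrite mxE crd_sum; apply: eq_bigr => i _; rewrite !mxE crdZ.
have pE (y : V) : zpart y ord0 k = crd y (k + 3) by rewrite mxE.
rewrite sE /vf_of /= !pE -/a.
have : N (crd (X (Tm 1 w (T *: z) 0) - X a - 'd X a h) (k + 3)) <= e / (2 * c) * (t * c) := K.
rewrite dh opprD !(crdD, crdN, crdZ) -/T.
set A := crd (X _) _; set A0 := crd (X a) _; set S := crd (\sum_(i < m) _) _; set Q := crd ('d X a (dd R n 2)) _.
move=> K2.
have -> : A - A0 - T * S = (A - A0 + (- (T * S) - T * (T * (q * Q)))) + T * (T * (q * Q)) by ring.
apply: le_trans (le_normcD _ _) _.
have E1 : e / (2 * c) * (t * c) = e / 2 * t by field; rewrite gt_eqF.
rewrite E1 in K2.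
have E2 : N (T * (T * (q * Q))) <= e / 2 * t.
  rewrite normcM NT mulrC ler_pM2r// normcM NT.
  have qb : N (q * Q) <= b by have := bb (inord (k + 3).-1); rewrite mxE.
  apply: le_trans (_ : t * (b + 1) <= _); first by rewrite ler_pM2l//; lra.
  rewrite -ler_pdivlMr// (_ : e / 2 / (b + 1) = e / (2 * (b + 1))) ?ltW//.
  by field; rewrite gt_eqF.
apply: le_trans (lerD K2 E2) _.
by rewrite le_eqVlt; apply/orP; left; apply/eqP; field.
Qed.
End NormalForm.
End Frechet.

(** * The normal form of the isotropy algebra *)

Section Normal_form.
Variable R : realType.
Local Notation C := R[i].
Local Notation N := (@ComplexField.Normc.normc R).
Local Notation Re := (@complex.Re R).
Local Notation Im := (@complex.Im R).
Local Notation "x +i* y" := (Complex x y).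
Local Notation II := (0 +i* 1 : C).
Section NF.
Variable m : nat.
Local Notation n := m.+2.
Local Notation V := 'rV[C]_n.+1.
Local Notation Z := 'rV[C]_m.

Definition skew (H : 'M[C]_m) := forall i j, H i j + (H j i)^*%C = 0.

(** In the coordinates (u, w, zeta, v) the field is (i q / 2) (u^2 - 1) d_u + (2 al w + 2 i p
   (u - 1) + i q v) d_w + zeta (al + H) d_zeta + (2 al v + i p (u^2 - 1) + i q u v) d_v; the
   term - zeta.(zeta H) in the z_2-component comes from z_2 = w - zeta.zeta / 2. *)
Definition nform (al p q : R) (H : 'M[C]_m) (a : V) : V :=
  let u := crd a 1 in let v := crd a n.+1 in let z := zpart a in
  let t (x : R) : C := (x%:C)%C in
  mkV (II * t q / 2 * (u ^+ 2 - 1))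
      (2 * t al * crd a 2 + 2 * (II * t p) * (u - 1) + II * t q * v - dot z (z *m H))
      (t al *: z + z *m H)
      (2 * t al * v + II * t p * (u ^+ 2 - 1) + II * t q * u * v).

Lemma mkV_congr (u u' w w' : C) (z z' : Z) (v v' : C) : u = u' -> w = w' -> z = z' -> v = v' ->
  mkV u w z v = mkV u' w' z' v'.
Proof. by move=> -> -> -> ->. Qed.

(** Converse of [pt_open]: points near p0 lie in a given polydisc. *)
Lemma near_pt (e : R) : 0 < e ->
  \forall a \near p0 R n, pt e (crd a 1) (crd a 2 + dot (zpart a) (zpart a) / 2) (zpart a) (crd a n.+1).
Proof.
move=> e0; pose r := Num.min e 1 / (m%:R + 1).
have m0 : (0 : R) <= m%:R by rewrite ler0n.
have m1 : (0 : R) < m%:R + 1 by lra.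
have q0 : 0 < Num.min e 1 by rewrite lt_min e0 ltr01.
have r0 : 0 < r by rewrite divr_gt0.
have rq : r * (m%:R + 1) = Num.min e 1 by rewrite /r divfK// gt_eqF.
have qe : Num.min e 1 <= e by rewrite ge_min lexx.
have q1 : Num.min e 1 <= 1 by rewrite ge_min lexx orbT.
have rmin : r <= Num.min e 1 by rewrite -rq; nra.
apply/nbhs_ballP; exists ((r%:C)%C) => /=; first by rewrite ltcR.
move=> a [_ /(_ ord0) hb].
have B j : N (crd (p0 R n) j - crd a j) < r.
  by have := hb (inord j.-1); rewrite -ball_normE /= norm_normc ltcR.
have B1 : N (crd a 1 - 1) < r.
  by have := B 1%N; rewrite /p0 crd_dd// normcB.
have Bz (j : 'I_m) : N (zpart a ord0 j) < r.
  have := B (j + 3)%N; rewrite /p0 crd_dd//; last by rewrite addn3 /= !ltnS ltnW.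
  by rewrite addn3 /= sub0r normcN mxE addn3.
have Bn : N (crd a n.+1) < r.
  by have := B n.+1; rewrite /p0 crd_dd ?leqnn//= sub0r normcN.
have B2 : N (crd a 2) < r.
  by have := B 2%N; rewrite /p0 crd_dd//= sub0r normcN.
have re := le_trans rmin qe.
split; [exact: lt_le_trans B1 re| |by move=> j; exact: lt_le_trans (Bz j) re|exact: lt_le_trans Bn re].
have hz2 : N (dot (zpart a) (zpart a)) <= m%:R * r.
  apply: normc_dot => j; apply/ltW; last exact: Bz.
  exact: lt_le_trans (Bz j) (le_trans rmin q1).
apply: le_lt_trans (le_normcD _ _) _; rewrite normcM ComplexField.Normc.normcV normc2.
have mr : 0 <= m%:R * r by rewrite mulr_ge0 // ltW.
apply: lt_le_trans qe; rewrite -rq.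
by move: B2 hz2 mr; clear; move: (N _) (N (dot _ _)) => x y ? ? ?; lra.
Qed.

Lemma conjz_mul (z : Z) (M : 'M[C]_m) : conjz (z *m M) = conjz z *m map_mx (@conjc R) M.
Proof. by rewrite /conjz map_mxM. Qed.

Lemma conjz0 : conjz (0 : Z) = 0.
Proof. by apply/rowP => i; rewrite !mxE conjc0. Qed.

Lemma vA_conj (X : @vf R m) u w (z : Z) v : vA (conj_vf X) u w z v = (vA X u^*%C w^*%C (conjz z) v^*%C)^*%C :> C.
Proof. by []. Qed.
Lemma vB_conj (X : @vf R m) u w (z : Z) v : vB (conj_vf X) u w z v = (vB X u^*%C w^*%C (conjz z) v^*%C)^*%C :> C.
Proof. by []. Qed.
Lemma vK_conj (X : @vf R m) u w (z : Z) v : vK (conj_vf X) u w z v = conjz (vK X u^*%C w^*%C (conjz z) v^*%C) :> Z.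
Proof. by []. Qed.
Lemma vD_conj (X : @vf R m) u w (z : Z) v : vD (conj_vf X) u w z v = (vD X u^*%C w^*%C (conjz z) v^*%C)^*%C :> C.
Proof. by []. Qed.
Let vE := (vA_conj, vB_conj, vK_conj, vD_conj).

Lemma Kdiff_conj (X : @vf R m) (d : R) : Kdiff d X -> Kdiff d (conj_vf X).
Proof.
move=> dX w hw; have [M hM] := dX (w^*)%C ltac:(by rewrite normc_conj).
exists (map_mx (@conjc R) M) => z e e0.
have [t0 t00 ht] := hM (conjz z) e e0; exists t0 => // t ht0 k.
have := ht t ht0 k; rewrite -normc_conj => H; apply: le_trans H.
rewrite !vE conjc1 conjc0 conjz0 conjzZ conjc_real ![conjz _ ord0 k]mxE !conjcB conjcM conjc_real.
have E : ((conjz z *m M) ord0 k)^*%C = (z *m map_mx (@conjc R) M) ord0 k.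
  have -> : ((conjz z *m M) ord0 k)^*%C = conjz (conjz z *m M) ord0 k by rewrite [RHS]mxE.
  by rewrite conjz_mul conjzK.
by rewrite E.
Qed.

Lemma imaginary (k : C) : k^*%C = - k -> k = II * ((Im k)%:C)%C.
Proof.
move=> kE; have : Re k^*%C = Re (- k) by rewrite kE.
rewrite ReN {kE}; case: k => a b /= h; have -> : a = 0 by lra.
by apply/eqP; rewrite eq_complex /= !mul0r !mulr0 subr0 add0r mul1r !eqxx.
Qed.

(** Evaluating the solution for the conjugate field, found in [vf_solve], at conjugate points
   shows that k and l are imaginary, that L' is the conjugate of L and that th is real. *)
Lemma isotropy_algebra_nform (k0 : 'I_m) (X : V -> V) : isotropy_algebra X ->
  exists al p q H, skew H /\ \forall a \near p0 R n, X a = nform al p q H a.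
Proof.
move=> /isotropy_algebra_tangent[U [oU U0 hX X0 tan]].
have [d d01 [hpol dU]] := polarize oU U0 hX tan.
have /andP[d0 d1] := d01.
have nm0 : N 0 = 0 by exact: normc00.
set Xh := vf_of X in hpol; set Yh := conj_vf Xh in hpol.
have XT0 : X (Tm 1 0 0 0) = 0 by rewrite -p0_Tm.
have vX : vanishes Xh.
  split; rewrite /Xh /vf_of /= XT0 ?crd0//; last by apply/rowP => i; rewrite !mxE crd0.
  by rewrite dot0l addr0.
have vY : vanishes Yh.
  have [x1 x2 x3 x4] := vX.
  by split; rewrite /Yh !vE conjc1 conjc0 conjz0 ?x1 ?x2 ?x3 ?x4 ?conjc0 ?conjz0.
have kX : Kdiff d Xh.
  apply: Kdiff_vf_of => w hw; apply: hX; apply: dU; split=> //.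
  - by rewrite subrr nm0.
  - by move=> j; rewrite mxE nm0.
  - by rewrite nm0.
have kY : Kdiff d Yh := Kdiff_conj kX.
have [e [th [k [l [L [L' [e0 SX SY SL]]]]]]] := vf_solve k0 d01 hpol vX vY kX kY.
have e20 : 0 < e by [].
set h := (e%:C)%C / 2; have h0 : h != 0 := half_neq0 e0; have Nh : N h = e / 2 := normc_scale e0.
have Nhc : N (h^*)%C = e / 2 by rewrite normc_conj.
have pz (u v : C) (z : Z) : N (u - 1) < e -> N v < e -> (forall j, N (z ord0 j) < e) -> pt e u 0 z v.
  by move=> *; split=> //; rewrite nm0.
have z0 j : N ((0 : Z) ord0 j) < e by rewrite mxE nm0.
have hlt : N h < e by rewrite Nh; lra.
have hclt : N (h^*)%C < e by rewrite Nhc; lra.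
have u1 : N (1 - 1 : C) < e by rewrite subrr nm0.
have u2 : N (1 + h - 1) < e by rewrite addrC addKr.
have u2c : N (1 + h^*%C - 1) < e by rewrite addrC addKr.
have v0 : N 0 < e by rewrite nm0.
(* the coefficient of v in the w-component, read at v = h for the conjugate field *)
have kim : k^*%C = - k.
  have [E1 _] := SY _ _ _ _ (pz 1 h 0 u1 hlt z0).
  have [_ E2 _ _] := SX _ _ _ _ (pz 1 h^*%C 0 u1 hclt z0).
  move: E1; rewrite /Yh !vE conjc1 conjc0 conjz0 E2.
  rewrite !subrr !mulr0 !add0r addr0 conjcM conjcK => E.
  by apply: (mulIf h0); rewrite E mulNr.
have lim : l^*%C = - l.
  have [E1 _] := SY _ _ _ _ (pz (1 + h) 0 0 u2 v0 z0).
  have [_ E2 _ _] := SX _ _ _ _ (pz (1 + h^*%C) 0 0 u2c v0 z0).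
  rewrite [1 + h^*%C]addrC addrK [h^*%C + 1]addrC !mulr0 !addr0 in E2.
  rewrite [1 + h]addrC addrK [h + 1]addrC !mulr0 subr0 /Yh !vE (conjcD 1 h) conjc1 conjc0 conjz0 E2 in E1.
  by apply: (mulIf h0); rewrite mulNr -mulNr -E1 conjcM conjcK.
have LL : L' = map_mx (@conjc R) L.
  apply/matrixP => i j; apply: (mulfI h0).
  have hz : forall j, N ((h *: delta_mx ord0 i : Z) ord0 j) < e by exact: delta_lt.
  have hzc : forall j, N (conjz (h *: delta_mx ord0 i : Z) ord0 j) < e.
    by move=> j'; rewrite mxE normc_conj.
  have [_ E1] := SY _ _ _ _ (pz 1 0 _ u1 v0 hz).
  have [_ _ E2 _] := SX _ _ _ _ (pz 1 0 _ u1 v0 hzc).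
  move: E1; rewrite /Yh !vE conjc1 conjc0 E2 conjz_mul conjzK => E.
  by rewrite -!mul_delta E.
have thr : th = 2 * ((Re (L k0 k0))%:C)%C.
  by have := SL k0 k0; rewrite LL mxE eqxx mul1r addc_conj => <-.
pose al := Re (L k0 k0).
exists al, (Im l / 2), (Im k), (L - ((al%:C)%C)%:M); split.
  move=> i j; rewrite !mxE; have := SL i j; rewrite LL mxE thr conjcB.
  rewrite (eq_sym j i); case: (i == j) => E; last first.
    by rewrite !mulr0n conjc0 !subr0 E mulr0n mul0r.
  by rewrite !mulr1n conjc_real; rewrite mulr1n in E; apply: (lc E); rewrite /al; ring.
apply: filterS (near_pt e0) => a pa; have [E1 E2 E3 E4] := SX _ _ _ _ pa.
move: E1 E2 E3 E4; rewrite /Xh /vf_of /= Tm_crd => E1 E2 E3 E4.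
have kE := imaginary kim; have lE := imaginary lim.
have l2 : II * (((Im l / 2)%:C)%C) = l / 2.
  rewrite {2}lE rmorphM /= fmorphV rmorph_nat; ring.
rewrite -[LHS]mkV_crd /nform -kE l2 mulmxBr mul_mx_scalar E3.
apply: mkV_congr.
- by rewrite E1.
- have {}E2 : crd (X a) 2 = l * (crd a 1 - 1) + k * crd a n.+1 + th * (crd a 2 + dot (zpart a) (zpart a) / 2) - dot (zpart a) (zpart a *m L).
    by rewrite -E2 E3 addrK.
  by rewrite E2 thr -/al dotBr dotZr; field.
- by rewrite addrC subrK.
- by rewrite E4 thr -/al; ring.
Qed.
End NF.
End Normal_form.

(** * Normal forms as combinations of the listed fields *)

Section Basis.
Variable R : realType.
Local Notation C := R[i].
Local Notation N := (@ComplexField.Normc.normc R).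
Local Notation Re := (@complex.Re R).
Local Notation Im := (@complex.Im R).
Local Notation "x +i* y" := (Complex x y).
Local Notation II := (0 +i* 1 : C).

(** Groups the entries of a matrix as the listed fields do: pairs above and below the
   diagonal, then the diagonal. *)
Lemma sum_pairs (T : nmodType) m (G : 'I_m -> 'I_m -> T) :
  \sum_(r < m) \sum_(c < m) G r c =
  \sum_(r < m) \sum_(c < m | (r < c)%N) (G r c + G c r) + \sum_(r < m) G r r.
Proof.
have S (r : 'I_m) : \sum_c G r c = \sum_(c < m | (r < c)%N) G r c + (\sum_(c < m | (c < r)%N) G r c + G r r).
  rewrite (bigID (fun c : 'I_m => (r < c)%N)) /=; congr (_ + _).
  rewrite (bigD1 r) ?ltnn//= addrC; congr (_ + _); apply: eq_bigl => c.
  by rewrite -leqNgt ltn_neqAle andbC -(inj_eq val_inj).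
rewrite (eq_bigr _ (fun r _ => S r)) big_split big_split /= addrA; congr (_ + _).
rewrite [X in _ + X](exchange_big_dep xpredT) //= -big_split; apply: eq_bigr => r _.
by rewrite -big_split.
Qed.

Section Labels.
Variable m : nat.
Local Notation n := m.+2.
Local Notation V := 'rV[C]_n.+1.
Local Notation Z := 'rV[C]_m.

Lemma sum_nat_gt (T : nmodType) (F : nat -> T) (i : nat) :
  \sum_((i + 3).+1 <= k < n.+1) F k = \sum_(k < m | (i < k)%N) F (k + 3)%N.
Proof.
rewrite (big_nat_widenl _ 3) ?addn3//= big_mkcond /= sum_zpart [RHS]big_mkcond.
by apply: eq_bigr => k _; rewrite addn3 !ltnS.
Qed.

(** The kind and the indices of a field, which its position in the list hides. *)
Definition label := (nat * nat * nat)%type.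

Definition label_field (l : label) : V -> V :=
  match l.1.1 with
  | 0 => @Ydil R n | 1 => @Yrot R n l.1.2 l.2 | 2 => @Yherm R n l.1.2 l.2
  | 3 => @Ydiag R n l.1.2 | 4 => @Ypar R n | _ => @Ymoeb R n
  end%N.

Definition labels : seq label :=
  (0, 0, 0)%N
  :: [seq (1, j, k)%N | j <- index_iota 3 n.+1, k <- index_iota j.+1 n.+1]
  ++ [seq (2, j, k)%N | j <- index_iota 3 n.+1, k <- index_iota j.+1 n.+1]
  ++ [seq (3, j, 0)%N | j <- index_iota 3 n.+1]
  ++ [:: (4, 0, 0)%N; (5, 0, 0)%N].

Lemma isotropy_fields_labels : isotropy_fields R n = [seq label_field l | l <- labels].
Proof.
rewrite /isotropy_fields /labels map_cons !map_cat !map_allpairs -map_comp.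
by congr (_ :: _ ++ _ ++ _ ++ _).
Qed.

Lemma size_labels : size labels = (n ^ 2 + 7 - 4 * n)%N.
Proof.
have E k : (\sum_(i < k) i + \sum_(i < k) i)%N = (k * k.-1)%N.
  by elim: k => [|k IH]; rewrite ?big_ord0// big_ord_recr /=; case: k IH => [|k] /=; lia.
rewrite /labels /= !size_cat !size_allpairs_dep size_map !sumnE !big_map.
rewrite sum_zpart (eq_bigr (fun i : 'I_m => rev_ord i : nat)); last first.
  by move=> i _; rewrite size_iota /= addn3 !subSS.
rewrite (reindex_inj rev_ord_inj) /= (eq_bigr (fun i : 'I_m => i : nat)); last first.
  by move=> i _; rewrite -[RHS](congr1 val (rev_ordK i)).
rewrite size_iota /= addnA E; case: m => [//|k]; rewrite /= expnS expn1; nia.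
Qed.

Lemma uniq_labels : uniq labels.
Proof.
have P t : uniq [seq (t, j, k)%N | j <- index_iota 3 n.+1, k <- index_iota j.+1 n.+1].
  apply: allpairs_uniq_dep => [|j _|[j k] [j' k'] _ _ /= [-> ->]//]; exact: iota_uniq.
have T t (s : seq nat) (F : nat -> seq nat) (l : label) : l \in [seq (t, j, k)%N | j <- s, k <- F j] -> l.1.1 = t.
  by case/allpairsPdep => j [k [_ _ ->]].
have T3 (s : seq nat) (l : label) : l \in [seq (3, j, 0)%N | j <- s] -> l.1.1 = 3%N.
  by case/mapP => j _ ->.
rewrite /labels cons_uniq !cat_uniq !P /= map_inj_uniq ?iota_uniq; last by move=> i j [].
rewrite !mem_cat !negb_or !andbT /= -!andbA.
by do ![apply/andP; split]; try (by apply/negP => /T); try (by apply/negP => /T3);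
  apply/hasPn => l; rewrite !mem_cat => H; apply/negP => /T hl; move: H;
  do ?[case/orP => [/T|]]; do ?[case/orP => [/T3|]]; rewrite ?hl// !inE => /orP[]/eqP El; move: hl; rewrite El.
Qed.

(** Rotations contribute the real parts of the entries, the fields [Yherm] and [Ydiag] the
   imaginary parts. *)
Definition Hmat (f : label -> R) : 'M[C]_m := \matrix_(r, c)
  if (r < c)%N then (- f (1, r + 3, c + 3)%N) +i* f (2, r + 3, c + 3)%N
  else if (c < r)%N then f (1, c + 3, r + 3)%N +i* f (2, c + 3, r + 3)%N
  else 0 +i* f (3, r + 3, 0)%N.

Lemma skew_Hmat f : skew (Hmat f).
Proof.
move=> r c; rewrite !mxE; case: (ltngtP r c) => [||/val_inj->];
  by rewrite ?ltnn; move=> *; apply/eqP; rewrite eq_complex /= ?addNr ?subrr ?addr0 ?eqxx.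
Qed.

Lemma cartesian (a b : R) : (a +i* b) = (a%:C)%C + II * (b%:C)%C.
Proof. by cring. Qed.

Lemma sum_labels f (a : V) : \sum_(l <- labels) (f l)%:C%C *: label_field l a =
  nform (f (0, 0, 0)%N) (f (4, 0, 0)%N) (f (5, 0, 0)%N) (Hmat f) a.
Proof.
pose z := zpart a; pose H := Hmat f.
pose P r c : V := (z ord0 r * H r c) *: dd R n (c + 3) - (z ord0 r * H r c * z ord0 c) *: dd R n 2.
have crdz (r : 'I_m) : crd a (r + 3) = z ord0 r by rewrite mxE.
have PE : \sum_r \sum_c P r c = \sum_c (z *m H) ord0 c *: dd R n (c + 3) - dot z (z *m H) *: dd R n 2.
  rewrite (exchange_big_dep xpredT) //= /dot scaler_suml -sumrB; apply: eq_bigr => c _.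
  rewrite sumrB; congr (_ - _); rewrite -scaler_suml; congr (_ *: _).
    by rewrite mxE.
  by rewrite mulrC [(z *m H) _ _]mxE mulr_suml.
have -> : nform (f (0, 0, 0)%N) (f (4, 0, 0)%N) (f (5, 0, 0)%N) H a =
   (f (0, 0, 0)%N)%:C%C *: @Ydil R n a + (f (4, 0, 0)%N)%:C%C *: @Ypar R n a +
   (f (5, 0, 0)%N)%:C%C *: @Ymoeb R n a + \sum_r \sum_c P r c.
  rewrite PE /nform /mkV /Ydil sum_zpart.
  rewrite (eq_bigr (fun i : 'I_m => (f (0, 0, 0)%N)%:C%C *: (crd a (i + 3) *: dd R n (i + 3))
     + (z *m H) ord0 i *: dd R n (i + 3))); last first.
    by move=> i _; rewrite crdz !mxE scalerDl scalerA.
  rewrite big_split /= -scaler_sumr /Ypar /Ymoeb -/z.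
  set s1 := \sum_i _; set s2 := \sum_i _; set d := dot _ _.
  by apply/rowP => k; rewrite !mxE; ring.
have AC (x1 x2 x3 y1 y2 y3 : V) :
    x1 + (y1 + (y2 + (y3 + (x2 + (x3 + 0))))) = x1 + x2 + x3 + (y1 + y2 + y3).
  by apply/rowP => k; rewrite !mxE; ring.
rewrite big_cons !big_cat /= !big_allpairs_dep /= big_map !sum_zpart !big_cons big_nil AC sum_pairs.
congr (_ + (_ + _)).
  rewrite -big_split /=; apply: eq_bigr => r _; rewrite !sum_nat_gt -big_split /=.
  apply: eq_bigr => c rc; rewrite /label_field /= /Yrot /Yherm !crdz /P.
  have -> : H r c = - (f (1, r + 3, c + 3)%N)%:C%C + II * (f (2, r + 3, c + 3)%N)%:C%C.
    by rewrite /H /Hmat mxE rc cartesian rmorphN.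
  have -> : H c r = (f (1, r + 3, c + 3)%N)%:C%C + II * (f (2, r + 3, c + 3)%N)%:C%C.
    by rewrite /H /Hmat mxE ltnNge (ltnW rc) rc cartesian.
  move: (z ord0 r) (z ord0 c) (dd R n _) (dd R n _) (dd R n _) => zr zc d1 d2 d3.
  by apply/rowP => k; rewrite !mxE; ring.
apply: eq_bigr => r _; rewrite /label_field /= /Ydiag !crdz /P.
have -> : H r r = II * (f (3, r + 3, 0)%N)%:C%C.
  by rewrite /H /Hmat mxE ltnn cartesian rmorph0 add0r.
move: (z ord0 r) (dd R n _) (dd R n _) => zr d1 d2.
by apply/rowP => k; rewrite !mxE; ring.
Qed.

(** The coefficient attached to a label; triples that are not labels get the default 0. *)
Definition coef (N : nat) (c : 'I_N -> R) (l : label) : R := oapp c 0 (insub (index l labels)).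

Lemma isotropy_comb_nform (N : nat) (c : 'I_N -> R) (a : V) : N = size labels ->
  isotropy_comb c a = nform (coef c (0, 0, 0)%N) (coef c (4, 0, 0)%N) (coef c (5, 0, 0)%N) (Hmat (coef c)) a.
Proof.
move=> hN; rewrite -sum_labels (big_nth (0, 0, 0)%N) big_mkord -hN; apply: eq_bigr => i _.
rewrite /isotropy_field isotropy_fields_labels (nth_map (0, 0, 0)%N) -?hN//.
by rewrite /coef index_uniq -?hN ?uniq_labels// valK.
Qed.

Lemma coef_nth (N : nat) (f : label -> R) (l : label) : N = size labels -> l \in labels ->
  coef (fun i : 'I_N => f (nth (0, 0, 0)%N labels i)) l = f l.
Proof.
move=> hN hl; rewrite /coef; case: insubP => [i _ hi|]; last by rewrite hN index_mem hl.
by rewrite /= hi nth_index.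
Qed.

(** Reduces a statement on all labels to the indices of the normal form. *)
Lemma labels_mem (Q : label -> Prop) : (forall l, l \in labels -> Q l) <->
  [/\ Q (0, 0, 0)%N, Q (4, 0, 0)%N, Q (5, 0, 0)%N, forall i : 'I_m, Q (3, i + 3, 0)%N &
      forall i j : 'I_m, (i < j)%N -> Q (1, i + 3, j + 3)%N /\ Q (2, i + 3, j + 3)%N].
Proof.
have I3 (i : 'I_m) : (i + 3)%N \in index_iota 3 n.+1.
  by rewrite mem_index_iota addn3 /= !ltnS.
have I3' k : k \in index_iota 3 n.+1 -> exists i : 'I_m, k = (i + 3)%N.
  rewrite mem_index_iota => /andP[k3 kn].
  have hk : (k - 3 < m)%N by lia.
  by exists (Ordinal hk); rewrite /= subnK.
have Ij (i j : 'I_m) : (i < j)%N -> (j + 3)%N \in index_iota (i + 3).+1 n.+1.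
  by move=> ij; rewrite mem_index_iota !addn3 !ltnS ij ltn_ord.
split=> [H|[H0 H4 H5 H3 H12] l].
  split; try by apply: H; rewrite /labels !(inE, mem_cat) ?eqxx ?orbT.
    by move=> i; apply: H; rewrite /labels !(inE, mem_cat) map_f ?orbT.
  move=> i j ij; split; apply: H; rewrite /labels !(inE, mem_cat).
    by rewrite (@allpairs_f_dep _ _ _ (fun j k : nat => (1, j, k)%N)) ?orbT// Ij.
  by rewrite (@allpairs_f_dep _ _ _ (fun j k : nat => (2, j, k)%N)) ?orbT// Ij.
have J j k : j \in index_iota 3 n.+1 -> k \in index_iota j.+1 n.+1 ->
    exists i i' : 'I_m, [/\ (i < i')%N, j = (i + 3)%N & k = (i' + 3)%N].
  move=> /I3' [i ->]; rewrite mem_index_iota => /andP[ik kn].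
  have /I3' [i' ki] : k \in index_iota 3 n.+1 by rewrite mem_index_iota; lia.
  by exists i, i'; split=> //; lia.
rewrite /labels !(inE, mem_cat) => /or4P[/eqP->//| | |].
- by case/allpairsPdep => j [k [/J + /[swap] ->]] => /[apply] -[i [i' [/H12[] ? ? -> ->]]].
- by case/allpairsPdep => j [k [/J + /[swap] ->]] => /[apply] -[i [i' [/H12[] ? ? -> ->]]].
by rewrite /= => /orP[/mapP[j /I3'[i ->] ->]//|/orP[]/eqP ->].
Qed.

(** The coefficients are the real and imaginary parts of the entries of H on and above the
   diagonal, which determine a skew-Hermitian matrix. *)
Lemma isotropy_comb_surj (N : nat) (al p q : R) (H : 'M[C]_m) : N = size labels -> skew H ->
  exists c : 'I_N -> R, forall a, isotropy_comb c a = nform al p q H a.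
Proof.
move=> hN sH.
pose e (i j : nat) : C := oapp (fun i => oapp (H i) 0 (insub j : option 'I_m)) 0 (insub i : option 'I_m).
have eE (i j : 'I_m) : e i j = H i j by rewrite /e !valK.
pose f (l : label) : R := match l with
  | (0, _, _) => al | (4, _, _) => p | (5, _, _) => q
  | (1, i, j) => - Re (e (i - 3) (j - 3)) | (2, i, j) => Im (e (i - 3) (j - 3))
  | (_, i, _) => Im (e (i - 3) (i - 3)) end%N.
pose c (i : 'I_N) : R := f (nth (0, 0, 0)%N labels i).
exists c => a; rewrite isotropy_comb_nform//.
have /labels_mem [-> -> -> f3 f12] : forall l, l \in labels -> coef c l = f l.
  by move=> l hl; exact: coef_nth.
suff -> : Hmat (coef c) = H by [].
apply/matrixP => i j; rewrite mxE.
have hj := sH j i; have hi := sH i j.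
case: (ltngtP i j) => ij.
- by have [-> ->] := f12 _ _ ij; rewrite /f !addnK eE opprK; case: (H i j).
- have [-> ->] := f12 _ _ ij; rewrite /f !addnK eE; move: hi.
  by case: (H i j) (H j i) => x y [x' y'] /eqP; rewrite eq_complex /= => /andP[/eqP h1 /eqP h2]; congr (_ +i* _); lra.
- rewrite f3 /f !addnK eE; move: hj; rewrite -(val_inj ij).
  case: (H i i) => x y /eqP; rewrite eq_complex /= => /andP[/eqP h _].
  by have -> : x = 0 by lra.
Qed.

Lemma near_line (P : V -> Prop) (d : V) : (\forall a \near p0 R n, P a) ->
  exists2 t : R, 0 < t & P (p0 R n + t%:C%C *: d).
Proof.
move=> hP.
have c : (fun t : R => p0 R n + t%:C%C *: d) @ 0^' --> p0 R n + 0 *: d.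
  exact: (cvgD (cvg_cst (p0 R n)) (cvgZr_tmp (a := d) (@cvg_realC R))).
rewrite scale0r addr0 in c.
have /nbhs_ballP[e /= e0 he] : nbhs (0 : R) (fun t => t != 0 -> P (p0 R n + t%:C%C *: d)) := c _ hP.
exists (e / 2); first by rewrite divr_gt0.
apply: he; last by rewrite gt_eqF ?divr_gt0.
by rewrite -ball_normE /= sub0r normrN gtr0_norm ?divr_gt0//; lra.
Qed.

Lemma mkVD u w (z : Z) v u' w' (z' : Z) v' :
  mkV u w z v + mkV u' w' z' v' = mkV (u + u') (w + w') (z + z') (v + v') :> V.
Proof.
apply: crd_eq => [||i|]; rewrite [LHS]crdD.
- by rewrite !crd_mkV1.
- by rewrite !crd_mkV2.
- by rewrite !crd_mkVz mxE.
- by rewrite !crd_mkVn.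
Qed.

Lemma mkVZ k u w (z : Z) v : k *: mkV u w z v = mkV (k * u) (k * w) (k *: z) (k * v) :> V.
Proof.
apply: crd_eq => [||i|]; rewrite [LHS]crdZ.
- by rewrite !crd_mkV1.
- by rewrite !crd_mkV2.
- by rewrite !crd_mkVz mxE.
- by rewrite !crd_mkVn.
Qed.

(** Test points: u = 1 + t gives q and p; zeta along a coordinate axis gives al + H row by
   row, and al is its real diagonal. *)
Lemma nform0 (al p q : R) (H : 'M[C]_m) (k0 : 'I_m) : skew H ->
  (\forall a \near p0 R n, nform al p q H a = 0) -> [/\ al = 0, p = 0, q = 0 & H = 0].
Proof.
move=> sH h0.
have real0 (x : R) : (x%:C)%C = 0 -> x = 0 by case.
have p0E : p0 R n = mkV 1 0 0 0 by rewrite p0_Tm /Tm dot0l mul0r subrr.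
have [t t0 ht] := near_line (mkV 1 0 0 0) h0.
have E1 : p0 R n + t%:C%C *: mkV 1 0 (0 : Z) 0 = mkV (1 + t%:C%C) 0 0 0.
  by rewrite p0E mkVZ mkVD; apply: mkV_congr; rewrite ?mulr0 ?mulr1 ?scaler0 ?addr0.
have u0 : (1 + t%:C%C) ^+ 2 - 1 != 0 :> C.
  rewrite (_ : _ - 1 = ((t * (2 + t))%:C)%C); last by rewrite rmorphM rmorphD /= rmorph_nat; ring.
  by apply/eqP => /real0 /eqP; rewrite mulf_eq0 !gt_eqF// addr_gt0.
move: ht; rewrite E1 => ht.
have q0 : q = 0.
  apply/real0/eqP; have /eqP := congr1 (fun a => crd a 1) ht.
  rewrite crd_mkV1 crd_mkV1 crd0 !mulf_eq0 (negbTE u0) orbF (negbTE (II_neq0 R)) invr_eq0 pnatr_eq0 orbF.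
  by [].
have pz : p = 0.
  apply/real0/eqP; have /eqP := congr1 (fun a => crd a n.+1) ht.
  rewrite crd_mkVn !crd_mkVn crd_mkV1 crd0 !mulr0 add0r addr0 !mulf_eq0 (negbTE u0) orbF (negbTE (II_neq0 R)).
  by [].
have HE (i j : 'I_m) : al%:C%C * (i == j)%:R + H i j = 0.
  have {t t0 ht E1 u0} [t t0 ht] := near_line (mkV 0 0 (delta_mx ord0 i) 0) h0.
  have /eqP := congr1 (fun a => crd a (j + 3)) ht.
  have E2 : p0 R n + t%:C%C *: mkV 0 0 (delta_mx ord0 i : Z) 0 = mkV 1 0 (t%:C%C *: delta_mx ord0 i) 0.
    by rewrite p0E mkVZ mkVD; apply: mkV_congr; rewrite ?mulr0 ?addr0 ?add0r.
  have E3 : zpart (mkV 1 0 (t%:C%C *: delta_mx ord0 i : Z) 0) = t%:C%C *: delta_mx ord0 i.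
    by apply/rowP => k; rewrite mxE crd_mkVz.
  rewrite E2 crd_mkVz E3 crd0 -scalemxAl -rowE !mxE eqxx /= mulrCA -mulrDr mulf_eq0.
  case/orP => /eqP; first by move=> /real0 h; move: t0; rewrite h ltxx.
  by rewrite eq_sym.
have al0 : al = 0.
  have := HE k0 k0; have := sH k0 k0; rewrite eqxx mulr1; case: (H k0 k0) => x y.
  by move=> /eqP; rewrite eq_complex /= => /andP[/eqP h _] /eqP; rewrite eq_complex /= => /andP[/eqP h' _]; lra.
split=> //; apply/matrixP => i j; have := HE i j.
by rewrite al0 mul0r add0r mxE.
Qed.

Lemma isotropy_comb_inj (N : nat) (c : 'I_N -> R) (k0 : 'I_m) : N = size labels ->
  (\forall a \near p0 R n, isotropy_comb c a = 0) -> forall i, c i = 0.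
Proof.
move=> hN h0 i.
have [|al0 p0' q0 H0] := @nform0 (coef c (0, 0, 0)%N) (coef c (4, 0, 0)%N) (coef c (5, 0, 0)%N) (Hmat (coef c)) k0 (skew_Hmat _).
  by near=> a; rewrite -isotropy_comb_nform//; near: a.
have : forall l, l \in labels -> coef c l = 0.
  apply/labels_mem; split=> // [k|j k jk].
    by have := congr1 (fun M : 'M[C]_m => Im (M k k)) H0; rewrite !mxE ltnn.
  have := congr1 (fun M : 'M[C]_m => M j k) H0; rewrite !mxE jk => /eqP.
  by rewrite eq_complex /= oppr_eq0 => /andP[/eqP ? /eqP].
move=> /(_ (nth (0, 0, 0)%N labels i)); rewrite mem_nth -?hN// /coef index_uniq -?hN ?uniq_labels// valK.
by apply.
Unshelve. all: by end_near.
Qed.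
End Labels.
End Basis.

(** * Automorphisms of the hypersurface *)

Section Flows.
Variable R : realType.
Local Notation C := R[i].
Local Notation N := (@ComplexField.Normc.normc R).
Local Notation Re := (@complex.Re R).
Local Notation "x +i* y" := (Complex x y).
Local Notation II := (0 +i* 1 : C).
Section Flow.
Variable m : nat.
Local Notation n := m.+2.
Local Notation V := 'rV[C]_n.+1.
Local Notation Z := 'rV[C]_m.

Definition wcrd (a : V) : C := crd a 2 + dot (zpart a) (zpart a) / 2.

Lemma zpart_Tm u w (z : Z) v : zpart (Tm u w z v) = z.
Proof. by apply/rowP => i; rewrite mxE crd_mkVz. Qed.
Lemma wcrd_Tm u w (z : Z) v : wcrd (Tm u w z v) = w.
Proof. by rewrite /wcrd zpart_Tm crd_mkV2 subrK. Qed.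

(** In the coordinates (u, w, zeta, v), the composition of the linear map (w, zeta, v) ->
   (lam^2 w + 2 Q (u - 1), lam zeta M, lam^2 v + Q (u^2 - 1)) with the Moebius map u -> (u -
   B) / (1 - B u), extended to w and v. Automorphisms are obtained for lam real, M unitary,
   and Q and B imaginary, while the formula for the inverse is a rational identity in all four
   parameters. *)
Definition phi (lam Q B : C) (M : 'M[C]_m) (a : V) : V :=
  let u := crd a 1 in let w := wcrd a in let z := zpart a in let v := crd a n.+1 in
  let d := 1 - B * u in
  let w1 := lam ^+ 2 * w + 2 * Q * (u - 1) in
  let v1 := lam ^+ 2 * v + Q * (u ^+ 2 - 1) in
  Tm ((u - B) / d) (w1 + 2 * B * v1 / d) (lam *: (z *m M)) ((1 - B ^+ 2) * v1 / d ^+ 2).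

(** The inverse of [phi]: the Moebius map with - B, followed by the inverse of the linear map. *)
Definition psi (lam Q B : C) (M : 'M[C]_m) (a : V) : V :=
  let U := crd a 1 in let W := wcrd a in let z := zpart a in let V := crd a n.+1 in
  let d := 1 + B * U in
  let u := (U + B) / d in
  let w1 := W - 2 * B * V / d in
  let v1 := (1 - B ^+ 2) * V / d ^+ 2 in
  Tm u ((w1 - 2 * Q * (u - 1)) / lam ^+ 2) (lam^-1 *: (z *m M)) ((v1 - Q * (u ^+ 2 - 1)) / lam ^+ 2).

Lemma Tm_congr u w (z : Z) v u' w' (z' : Z) v' : u = u' -> w = w' -> z = z' -> v = v' ->
  Tm u w z v = Tm u' w' z' v'.
Proof. by move=> -> -> -> ->. Qed.

Lemma phiK (lam Q B : C) (M M' : 'M[C]_m) (a : V) : lam != 0 -> 1 - B ^+ 2 != 0 -> M *m M' = 1%:M ->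
  1 - B * crd a 1 != 0 -> psi lam Q B M' (phi lam Q B M a) = a.
Proof.
move=> l0 B0 MM d0; rewrite -[RHS]Tm_crd -/(wcrd a) /psi wcrd_Tm zpart_Tm crd_mkV1 crd_mkVn.
move: d0; set u := crd a 1; set w := wcrd a; set z := zpart a; set v := crd a n.+1 => d0.
have d1 : 1 + B * ((u - B) / (1 - B * u)) = (1 - B ^+ 2) / (1 - B * u) by field.
have E : ((u - B) / (1 - B * u) + B) / (1 + B * ((u - B) / (1 - B * u))) = u.
  by rewrite d1; field; rewrite d0 B0.
rewrite E d1; apply: Tm_congr => //.
- by field; rewrite d0 B0 l0.
- by rewrite -scalemxAl -mulmxA MM mulmx1 scalerA mulVf// scale1r.
- by field; rewrite d0 B0 l0.
Qed.

Lemma psiK (lam Q B : C) (M M' : 'M[C]_m) (a : V) : lam != 0 -> 1 - B ^+ 2 != 0 -> M' *m M = 1%:M ->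
  1 + B * crd a 1 != 0 -> phi lam Q B M (psi lam Q B M' a) = a.
Proof.
move=> l0 B0 MM d0; rewrite -[RHS]Tm_crd -/(wcrd a) /phi wcrd_Tm zpart_Tm crd_mkV1 crd_mkVn.
move: d0; set u := crd a 1; set w := wcrd a; set z := zpart a; set v := crd a n.+1 => d0.
have d1 : 1 - B * ((u + B) / (1 + B * u)) = (1 - B ^+ 2) / (1 + B * u) by field.
set U := (u + B) / (1 + B * u); rewrite d1.
have E : (U - B) / ((1 - B ^+ 2) / (1 + B * u)) = u.
  by rewrite /U; field; rewrite d0 B0.
have F (x y : C) : lam ^+ 2 * ((x - y) / lam ^+ 2) + y = x by field.
apply: Tm_congr => //.
- by rewrite F F; field; rewrite d0 B0.
- by rewrite -scalemxAl -mulmxA MM mulmx1 scalerA mulfV// scale1r.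
- by rewrite F; field; rewrite d0 B0.
Qed.

(** The denominators of [phi] and [psi] at corresponding points have product 1 - B^2. *)
Lemma phi_denom (lam Q B : C) (M : 'M[C]_m) (a : V) : 1 - B ^+ 2 != 0 ->
  1 - B * crd a 1 != 0 -> 1 + B * crd (phi lam Q B M a) 1 != 0.
Proof.
move=> B0 d0; rewrite crd_mkV1; move: d0; set u := crd a 1 => d0.
have -> : 1 + B * ((u - B) / (1 - B * u)) = (1 - B ^+ 2) / (1 - B * u) by field.
by rewrite mulf_neq0 // invr_neq0.
Qed.

Lemma phi_p0 (lam Q B : C) (M : 'M[C]_m) : 1 - B != 0 -> phi lam Q B M (p0 R n) = p0 R n.
Proof.
move=> B1; rewrite /phi p0_Tm wcrd_Tm zpart_Tm crd_mkV1 crd_mkVn mul0mx scaler0.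
by apply: Tm_congr => //; rewrite ?mulr1 ?expr1n ?subrr ?mulr0 ?addr0 ?mulr0 ?mul0r ?addr0// divff.
Qed.

Lemma Re_gt0 (u : C) : (0 < Re u) = (0 < u + u^*%C).
Proof. by rewrite addc_conj pmulr_rgt0 ?ltcR// ltr0n. Qed.

Lemma mul_conj (d : C) : d * d^*%C = ((N d ^+ 2)%:C)%C.
Proof. by case: d => x y; rewrite /= sqr_sqrtr ?addr_ge0 ?sqr_ge0//; cring. Qed.

Lemma mul_conj_gt0 (d : C) : d != 0 -> 0 < d * d^*%C.
Proof. by rewrite -normc_gt0 => h; rewrite mul_conj ltcR exprn_gt0. Qed.

Definition isom (M : 'M[C]_m) := forall z : Z, dot (z *m M) (conjz (z *m M)) = dot z (conjz z).

(** The linear part multiplies the defining equation by lam^2, and U + U^* = (1 - B^2) (u +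
   u^* ) / |1 - B u|^2 shows that the Moebius part preserves it as well. *)
Lemma phi_Gammat (lam P b : R) (M : 'M[C]_m) (a : V) : isom M ->
  1 - II * (b%:C)%C * crd a 1 != 0 -> Gammat a -> Gammat (phi (lam%:C)%C (II * (P%:C)%C) (II * (b%:C)%C) M a).
Proof.
move=> uM; rewrite -{2}[a]Tm_crd -/(wcrd a) Gammat_Tm /phi Gammat_Tm.
set u := crd a 1; set w := wcrd a; set z := zpart a; set v := crd a n.+1.
have c2 : (2 : C) != 0 by rewrite pnatr_eq0.
have B2 : 0 < 1 - (II * (b%:C)%C) ^+ 2.
  have -> : 1 - (II * (b%:C)%C) ^+ 2 = ((1 + b ^+ 2)%:C)%C by cring.
  by rewrite ltcR; have := sqr_ge0 b; lra.
set l := (lam%:C)%C; have lcj : l^*%C = l by rewrite conjc_real.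
set B := II * _; have Bc : B^*%C = - B by rewrite conjcM conjc_II conjc_real mulNr.
set Q := II * _; have Qc : Q^*%C = - Q by rewrite conjcM conjc_II conjc_real mulNr.
clearbody l Q; move: B2 Bc; rewrite -/B; move: B => B B2 Bc d0 [Hv].
have conjcV (x : C) : (x^-1)^*%C = (x^*%C)^-1 by rewrite conjc_inv.
have conjcX2 (x : C) : (x ^+ 2)^*%C = (x^*%C) ^+ 2 by rewrite rmorphXn.
rewrite !Re_gt0 => u0.
have d1 : 1 + B * u^*%C != 0.
  by have := d0; rewrite -conjc_eq0 conjcB conjcM conjc1 Bc mulNr opprK.
have cd : (1 - B * u)^*%C = 1 + B * u^*%C by rewrite conjcB conjcM conjc1 Bc mulNr opprK.
have cU : ((u - B) / (1 - B * u))^*%C = (u^*%C + B) / (1 + B * u^*%C).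
  by rewrite conjcM conjcV cd conjcB Bc opprK.
have cB2 : (1 - B ^+ 2)^*%C = 1 - B ^+ 2 by rewrite conjcB conjcX2 Bc sqrrN conjc1.
have Hl : dot (l *: (z *m M)) (conjz (l *: (z *m M))) = l ^+ 2 * dot z (conjz z).
  by rewrite conjzZ lcj dotZl dotZr uM mulrA.
rewrite Hl; move: (dot z (conjz z)) Hv => D Hv.
set v1 := l ^+ 2 * v + _; set w1 := l ^+ 2 * w + _.
have cV : ((1 - B ^+ 2) * v1 / (1 - B * u) ^+ 2)^*%C = (1 - B ^+ 2) * v1^*%C / (1 + B * u^*%C) ^+ 2.
  by rewrite conjcM conjcM conjcV conjcX2 cd cB2.
have cW : (w1 + 2 * B * v1 / (1 - B * u))^*%C = w1^*%C - 2 * B * v1^*%C / (1 + B * u^*%C).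
  by rewrite (conjcD w1) conjcM conjcM conjcM conjcV cd Bc conjc2 mulrN !mulNr.
have c1 : v1^*%C = l ^+ 2 * v^*%C - Q * ((u^*%C) ^+ 2 - 1).
  by rewrite /v1 conjcD !conjcM conjcB conjc1 !conjcM lcj Qc; ring.
have c2' : w1^*%C = l ^+ 2 * w^*%C - 2 * Q * (u^*%C - 1).
  by rewrite /w1 conjcD !conjcM conjcB conjc1 conjc2 lcj Qc; ring.
have H1 : 2 * (v1 + v1^*%C) = (u + u^*%C) * (w1 + w1^*%C + l ^+ 2 * D).
  by rewrite c1 c2' /v1 /w1; apply: (lc (lcM (l ^+ 2) Hv)); ring.
rewrite cV cW cU; have {}H1 : v1^*%C = (u + u^*%C) * (w1 + w1^*%C + l ^+ 2 * D) / 2 - v1.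
  by apply: (mulfI c2); apply: (lc H1); field.
rewrite H1; move: u0 d0 d1 cd; move: (u^*%C) (w1^*%C) => u' w' u0 d0 d1 cd; split; first by field; rewrite d0 d1.
have -> : (u - B) / (1 - B * u) + (u' + B) / (1 + B * u') = (1 - B ^+ 2) * (u + u') / ((1 - B * u) * (1 + B * u')).
  by field; rewrite d0 d1.
by apply: divr_gt0; [exact: mulr_gt0|rewrite -cd mul_conj_gt0].
Qed.

Lemma skew_dot (A : 'M[C]_m) (y : Z) : skew A -> dot y (conjz (y *m A)) + dot (y *m A) (conjz y) = 0.
Proof.
move=> sA.
have E1 : dot y (conjz (y *m A)) = \sum_i \sum_j y ord0 i * (y ord0 j)^*%C * (A j i)^*%C.
  rewrite /dot; apply: eq_bigr => i _; rewrite !mxE rmorph_sum mulr_sumr; apply: eq_bigr => j _.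
  by rewrite rmorphM mulrA.
have E2 : dot (y *m A) (conjz y) = \sum_i \sum_j y ord0 i * (y ord0 j)^*%C * A i j.
  rewrite /dot exchange_big; apply: eq_bigr => i _; rewrite !mxE mulr_suml; apply: eq_bigr => j _.
  by rewrite mulrAC.
rewrite E1 E2 -big_split big1//= => i _; rewrite -big_split big1//= => j _.
by rewrite -mulrDr addrC sA mulr0.
Qed.

Lemma dot_conj_eq0 (z : Z) : dot z (conjz z) = 0 -> z = 0.
Proof.
move=> h; apply/rowP => i; rewrite mxE; apply/eqP.
have ge0 (x : C) : 0 <= x * x^*%C.
  by case: (eqVneq x 0) => [->|x0]; [rewrite mul0r|exact/ltW/mul_conj_gt0].
have /eqP : \sum_j z ord0 j * (z ord0 j)^*%C = 0.
  by rewrite -[RHS]h /dot; apply: eq_bigr => j _; rewrite mxE.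
rewrite psumr_eq0 => [/allP /(_ i)|j _]; last exact: ge0.
by rewrite mem_index_enum mulf_eq0 conjc_eq0 orbb; apply.
Qed.

Lemma skewN (A : 'M[C]_m) : skew A -> skew (- A).
Proof. by move=> sA i j; rewrite !mxE conjcN -opprD sA oppr0. Qed.

Lemma skewZ (A : 'M[C]_m) (t : R) : skew A -> skew ((t%:C)%C *: A).
Proof. by move=> sA i j; rewrite !mxE conjcM conjc_real -mulrDr sA mulr0. Qed.

(** If y = y A then y is orthogonal to itself, because A is skew-Hermitian. *)
Lemma skew_unit (A : 'M[C]_m) : skew A -> (1%:M - A) \in unitmx.
Proof.
move=> sA; rewrite -row_free_unit; apply: inj_row_free => y.
rewrite mulmxBr mulmx1 => /eqP; rewrite subr_eq0 => /eqP yA.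
apply: dot_conj_eq0; have := skew_dot y sA; rewrite -yA => /eqP.
by rewrite -mulr2n mulrn_eq0 => /eqP.
Qed.

(** A rational substitute for the exponential of 2 A: unitary when A is skew-Hermitian. *)
Definition cayley (A : 'M[C]_m) : 'M[C]_m := invmx (1%:M - A) *m (1%:M + A).

Lemma cayley_inv (A : 'M[C]_m) : skew A ->
  cayley A *m cayley (- A) = 1%:M.
Proof.
move=> sA; rewrite /cayley opprK.
have u1 := skew_unit sA; have := skew_unit (skewN sA); rewrite opprK => u2.
by rewrite mulmxA (mulmxK u2) (mulVmx u1).
Qed.

(** With y = z (1 - A)^-1 the vectors y (1 + A) and y (1 - A) have the same norm. *)
Lemma cayley_isom (A : 'M[C]_m) : skew A -> isom (cayley A).
Proof.
move=> sA z; rewrite /cayley mulmxA; have u1 := skew_unit sA.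
have -> : z = z *m invmx (1%:M - A) *m (1%:M - A) by rewrite (mulmxKV u1).
move: (z *m _) => y; rewrite (mulmxK u1) mulmxDr mulmxBr mulmx1.
have conjzB (a b : Z) : conjz (a - b) = conjz a - conjz b.
  by apply/rowP => i; rewrite !mxE conjcB.
rewrite conjzD conjzB !(dotDl, dotDr).
have := skew_dot y sA; have -> : dot y (- conjz (y *m A)) = - dot y (conjz (y *m A)).
  by rewrite -scaleN1r dotZr mulN1r.
have dN (a b : Z) : dot (- a) b = - dot a b by rewrite -scaleN1r dotZl mulN1r.
have dNr (a b : Z) : dot a (- b) = - dot a b by rewrite -scaleN1r dotZr mulN1r.
rewrite !dN dNr; move: (dot _ _) (dot _ _) (dot _ _) (dot _ _) => p1 p2 p3 p4 h.
by apply: (lc (lcM 2 h)); ring.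
Qed.

Lemma le_normc_sum (I : Type) (r : seq I) (P : pred I) (F : I -> C) :
  N (\sum_(i <- r | P i) F i) <= \sum_(i <- r | P i) N (F i).
Proof.
apply: (big_ind2 (fun x y => N x <= y)); first by rewrite normc00.
  by move=> x1 x2 y1 y2 h1 h2; apply: le_trans (le_normcD _ _) (lerD h1 h2).
by [].
Qed.

Lemma isom_entry (M : 'M[C]_m) i j : isom M -> N (M i j) <= 1.
Proof.
move=> uM; have := uM (delta_mx ord0 i); rewrite -rowE.
have -> : dot (delta_mx ord0 i : Z) (conjz (delta_mx ord0 i : Z)) = 1.
  by rewrite dotC dot_delta !mxE !eqxx conjc1.
have -> : dot (row i M) (conjz (row i M)) = ((\sum_k N (M i k) ^+ 2)%:C)%C.
  by rewrite rmorph_sum; apply: eq_bigr => k _; rewrite !mxE mul_conj.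
move=> [h]; have {}h : \sum_k N (M i k) ^+ 2 = 1 :> R by exact: h.
rewrite -(@expr_le1 _ 2) ?normc_ge0// -h (bigD1 j)//= lerDl.
by apply: sumr_ge0 => k _; rewrite sqr_ge0.
Qed.

(** The slope (cayley (t H / 2) - 1) / t, written so that it makes sense at t = 0. *)
Definition dcayley (H : 'M[C]_m) (t : R) : 'M[C]_m :=
  2^-1 *: ((cayley (((t / 2)%:C)%C *: H) + 1%:M) *m H).

Lemma cayleyE (H : 'M[C]_m) (t : R) : skew H ->
  cayley (((t / 2)%:C)%C *: H) = 1%:M + (t%:C)%C *: dcayley H t.
Proof.
move=> sH; have := skew_unit (skewZ (t / 2) sH); rewrite /dcayley /cayley.
have -> : ((t / 2)%:C)%C = (t%:C)%C / 2 by rewrite rmorphM fmorphV rmorph_nat.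
set A := _ *: H => u1; set W := invmx (1%:M - A).
have W1 : W *m (1%:M - A) = 1%:M by exact: mulVmx.
have tA : (t%:C)%C *: (2^-1 *: ((W *m (1%:M + A) + 1%:M) *m H)) = (W *m (1%:M + A) + 1%:M) *m A.
  by rewrite scalerA -scalemxAr.
rewrite tA; set X := W *m (1%:M + A).
have X1 : X - X *m A = 1%:M + A.
  have <- : X *m (1%:M - A) = X - X *m A by rewrite mulmxBr mulmx1.
  rewrite /X -mulmxA.
  have -> : (1%:M + A) *m (1%:M - A) = (1%:M - A) *m (1%:M + A).
    by rewrite mulmxDl mulmxBl !(mulmxBr, mulmxDr) !mul1mx !mulmx1 opprD !addrA addrK subrK.
  by rewrite mulmxA W1 mul1mx.
by rewrite mulmxDl mul1mx addrCA addrC -X1 subrK.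
Qed.

(** The Cayley transform is bounded because it is unitary, and the difference is t / 4 times
   (cayley + 1) H H. *)
Lemma dcayley_cvg (H : 'M[C]_m) : skew H ->
  exists2 K : R, 0 <= K & forall t i j, N (dcayley H t i j - H i j) <= `|t| * K.
Proof.
move=> sH.
pose h := \sum_i \sum_j N (H i j).
have h0 : 0 <= h by apply: sumr_ge0 => i _; apply: sumr_ge0 => j _; rewrite normc_ge0.
have hE i j : N (H i j) <= h.
  rewrite /h (bigD1 i)//= (bigD1 j)//= -addrA lerDl addr_ge0//; apply: sumr_ge0 => k _ //;
    first by rewrite normc_ge0.
  by apply: sumr_ge0 => l _; rewrite normc_ge0.
have bound (A B : 'M[C]_m) (x y : R) : 0 <= x -> (forall i j, N (A i j) <= x) -> (forall i j, N (B i j) <= y) ->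
    forall i j, N ((A *m B) i j) <= m%:R * (x * y).
  move=> x0 hA hB i j; rewrite mxE; apply: le_trans (le_normc_sum _ _ _) _.
  have -> : m%:R * (x * y) = \sum_(k < m) x * y by rewrite sumr_const card_ord mulr_natl.
  apply: ler_sum => k _.
  by rewrite normcM ler_pM ?normc_ge0.
pose K := 4^-1 * (m%:R * (m%:R * (2 * h) * h)).
exists K; first by rewrite !mulr_ge0.
move=> t i j; have E := cayleyE t sH.
set M := cayley _ in E.
have DH : dcayley H t - H = ((t / 4)%:C)%C *: ((M + 1%:M) *m H *m H).
  have n2 : (2 : C) != 0 by rewrite pnatr_eq0.
  have e2 : 2 *: dcayley H t = (M + 1%:M) *m H by rewrite scalerA mulfV// scale1r.
  have e3 : ((t / 4)%:C)%C * 2 = (t%:C)%C / 2 by rewrite rmorphM fmorphV rmorph_nat; field.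
  rewrite -e2 -scalemxAl scalerA e3; apply: (scalerI n2).
  rewrite scalerBr e2 E mulmxDl mulmxDl mul1mx -scalemxAl scaler_nat mulr2n opprD.
  rewrite scalerA mulrCA mulfV// mulr1.
  by rewrite addrACA -addrA subrr addr0 addrAC subrr add0r.
have -> : dcayley H t i j - H i j = (dcayley H t - H) i j by rewrite !mxE.
have Mb k l : N ((M + 1%:M) k l) <= 2.
  rewrite mxE; apply: le_trans (le_normcD _ _) _.
  have -> : (2 : R) = 1 + 1 by ring.
  apply: lerD; first by apply: isom_entry; exact: cayley_isom (skewZ _ sH).
  by rewrite mxE; case: eqP => _; rewrite ?normc00 ?(normc_real 1) ?normr1.
have n4 : (4 : R) != 0 by rewrite pnatr_eq0.
rewrite DH mxE normcM normc_real normrM [`|4^-1|]gtr0_norm ?invr_gt0 ?ltr0n// -mulrA.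
apply: ler_wpM2l => //; rewrite ler_wpM2l ?invr_ge0//.
have h2 : 0 <= m%:R * (2 * h) by rewrite !mulr_ge0.
exact: (bound _ _ _ _ h2 (bound _ _ _ _ (ler0n R 2) Mb hE) hE).
Qed.
End Flow.
End Flows.

(** * Families of functions with a limit in all derivatives *)

Section Families.
Variable R : realType.
Local Notation C := R[i].
Local Notation N := (@ComplexField.Normc.normc R).

Section Scalar.
Variable p : nat.
Local Notation V := 'rV[C]_p.+1.

Lemma derive_addC (f g : V -> C) (a v : V) : differentiable f a -> differentiable g a ->
  'D_v (fun x => f x + g x) a = 'D_v f a + 'D_v g a.
Proof. by move=> df dg; exact: (deriveD (diff_derivable df) (diff_derivable dg)). Qed.

Lemma derive_mulC (f g : V -> C) (a v : V) : differentiable f a -> differentiable g a ->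
  'D_v (fun x => f x * g x) a = f a * 'D_v g a + g a * 'D_v f a.
Proof. by move=> df dg; exact: (deriveM (diff_derivable df) (diff_derivable dg)). Qed.

Lemma derive_invC (f : V -> C) (a v : V) : f a != 0 -> differentiable f a ->
  'D_v (fun x => (f x)^-1) a = - (f a) ^- 2 * 'D_v f a.
Proof. by move=> f0 df; exact: (deriveV f0 (diff_derivable df)). Qed.

Lemma derive_coordC (k : 'I_p.+1) (a v : V) : 'D_v (fun x : V => x ord0 k) a = v ord0 k.
Proof.
apply: lim_near_cst => //; near=> h.
by rewrite /= !mxE addrK /GRing.scale /= mulKf//; near: h; exact: nbhs_dnbhs_neq.
Unshelve. all: by end_near.
Qed.

Lemma differentiable_addC (f g : V -> C) (a : V) : differentiable f a -> differentiable g a ->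
  differentiable (fun x => f x + g x) a.
Proof. by move=> df dg; exact: (differentiableD df dg). Qed.

Lemma differentiable_mulC (f g : V -> C) (a : V) : differentiable f a -> differentiable g a ->
  differentiable (fun x => f x * g x) a.
Proof. by move=> df dg; exact: (differentiableM df dg). Qed.

Lemma derive_row q (F : V -> 'rV[C]_q.+1) (a v : V) k : differentiable F a ->
  ('D_v F a) ord0 k = 'D_v (fun x => F x ord0 k) a.
Proof.
move=> /(@diff_derivable _ _ _ _ _ v)/cvg_ex[l hl]; rewrite /derive (cvg_lim _ hl)//.
apply/esym/cvg_lim => //.
have := cvg_comp _ _ hl (@coord_continuous _ _ _ ord0 k l).
apply: cvg_trans; apply: near_eq_cvg; near=> h; by rewrite /= !mxE.
Unshelve. all: by end_near.
Qed.

Section Tame.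
Variables (U : set V) (e : R) (B : R -> C).
Hypothesis e0 : 0 < e.
Hypothesis Ubound : forall a, U a -> forall k, N (a ord0 k) <= 2.

Definition conv0 (c : R -> C) := forall eps : R, 0 < eps ->
  exists2 d : R, 0 < d & forall t, `|t| < d -> N (c t - c 0) <= eps.

Hypothesis Bconv : conv0 B.
Hypothesis Blow : forall t a, `|t| < e -> U a -> 2^-1 <= N (1 - B t * a ord0 (inord 0)).

(** Families indexed by t that are built from the coordinates, from parameters continuous at t
   = 0 and from one denominator. Being generated by operations that are compatible with
   differentiation, they give all derivatives at once, by induction. *)
Inductive tame : (R -> V -> C) -> Prop :=
| tame_par c : conv0 c -> tame (fun t _ => c t)
| tame_coord k : tame (fun _ a => a ord0 k)
| tame_add f g : tame f -> tame g -> tame (fun t a => f t a + g t a)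
| tame_mul f g : tame f -> tame g -> tame (fun t a => f t a * g t a)
| tame_inv : tame (fun t a => (1 - B t * a ord0 (inord 0))^-1).

Lemma conv0_cst (c : C) : conv0 (fun=> c).
Proof. by move=> eps eps0; exists 1 => // t _; rewrite subrr normc00 ltW. Qed.

(** The denominator is bounded away from 0 uniformly, which is also what makes its inverse
   converge uniformly. *)
Lemma denom_neq0 t a : `|t| < e -> U a -> 1 - B t * a ord0 (inord 0) != 0.
Proof.
move=> te Ua; rewrite -normc_gt0; apply: lt_le_trans (Blow te Ua).
by rewrite invr_gt0.
Qed.

Lemma denom_diff t (a : V) : differentiable (fun x : V => 1 - B t * x ord0 (inord 0)) a.
Proof.
apply: (@differentiable_addC (fun=> 1)); first exact: differentiable_cst.
rewrite (_ : (fun x : V => _) = (fun x => (- B t) * x ord0 (inord 0))); last first.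
  by apply/funext => x; rewrite mulNr.
apply: (@differentiable_mulC (fun=> _)); first exact: differentiable_cst.
exact: differentiable_coord.
Qed.

Lemma tame_diff f : tame f -> forall t (a : V), 1 - B t * a ord0 (inord 0) != 0 -> differentiable (f t) a.
Proof.
elim=> [c _|k|f1 f2 _ h1 _ h2|f1 f2 _ h1 _ h2|] t a d0.
- exact: differentiable_cst.
- exact: differentiable_coord.
- by apply: differentiable_addC; [exact: h1|exact: h2].
- by apply: differentiable_mulC; [exact: h1|exact: h2].
- exact: (differentiableV (denom_diff t a) d0).
Qed.

(** The derivatives of 1 / (1 - B u) are multiples of its square, so the class is stable. *)
Lemma tame_derive f j : tame f -> exists2 g, tame g &
  forall t a, `|t| < e -> U a -> 'D_(delta_mx ord0 j) (f t) a = g t a.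
Proof.
elim=> [c _|k|f1 f2 t1 [g1 h1 E1] t2 [g2 h2 E2]|f1 f2 t1 [g1 h1 E1] t2 [g2 h2 E2]|].
- exists (fun _ _ => 0); first exact: tame_par (conv0_cst _).
  by move=> t a _ _; exact: derive_cst.
- exists (fun _ _ => (delta_mx ord0 j : V) ord0 k); first exact: tame_par (conv0_cst _).
  by move=> t a _ _; rewrite derive_coordC.
- exists (fun t a => g1 t a + g2 t a); first exact: tame_add.
  by move=> t a te Ua; rewrite derive_addC ?E1 ?E2//; apply: tame_diff => //; exact: denom_neq0.
- exists (fun t a => f1 t a * g2 t a + f2 t a * g1 t a).
    by apply: tame_add; apply: tame_mul.
  by move=> t a te Ua; rewrite derive_mulC ?E1 ?E2//; apply: tame_diff => //; exact: denom_neq0.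
- pose I (t : R) (a : V) : C := (1 - B t * a ord0 (inord 0))^-1.
  have tI : tame I by exact: tame_inv.
  exists (fun t a => (I t a * I t a) * (B t * (delta_mx ord0 j : V) ord0 (inord 0))).
    apply: tame_mul; first exact: tame_mul.
    by apply: tame_mul; [exact: tame_par|exact: tame_par (conv0_cst _)].
  move=> t a te Ua; rewrite derive_invC; [|exact: denom_neq0|exact: denom_diff].
  have -> : 'D_(delta_mx ord0 j) (fun x : V => 1 - B t * x ord0 (inord 0)) a =
     - (B t * (delta_mx ord0 j : V) ord0 (inord 0)).
    have -> : (fun x : V => 1 - B t * x ord0 (inord 0)) = (fun x => 1 + (- B t) * x ord0 (inord 0)).
      by apply/funext => x; rewrite mulNr.
    rewrite (@derive_addC (fun=> 1)); [|exact: differentiable_cst|]; last first.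
      by apply: (@differentiable_mulC (fun=> _)); [exact: differentiable_cst|exact: differentiable_coord].
    rewrite (@derive_mulC (fun=> _)); [|exact: differentiable_cst|exact: differentiable_coord].
    by rewrite !derive_cst derive_coordC mulr0 addr0 add0r mulNr.
  by rewrite mulNr mulrN opprK /I -invfM expr2.
Qed.

Lemma tame_ext f g : (forall t a, g t a = f t a) -> tame f -> tame g.
Proof. by move=> fg; rewrite (_ : g = f)//; apply/funext => t; apply/funext => a. Qed.

Lemma tame_cst (c : C) : tame (fun _ _ => c).
Proof. exact: tame_par (conv0_cst c). Qed.

Lemma tame_sub f g : tame f -> tame g -> tame (fun t a => f t a - g t a).
Proof.
move=> tf tg; apply: (@tame_ext (fun t a => f t a + (-1) * g t a)).
  by move=> t a; rewrite mulN1r.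
by apply: tame_add => //; apply: tame_mul => //; exact: tame_cst.
Qed.

Lemma tame_sum q (f : 'I_q -> R -> V -> C) : (forall i, tame (f i)) -> tame (fun t a => \sum_i f i t a).
Proof.
move=> tf; apply: (@tame_ext (\sum_i f i)).
  by move=> t a; rewrite !fct_sumE.
by apply: big_ind => [||i _]; [exact: tame_cst|exact: tame_add|exact: tf].
Qed.

Lemma tame_time : tame (fun t _ => (t%:C)%C).
Proof.
apply: tame_par => eps eps0; exists eps => // t te.
by rewrite rmorph0 subr0 normc_real ltW.
Qed.

Lemma tame_bound f : tame f -> exists2 K : R, 0 < K & forall a, U a -> N (f 0 a) <= K.
Proof.
have z0 : `|0 : R| < e by rewrite normr0.
elim=> [c _|k|f1 f2 _ [K1 K10 h1] _ [K2 K20 h2]|f1 f2 _ [K1 K10 h1] _ [K2 K20 h2]|].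
- by exists (N (c 0) + 1) => [|a _]; [rewrite ltr_wpDl ?normc_ge0|rewrite lerDl].
- by exists 2 => // a Ua; exact: Ubound.
- exists (K1 + K2); first exact: addr_gt0.
  by move=> a Ua; apply: le_trans (le_normcD _ _) (lerD (h1 a Ua) (h2 a Ua)).
- exists (K1 * K2); first exact: mulr_gt0.
  by move=> a Ua; rewrite normcM ler_pM ?normc_ge0 ?h1 ?h2.
- exists 2 => // a Ua; rewrite ComplexField.Normc.normcV -[2]invrK lef_pV2 ?posrE ?invr_gt0//.
    exact: Blow.
  by rewrite normc_gt0 denom_neq0.
Qed.

(** Uniform convergence on U; products use the boundedness of the limits on U. *)
Lemma tame_unif f : tame f -> forall eps : R, 0 < eps ->
  exists2 d : R, 0 < d & forall t a, `|t| < d -> U a -> N (f t a - f 0 a) <= eps.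
Proof.
have z0 : `|0 : R| < e by rewrite normr0.
elim=> [c hc|k|f1 f2 _ h1 _ h2|f1 f2 t1 h1 t2 h2|] eps eps0.
- by have [d d0 hd] := hc _ eps0; exists d => // t a td _; exact: hd.
- by exists 1 => // t a _ _; rewrite subrr normc00 ltW.
- have eps2 : 0 < eps / 2 by rewrite divr_gt0.
  have [d1 d10 hd1] := h1 _ eps2; have [d2 d20 hd2] := h2 _ eps2.
  exists (Num.min d1 d2); first by rewrite lt_min d10.
  move=> t a; rewrite lt_min => /andP[td1 td2] Ua; rewrite opprD addrACA.
  by apply: le_trans (le_normcD _ _) _; rewrite [eps]splitr lerD ?hd1 ?hd2.
- have [K1 K10 b1] := tame_bound t1; have [K2 K20 b2] := tame_bound t2.
  pose eps1 := eps / (2 * K2); pose eps2 := eps / (2 * (K1 + eps1)).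
  have e10 : 0 < eps1 by rewrite divr_gt0 ?mulr_gt0.
  have e20 : 0 < eps2 by rewrite divr_gt0 ?mulr_gt0 ?addr_gt0.
  have [d1 d10 hd1] := h1 _ e10; have [d2 d20 hd2] := h2 _ e20.
  exists (Num.min d1 d2); first by rewrite lt_min d10.
  move=> t a; rewrite lt_min => /andP[td1 td2] Ua.
  have -> : f1 t a * f2 t a - f1 0 a * f2 0 a =
     f1 t a * (f2 t a - f2 0 a) + (f1 t a - f1 0 a) * f2 0 a by ring.
  apply: le_trans (le_normcD _ _) _; rewrite !normcM.
  have n1 : N (f1 t a) <= K1 + eps1.
    rewrite -[f1 t a](subrK (f1 0 a)) addrC; apply: le_trans (le_normcD _ _) _.
    by rewrite lerD ?b1 ?hd1.
  have E1 : (K1 + eps1) * eps2 = eps / 2.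
    by rewrite /eps2 invfM mulrCA mulrA mulrAC [_^-1 * _]mulrC; field; rewrite gt_eqF// addr_gt0.
  have E2 : eps1 * K2 = eps / 2 by rewrite /eps1; field; rewrite gt_eqF.
  rewrite [eps]splitr -{1}E1 -E2; apply: lerD; apply: ler_pM; rewrite ?normc_ge0 ?n1 ?hd1 ?hd2 ?b2//.
- have [d d0 hd] := Bconv (divr_gt0 eps0 (ltr0n R 8 : 0 < 8%:R)).
  exists (Num.min d e); first by rewrite lt_min d0.
  move=> t a; rewrite lt_min => /andP[td te] Ua.
  have n1 := denom_neq0 te Ua; have n2 := denom_neq0 z0 Ua.
  have := Blow te Ua; have := Blow z0 Ua.
  have hN (x : C) : x != 0 -> 2^-1 <= N x -> N x^-1 <= 2.
    move=> x0 hx; rewrite ComplexField.Normc.normcV -[2]invrK lef_pV2 ?posrE ?invr_gt0//.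
    by rewrite normc_gt0.
  have -> : (1 - B t * a ord0 (inord 0))^-1 - (1 - B 0 * a ord0 (inord 0))^-1 =
    (B t - B 0) * a ord0 (inord 0) * ((1 - B t * a ord0 (inord 0))^-1 * (1 - B 0 * a ord0 (inord 0))^-1).
    by field; rewrite n1 n2.
  move=> /(hN _ n2) h2 /(hN _ n1) h1; rewrite !normcM.
  have hB := hd _ td; have ha := Ubound Ua (inord 0).
  have -> : eps = eps / 8 * 2 * (2 * 2) by field.
  by rewrite ler_pM ?ler_pM ?mulr_ge0 ?normc_ge0.
Qed.

End Tame.
End Scalar.
End Families.

(** * Velocities of tame curves *)

Section Velocity.
Variable R : realType.
Local Notation C := R[i].
Local Notation N := (@ComplexField.Normc.normc R).
Local Notation Re := (@complex.Re R).

Section Conv.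
Variable p : nat.
Local Notation V := 'rV[C]_p.+1.

Lemma pderiv_eq (U : set V) (F G : V -> V) s : open U -> (forall a, U a -> F a = G a) ->
  forall a, U a -> pderiv s F a = pderiv s G a.
Proof.
move=> oU FG; elim: s => [|j s IH] a Ua; first exact: FG.
rewrite /=; apply: near_eq_derive.
by move: oU; rewrite openE => /(_ _ Ua); apply: filterS => b; exact: IH.
Qed.

Section Tame.
Variables (U : set V) (e : R) (B : R -> C).
Hypothesis e0 : 0 < e.
Hypothesis oU : open U.
Hypothesis Ubound : forall a, U a -> forall k, N (a ord0 k) <= 2.
Hypothesis Bconv : conv0 B.
Hypothesis Blow : forall t a, `|t| < e -> U a -> 2^-1 <= N (1 - B t * a ord0 (inord 0)).

Definition tame_rows (G : R -> V -> V) := forall k, tame B (fun t a => G t a ord0 k).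

Lemma tame_rows_diff G : tame_rows G -> forall t (a : V), 1 - B t * a ord0 (inord 0) != 0 -> differentiable (G t) a.
Proof.
move=> tG t a d0; apply: differentiable_row => k.
exact: (tame_diff (tG k) d0).
Qed.

Lemma tame_pderiv s G : tame_rows G -> exists2 G', tame_rows G' &
  forall t a, `|t| < e -> U a -> pderiv s (G t) a = G' t a.
Proof.
move=> tG; elim: s => [|j s [G1 t1 E1]]; first by exists G.
have /choice[g hg] : forall k, exists g, tame B g /\
    forall t a, `|t| < e -> U a -> 'D_(delta_mx ord0 j) (fun x => G1 t x ord0 k) a = g t a.
  by move=> k; have [g tg Eg] := tame_derive Bconv Blow j (t1 k); exists g.
exists (fun t a => \row_k g k t a).
  move=> k; rewrite (_ : (fun t a => _) = g k); first by case: (hg k).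
  by apply/funext => t; apply/funext => a; rewrite mxE.
move=> t a te Ua /=.
rewrite (_ : 'D_(delta_mx ord0 j) _ a = 'D_(delta_mx ord0 j) (G1 t) a); last first.
  apply: near_eq_derive.
  by move: oU; rewrite openE => /(_ _ Ua); apply: filterS => b Ub; exact: E1.
apply/rowP => k; rewrite mxE derive_row; last exact: tame_rows_diff t1 _ _ (denom_neq0 Blow te Ua).
by have [_ ->] := hg k.
Qed.

Lemma tame_rows_unif G : tame_rows G -> forall eps : R, 0 < eps ->
  exists2 d : R, 0 < d & forall t a, `|t| < d -> U a -> forall k, N ((G t a - G 0 a) ord0 k) <= eps.
Proof.
move=> tG eps eps0.
have /choice[d hd] : forall k, exists d : R, 0 < d /\ forall t a, `|t| < d -> U a -> N (G t a ord0 k - G 0 a ord0 k) <= eps.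
  by move=> k; have [d d0 hd] := tame_unif e0 Ubound Bconv Blow (tG k) eps0; exists d.
exists (\big[Num.min/1]_k d k).
  by apply/bigmin_gtP; split=> // k _; case: (hd k).
move=> t a /bigmin_gtP[_ h] Ua k; rewrite !mxE.
by have [_] := hd k; apply => //; apply: h.
Qed.

(** On U the difference quotient of f is the tame family G for t different from 0, and X is
   its value at 0. *)
Lemma tame_velocity (G : R -> V -> V) (f : R -> V -> V) (X : V -> V) : tame_rows G ->
  (forall t a, `|t| < e -> U a -> f t a = a + (t%:C)%C *: G t a) ->
  (forall a, U a -> X a = G 0 a) ->
  forall s : seq 'I_p.+1, {family compactly_in U,
    (fun t : R => pderiv s (fun z => ((t^-1)%:C)%C *: (f t z - z))) @ 0^' --> pderiv s X}.
Proof.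
move=> tG fE XE s; apply/fam_cvgP => A [AU _].
have [G' tG' E] := tame_pderiv s tG.
move=> P /uniform_nbhs[W [eW hW]].
have [r /= r0 hr] : entourage_ (@ball C V) W by rewrite entourage_ballE.
have [rE rp] := gt0_cplx r0.
have r2 : 0 < Re r / 2 by rewrite divr_gt0.
have [d d0 hd] := tame_rows_unif tG' r2.
near=> t.
have t0 : t != 0 by near: t; exact: nbhs_dnbhs_neq.
have /andP[td te] : (`|t| < d) && (`|t| < e).
  near: t; apply/nbhs_ballP; exists (Num.min d e) => /=; first by rewrite lt_min d0.
  by move=> t; rewrite -ball_normE /= sub0r normrN lt_min.
apply: hW => a /AU Ua; apply: hr => /=.
have -> : pderiv s (fun z => ((t^-1)%:C)%C *: (f t z - z)) a = G' t a.
  rewrite -E//; apply: (pderiv_eq s oU) => // b Ub.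
  by rewrite fE// addrC addKr scalerA -rmorphM mulVf// scale1r.
have -> : pderiv s X a = G' 0 a.
  by rewrite -E ?normr0//; apply: (pderiv_eq s oU).
have rC : 0 < (Re r)%:C%C :> C by rewrite -rE.
rewrite rE; split=> // i j; rewrite (ord1 i) -ball_normE /= norm_normc ltcR normcB.
have := hd _ _ td Ua j; rewrite !mxE => h; apply: le_lt_trans h _; lra.
Unshelve. all: by end_near.
Qed.

End Tame.
End Conv.
End Velocity.

(** * Curves of automorphisms with prescribed velocity *)

Section Curves.
Variable R : realType.
Local Notation C := R[i].
Local Notation N := (@ComplexField.Normc.normc R).
Local Notation "x +i* y" := (Complex x y).
Local Notation II := (0 +i* 1 : C).

(** Elements of the isotropy algebra are prescribed near p0 only, so differentiability has to
   be transferred between functions that agree near a point. *)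
Lemma near_eq_differentiable p (F G : 'rV[C]_p.+1 -> 'rV[C]_p.+1) (a : 'rV[C]_p.+1) :
  (\forall x \near a, F x = G x) -> differentiable G a -> differentiable F a.
Proof.
move=> FG dG; have Fa : F a = G a := nbhs_singleton FG.
have E : F \o shift a = cst (F a) + 'd G a +o_ (0 : 'rV[C]_p.+1) id.
  have /eqaddoP H : G \o shift a = cst (G a) + 'd G a +o_ (0 : 'rV[C]_p.+1) id.
    by apply/funext => h; have := diff_locally dG; rewrite funeqE => ->.
  apply/eqaddoP => eps eps0; rewrite Fa.
  have FGs : \forall h \near (0 : 'rV[C]_p.+1), F (h + a) = G (h + a).
    have : (fun h : 'rV[C]_p.+1 => h + a) @ (0 : 'rV[C]_p.+1) --> 0 + a by exact: (cvgD cvg_id (cvg_cst a)).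
    by rewrite add0r => c; exact: (c _ FG).
  move: (H _ eps0) FGs => Hn FGs; near=> h.
  have -> : (F \o shift a - (cst (G a) + 'd G a)) h = (G \o shift a - (cst (G a) + 'd G a)) h.
    have e : F (h + a) = G (h + a) by near: h; exact: FGs.
    by change (F (h + a) - (cst (G a) + 'd G a) h = G (h + a) - (cst (G a) + 'd G a) h); rewrite e.
  near: h; exact: Hn.
have cd : continuous ('d G a) by exact: diff_continuous.
apply/diff_locallyP; rewrite (diff_unique cd E); split=> //.
Unshelve. all: by end_near.
Qed.

Section Curve.
Variable m : nat.
Local Notation n := m.+2.
Local Notation V := 'rV[C]_n.+1.
Local Notation Z := 'rV[C]_m.

Section Rows.
Variable B : R -> C.
Local Notation tame := (@tame R n B).

Lemma tame_crd j : tame (fun _ a => crd a j).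
Proof. exact: tame_coord. Qed.

Lemma tame_zpart i : tame (fun _ a => zpart a ord0 i).
Proof. by apply: tame_ext (tame_crd (i + 3)) => t a; rewrite mxE. Qed.

Lemma tame_dot (f g : R -> V -> Z) : (forall i, tame (fun t a => f t a ord0 i)) ->
  (forall i, tame (fun t a => g t a ord0 i)) -> tame (fun t a => dot (f t a) (g t a)).
Proof. by move=> tf tg; apply: tame_sum => i; exact: tame_mul. Qed.

Lemma tame_mulmx (f : R -> V -> Z) (M : R -> 'M[C]_m) : (forall i, tame (fun t a => f t a ord0 i)) ->
  (forall i j, conv0 (fun t => M t i j)) -> forall j, tame (fun t a => (f t a *m M t) ord0 j).
Proof.
move=> tf cM j; apply: (@tame_ext R n _ (fun t a => \sum_i f t a ord0 i * M t i j)).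
  by move=> t a; rewrite mxE.
by apply: tame_sum => i; apply: tame_mul => //; exact: tame_par.
Qed.

Lemma tame_wcrd : tame (fun _ a => wcrd a).
Proof.
apply: tame_add; first exact: tame_crd.
by apply: tame_mul; [apply: tame_dot => i; exact: tame_zpart|exact: tame_cst].
Qed.

Lemma tame_mkV (u w v : R -> V -> C) (z : R -> V -> Z) : tame u -> tame w ->
  (forall i, tame (fun t a => z t a ord0 i)) -> tame v ->
  tame_rows B (fun t a => mkV (u t a) (w t a) (z t a) (v t a)).
Proof.
move=> tu tw tz tv; apply: ord_cases.
- by apply: tame_ext tu => t a; rewrite -[RHS](crd_mkV1 (u t a) (w t a) (z t a) (v t a)).
- by apply: tame_ext tw => t a; rewrite -[RHS](crd_mkV2 (u t a) (w t a) (z t a) (v t a)).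
- move=> i; apply: tame_ext (tz i) => t a.
  by rewrite -[RHS](crd_mkVz (u t a) (w t a) (z t a) (v t a)) /crd addn3 addn2.
- by apply: tame_ext tv => t a; rewrite -[RHS](crd_mkVn (u t a) (w t a) (z t a) (v t a)).
Qed.

Lemma tame_Tm (u w v : R -> V -> C) (z : R -> V -> Z) : tame u -> tame w ->
  (forall i, tame (fun t a => z t a ord0 i)) -> tame v ->
  tame_rows B (fun t a => Tm (u t a) (w t a) (z t a) (v t a)).
Proof.
move=> tu tw tz tv; apply: tame_mkV => //; apply: tame_sub => //.
by apply: tame_mul; [exact: tame_dot|exact: tame_cst].
Qed.

End Rows.

Ltac tm := repeat first [assumption | exact: tame_cst | exact: tame_crd | exact: tame_wcrd | exact: tame_time
  | exact: tame_inv | apply: tame_sub | apply: tame_add | apply: tame_mul].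

Lemma phi_diff (lam Q B : C) (M : 'M[C]_m) (a : V) : 1 - B * crd a 1 != 0 ->
  differentiable (phi lam Q B M) a.
Proof.
move=> d0; apply: (@tame_rows_diff R n (fun=> B) (fun _ a => phi lam Q B M a) _ 0) => //.
have tI : @tame R n (fun=> B) (fun _ a => (1 - B * crd a 1)^-1) by exact: (@tame_inv R n (fun=> B)).
apply: tame_Tm; rewrite ?expr2; tm => //.
- move=> i; apply: (@tame_ext R n _ (fun _ a => lam * (zpart a *m M) ord0 i)).
    by move=> t b; rewrite mxE.
  apply: tame_mul; first exact: tame_cst.
  by apply: (@tame_mulmx _ (fun _ a => zpart a) (fun=> M)) => [j|j k]; [exact: tame_zpart|exact: conv0_cst].
- apply: (@tame_ext R n _ (fun _ a => (1 - B * crd a 1)^-1 * (1 - B * crd a 1)^-1)); last by tm.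
  by move=> t b; rewrite expr2 invfM.
Qed.

Lemma psi_diff (lam Q B : C) (M : 'M[C]_m) (a : V) : 1 + B * crd a 1 != 0 ->
  differentiable (psi lam Q B M) a.
Proof.
move=> d0; apply: (@tame_rows_diff R n (fun=> - B) (fun _ a => psi lam Q B M a) _ 0) => //; last first.
  by rewrite mulNr opprK.
have tI : @tame R n (fun=> - B) (fun _ a => (1 + B * crd a 1)^-1).
  apply: (@tame_ext R n _ _ _ _ (@tame_inv R n (fun=> - B))) => t b.
  by rewrite mulNr opprK.
have tI2 : @tame R n (fun=> - B) (fun _ a => (1 + B * crd a 1) ^- 2).
  apply: (@tame_ext R n _ (fun _ a => (1 + B * crd a 1)^-1 * (1 + B * crd a 1)^-1)); last by tm.
  by move=> t b; rewrite expr2 invfM.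
apply: tame_Tm; rewrite ?[(_ / _) ^+ 2]expr2; tm => //.
- move=> i; apply: (@tame_ext R n _ (fun _ a => lam^-1 * (zpart a *m M) ord0 i)).
    by move=> t b; rewrite mxE.
  apply: tame_mul; first exact: tame_cst.
  by apply: (@tame_mulmx _ (fun _ a => zpart a) (fun=> M)) => [j|j k]; [exact: tame_zpart|exact: conv0_cst].
Qed.

Section Velocity.
Variables (al p q : R) (H : 'M[C]_m).
Hypothesis sH : skew H.
Local Notation r := (real_complex R).

Definition lamt (t : R) : C := r (1 + al * t).
Definition Qt (t : R) : C := II * r (p * t).
Definition Bt (t : R) : C := II * r (q * t / 2).
Definition flow (t : R) : V -> V := phi (lamt t) (Qt t) (Bt t) (cayley (r (t / 2) *: H)).
Definition flow_inv (t : R) : V -> V := psi (lamt t) (Qt t) (Bt t) (cayley (- (r (t / 2) *: H))).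

(** The quotient (flow t - id) / t with the division by t carried out, so that it is defined
   at t = 0 and visibly tame. It uses lam^2 - 1 = t mu, M = 1 + t dcayley, and 1 - B^2 - (1 -
   B u)^2 = 2 B u - B^2 (1 + u^2), which is divisible by t. *)
Definition slope (t : R) (a : V) : V :=
  let u := crd a 1 in let v := crd a n.+1 in let z := zpart a in
  let zL := z *m dcayley H t in
  let i := (1 - Bt t * u)^-1 in
  let mu := 2 * r al + r al * r al * r t in
  let s := mu * v + II * r p * (u * u - 1) in
  mkV (II * r q / 2 * (u * u - 1) * i)
    (mu * crd a 2 - lamt t * lamt t * (dot z zL + r t / 2 * dot zL zL)
       + 2 * II * r p * (u - 1) + II * r q * (v + r t * s) * i)
    (r al *: z + lamt t *: zL)
    (i * i * ((1 - Bt t * Bt t) * s + v * (r q * r q * r t / 4 * (1 + u * u) + II * r q * u))).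

Lemma flowE t a : 1 - Bt t * crd a 1 != 0 -> flow t a = a + r t *: slope t a.
Proof.
move=> d0; rewrite -[X in _ = X + _]mkV_crd mkVZ mkVD /flow /phi /Tm cayleyE// /wcrd.
have I2 : II ^+ 2 = -1 by cring.
have rl : lamt t = 1 + r al * r t by rewrite /lamt rmorphD rmorphM rmorph1.
have rQ : Qt t = II * (r p * r t) by rewrite /Qt rmorphM.
have rB : Bt t = II * (r q * r t / 2) by rewrite /Bt !rmorphM fmorphV rmorph_nat.
move: d0; rewrite !rl !rQ !rB; move: (r al) (r p) (r q) (r t) => l P x y.
set u := crd a 1; set v := crd a n.+1; set z := zpart a; set zL := z *m dcayley H t => d0.
have zM : z *m (1%:M + y *: dcayley H t) = z + y *: zL by rewrite mulmxDr mulmx1 -scalemxAr.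
rewrite zM; move: II I2 d0 => J J2 d0.
have d1 : 2 - J * (x * y) * u != 0.
  rewrite (_ : _ - _ = 2 * (1 - J * (x * y / 2) * u)); last by field.
  by rewrite mulf_neq0 ?pnatr_eq0.
apply: mkV_congr.
- by field.
- rewrite dotZl dotZr !(dotDl, dotDr) !(dotZl, dotZr) [dot zL z]dotC.
  by field.
- by apply/rowP => i; rewrite !mxE; ring.
- apply: (lc (lcM (- (v * x ^+ 2 * y ^+ 2 / 4 * (1 + u ^+ 2) / (1 - J * (x * y / 2) * u) ^+ 2)) J2)).
  by field.
Qed.

Lemma slope0 a : slope 0 a = nform al p q H a.
Proof.
have B0 : Bt 0 = 0 by rewrite /Bt mulr0 mul0r rmorph0 mulr0.
have l0 : lamt 0 = 1 by rewrite /lamt mulr0 addr0.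
have L0 : dcayley H 0 = H.
  have [K _ hK] := dcayley_cvg sH; apply/matrixP => i j.
  have := hK 0 i j; rewrite normr0 mul0r => h; apply/eqP; rewrite -subr_eq0 -normc_eq0.
  by rewrite eq_le h normc_ge0.
rewrite /slope /nform L0 B0 l0 !rmorph0.
apply: mkV_congr.
- by field.
- by field.
- by rewrite scale1r.
- by field.
Qed.

Lemma conv0_lip (c : R -> C) (K : R) : 0 <= K -> (forall t, N (c t - c 0) <= `|t| * K) -> conv0 c.
Proof.
move=> K0 hc eps eps0; have K1 : 0 < K + 1 by rewrite ltr_wpDl.
exists (eps / (K + 1)); first by rewrite divr_gt0.
move=> t; rewrite ltr_pdivlMr// => h; apply: le_trans (hc t) _; apply: le_trans (ltW h).
by rewrite ler_wpM2l// lerDl.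
Qed.

Lemma Bt_le t : N (Bt t) <= `|t| * `|q|.
Proof.
rewrite /Bt normcM normc_real -mulrA [q * _]mulrC -mulrA !normrM.
have -> : N II = 1 by rewrite /= expr0n expr1n add0r sqrtr1.
have -> : `|2^-1 : R| = 2^-1 by rewrite gtr0_norm ?invr_gt0.
by rewrite mul1r mulrCA ler_piMl ?mulr_ge0//; lra.
Qed.

Lemma Bt_conv : conv0 Bt.
Proof.
apply: (@conv0_lip _ `|q|) => // t.
by have -> : Bt 0 = 0; [rewrite /Bt mulr0 mul0r rmorph0 mulr0|rewrite subr0 Bt_le].
Qed.

Lemma slope_tame : tame_rows Bt slope.
Proof.
have tB : @tame R n Bt (fun t _ => Bt t) by exact: tame_par Bt_conv.
have tl : @tame R n Bt (fun t _ => lamt t).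
  apply: (@tame_ext R n _ (fun t _ => 1 + r al * r t)); last by tm.
  by move=> t b; rewrite /lamt rmorphD rmorphM rmorph1.
have L0 : dcayley H 0 = H.
  have [K _ hK] := dcayley_cvg sH; apply/matrixP => i j.
  have := hK 0 i j; rewrite normr0 mul0r => h; apply/eqP; rewrite -subr_eq0 -normc_eq0.
  by rewrite eq_le h normc_ge0.
have tzL i : @tame R n Bt (fun t a => (zpart a *m dcayley H t) ord0 i).
  apply: (@tame_mulmx _ (fun _ a => zpart a) (dcayley H)) => [j|j k]; first exact: tame_zpart.
  have [K K0 hK] := dcayley_cvg sH; apply: (conv0_lip K0) => t.
  by rewrite L0; exact: hK.
have tI : @tame R n Bt (fun t a => (1 - Bt t * crd a 1)^-1) by exact: tame_inv.
have tz i : @tame R n Bt (fun t a => zpart a ord0 i) by exact: tame_zpart.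
have td : @tame R n Bt (fun t a => dot (zpart a) (zpart a *m dcayley H t)) by exact: tame_dot.
have td' : @tame R n Bt (fun t a => dot (zpart a *m dcayley H t) (zpart a *m dcayley H t)) by exact: tame_dot.
apply: tame_mkV; tm => //.
move=> i; apply: (@tame_ext R n _ (fun t a => r al * zpart a ord0 i + lamt t * (zpart a *m dcayley H t) ord0 i)).
  by move=> t a; rewrite ![in LHS]mxE; congr (_ * _ + _ * _); rewrite mxE.
by tm.
Qed.

(** The image of U is open because it is the preimage of U under the inverse map, near each of
   its points. *)
Lemma flow_isotropy (U : set V) t : open U -> U (p0 R n) -> lamt t != 0 ->
  (forall a, U a -> 1 - Bt t * crd a 1 != 0) -> isotropy_on U (flow t).
Proof.
move=> oU U0 l0 d0.
have B2 : 1 - Bt t ^+ 2 != 0.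
  have -> : 1 - Bt t ^+ 2 = r (1 + (q * t / 2) ^+ 2) by rewrite /Bt; cring.
  by rewrite gt_eqF// ltcR; have := sqr_ge0 (q * t / 2); lra.
have sA := skewZ (t / 2) sH.
have K a : U a -> flow_inv t (flow t a) = a.
  by move=> Ua; apply: phiK => //; [exact: cayley_inv|exact: d0].
have K' a : 1 + Bt t * crd a 1 != 0 -> flow t (flow_inv t a) = a.
  by move=> da; apply: psiK => //; rewrite -{2}[_ *: H]opprK; exact: cayley_inv (skewN sA).
have dW a : U a -> 1 + Bt t * crd (flow t a) 1 != 0.
  by move=> Ua; apply: phi_denom => //; exact: d0.
split=> //.
- by apply: phi_p0; have := d0 _ U0; rewrite p0_Tm crd_mkV1 mulr1.
- exists (flow t @` U); split; [exact: oU| |by []| |].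
  + rewrite openE => _ [a Ua <-]; rewrite /interior.
    have c1 : {for flow t a, continuous (flow_inv t)}.
      by apply: differentiable_continuous; apply: psi_diff; exact: dW.
    have c2 : {for flow t a, continuous (fun y : V => 1 + Bt t * crd y 1)}.
      apply: differentiable_continuous; apply: differentiable_addC; first exact: differentiable_cst.
      by apply: differentiable_mulC; [exact: differentiable_cst|exact: differentiable_coord].
    near=> y.
    have dy : 1 + Bt t * crd y 1 != 0.
      near: y; exact: (cvgr_neq0 _ c2 (dW _ Ua)).
    exists (flow_inv t y); last exact: K'.
    near: y; apply: c1; rewrite K//.
    by move: oU; rewrite openE; apply.
  + by move=> a Ua; apply: phi_diff; exact: d0.
  + exists (flow_inv t); last exact: K.
    by move=> _ [a Ua <-]; apply: psi_diff; exact: dW.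
- move=> _ [a [Ua Ga] <-].
  rewrite /flow /lamt /Qt /Bt; apply: phi_Gammat; [exact: cayley_isom sA|exact: d0 Ua|exact: Ga].
Unshelve. all: by end_near.
Qed.

(** U is a neighbourhood of p0 on which X is in normal form and the coordinates differ from
   those of p0 by less than 1. The bound e on the parameter makes |B u| at most 1 / 2 and lam
   positive. *)
Lemma nform_isotropy_algebra (X : V -> V) :
  (\forall a \near p0 R n, X a = nform al p q H a) -> isotropy_algebra X.
Proof.
move=> hX.
pose P := [set a : V | X a = nform al p q H a /\ forall k, N ((a - p0 R n) ord0 k) < 1].
have P0 : nbhs (p0 R n) P.
  have h1 : nbhs (p0 R n) [set a : V | forall k, N ((a - p0 R n) ord0 k) < 1].
    apply/nbhs_ballP; exists 1 => //= a [_ /(_ ord0) hb] k.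
    by have := hb k; rewrite !mxE -ball_normE /= norm_normc ltcR normcB.
  by apply: filterS2 hX h1 => a.
have PU : interior P (p0 R n) by [].
pose e : R := (4 * (1 + `|q| + `|al|))^-1.
have s0 : 0 < 1 + `|q| + `|al| by have := normr_ge0 q; have := normr_ge0 al; lra.
have e0 : 0 < e by rewrite invr_gt0 mulr_gt0.
have small (x t : R) : `|x| <= 1 + `|q| + `|al| -> `|t| < e -> `|t| * `|x| <= 4^-1.
  move=> hx te; have -> : 4^-1 = e * (1 + `|q| + `|al|) by rewrite /e; field; rewrite gt_eqF.
  by apply: ler_pM => //; exact: ltW.
have Ub (a : V) : interior P a -> forall k, N (a ord0 k) <= 2.
  move=> /interior_subset[_ ha] k; rewrite -(subrK (p0 R n) a) mxE.
  apply: le_trans (le_normcD _ _) _; have -> : (2 : R) = 1 + 1 by ring.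
  apply: lerD; first exact/ltW/ha.
  by rewrite mxE; case: (_ && _); rewrite ?normc00 ?(normc_real 1) ?normr1 ?ler01.
have low t (a : V) : `|t| < e -> interior P a -> 2^-1 <= N (1 - Bt t * a ord0 (inord 0)).
  move=> te Ua.
  have B4 : N (Bt t) <= 4^-1.
    apply: le_trans (Bt_le t) (small q t _ te).
    by have := normr_ge0 al; lra.
  have hBu : N (Bt t * a ord0 (inord 0)) <= 4^-1 * 2.
    by rewrite normcM ler_pM ?normc_ge0// Ub.
  have := le_normcD (1 - Bt t * a ord0 (inord 0)) (Bt t * a ord0 (inord 0)).
  by rewrite subrK (normc_real 1) normr1; move: hBu; clear; move: (N _) (N _) => x y; lra.
exists (interior P), e, flow; split=> //.
- move=> t te; apply: flow_isotropy => //; first exact: open_interior.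
    rewrite gt_eqF// ltcR.
    have h : `|t| * `|al| <= 4^-1 by apply: small => //; have := normr_ge0 q; lra.
    have : `|al * t| <= 4^-1 by rewrite normrM mulrC.
    by rewrite ler_norml => /andP[]; lra.
  by move=> a Ua; exact: (denom_neq0 low te Ua).
- move=> a Ua; rewrite flowE; first by rewrite rmorph0 scale0r addr0.
  by apply: (denom_neq0 low _ Ua); rewrite normr0.
- move=> a Ua; apply: (near_eq_differentiable (G := slope 0)).
    have : nbhs a (interior P) by apply: open_nbhs_nbhs; split=> //; exact: open_interior.
    by apply: filterS => b /interior_subset[-> _]; rewrite slope0.
  by apply: (tame_rows_diff slope_tame); apply: (denom_neq0 low _ Ua); rewrite normr0.
- apply: (tame_velocity e0 (@open_interior _ P) Ub Bt_conv low slope_tame).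
    by move=> t a te Ua; apply: flowE; exact: (denom_neq0 low te Ua).
  by move=> a /interior_subset[-> _]; rewrite slope0.
Qed.
End Velocity.
End Curve.
End Curves.

Theorem theorem3 (R : realType) (n : nat) (hn : (3 <= n)%N) :
  let N := (n ^ 2 + 7 - 4 * n)%N in
  [/\ size (isotropy_fields R n) = N,
      forall X : 'rV[R[i]]_n.+1 -> 'rV[R[i]]_n.+1,
        isotropy_algebra X <->
        exists c : 'I_N -> R, \forall z \near p0 R n, X z = isotropy_comb c z &
      forall c : 'I_N -> R,
        (\forall z \near p0 R n, isotropy_comb c z = 0) -> forall m, c m = 0].
Proof.
case: n hn => [|[|[|m]]]// _ N.
have hN : N = size (labels m.+1) by rewrite size_labels.
have k0 : 'I_m.+1 := ord0.
split.
- by rewrite isotropy_fields_labels size_map hN.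
- move=> X; split.
    move=> /(isotropy_algebra_nform k0)[al [p [q [H [sH XE]]]]].
    have [c hc] := isotropy_comb_surj al p q hN sH.
    by exists c; apply: filterS XE => a ->.
  move=> [c hc]; apply: (nform_isotropy_algebra (skew_Hmat (coef m.+1 c))) => /=.
  by apply: filterS hc => a ->; exact: isotropy_comb_nform.
- by move=> c hc; exact: (isotropy_comb_inj k0 hN hc).
Qed.
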